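(* Let $\alpha>2$ and $\gamma=1/\alpha$. Assume that $U$ satisfies $\lim_{t\to\infty}U(tx)/U(t)=x^{\gamma}$ for every $x>0$, and that there exist $t_0>0$ and $\eta\in[0,1)$ such that $U(tx)/U(t)\ge(1-\eta)x^{\gamma}+\eta$ for all $t\ge t_0$ and $x\ge 1$. Suppose that the network is generated under either the ordered Norros-Reittu model or the ordered Chung-Lu model. Suppose that the following second order condition holds: there exist $\rho\le0$ and a function $A$ of constant sign such that for every $x>0$ $$\lim_{t\to\infty}\frac{\frac{U(tx)}{U(t)}-x^{\gamma}}{A(t)}=x^{\gamma}\,\frac{x^{\rho}-1}{\rho}$$ (the right-hand side being understood as $x^{\gamma}\log x$ when $\rho=0$). Suppose further that $k(n)\to\infty$, $k(n)\,(\log n)^{\alpha}/n^{\frac{1}{4\alpha+1}}\to0$ and $k(n)A(n/k(n))\to0$ as $n\to\infty$. Then, as $n\to\infty$, $$\sqrt{k(n)}\left(\hat\gamma^{\mathrm{PWM}}_D(n)-\gamma\right)\Rightarrow N\left(0,\tau^{\mathrm{PWM}}\right),\qquad \tau^{\mathrm{PWM}}=\frac{(1-\gamma)(2-\gamma)^2(1-\gamma+2\gamma^2)}{(1-2\gamma)(3-2\gamma)}.$$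
   Context: Notation: $[n]=\{1,\dots,n\}$, $x\wedge y=\min(x,y)$, and $\Rightarrow$ denotes convergence in distribution; $N(0,\tau)$ is the normal law with mean $0$ and variance $\tau$. Let $F$ be a continuous distribution function supported on the positive reals, and let $W_1,W_2,\dots,W_n$ be independent with distribution function $F$. Let $W_{(1)}(n)\ge W_{(2)}(n)\ge\dots\ge W_{(n)}(n)$ be their decreasing order statistics and $L(n)=\sum_{i=1}^n W_i$. Let $U(t)=F^{\leftarrow}(1-1/t)$ for $t\ge1$, where $F^{\leftarrow}(y)=\inf\{x:F(x)\ge y\}$. Ordered random graph models on $n$ nodes: $\{A_{ij}(n)\}_{i,j=1}^n$ is a random symmetric adjacency matrix (unrelated to the function $A$ in the second order condition) whose entries with $1\le i\le j\le n$ are, conditionally on $\{W_{(i)}(n)\}_{i\in[n]}$, independent. In the (ordered) Norros-Reittu model, $A_{ij}(n)\mid\{W_{(i)}(n)\}_{i\in[n]}\sim\mathrm{Poisson}\left(W_{(i)}(n)W_{(j)}(n)/L(n)\right)$ for $1\le i\le j\le n$. In the (ordered) Chung-Lu model, $A_{ij}(n)\mid\{W_{(i)}(n)\}_{i\in[n]}\sim\mathrm{Bernoulli}\left(\frac{W_{(i)}(n)W_{(j)}(n)}{L(n)}\wedge1\right)$ for $1\le i\le j\le n$. The degree of node $i$ is $D_i(n)=\sum_{j=1}^n A_{ij}(n)$, and $D_{(1)}(n)\ge D_{(2)}(n)\ge\dots\ge D_{(n)}(n)$ are the decreasing order statistics of the degrees $D_1(n),\dots,D_n(n)$. $k(n)$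 denotes a sequence of positive integers. The degree-based probability weighted moment (PWM) estimator is $$\hat\gamma^{\mathrm{PWM}}_D(n)=\frac{\hat I^{(1)}_D(n)-4\hat I^{(2)}_D(n)}{\hat I^{(1)}_D(n)-2\hat I^{(2)}_D(n)},\qquad \hat I^{(q)}_D(n)=\frac{1}{k(n)-1}\sum_{i=1}^{k(n)-1}\left(\frac{i}{k(n)-1}\right)^{q-1}\left(D_{(i)}(n)-D_{(k(n))}(n)\right),\quad q=1,2.$$ *)

(* Defs.v *)
From HB Require Import structures.
From mathcomp Require Import all_boot all_order all_algebra.
From mathcomp Require Import all_classical all_reals all_analysis.
From mathcomp Require Import measurable_realfun.

Set Implicit Arguments.
Unset Strict Implicit.
Unset Printing Implicit Defensive.

Import Order.TTheory GRing.Theory Num.Theory.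
Import numFieldNormedType.Exports.

Local Open Scope classical_set_scope.
Local Open Scope ring_scope.

Section quantile.
Context {R : realType}.
Implicit Types (F U A : R -> R).

Definition left_inverse F (y : R) : R := inf [set x | y <= F x].

(* Only the values at t > 1 are meaningful; U(1) is the junk value of inf. *)
Definition tail_quantile F (t : R) : R := left_inverse F (1 - t^-1).

Definition regularly_varying U (gamma : R) :=
  forall x, 0 < x -> U (t * x) / U t @[t --> +oo] --> x `^ gamma.

Definition second_order_limit (gamma rho x : R) : R :=
  x `^ gamma * (if rho == 0 then ln x else (x `^ rho - 1) / rho).

(* A matters only near +oo, so its sign is only required to be constant there;
   the sign is strict, as A is a denominator. *)
Definition constant_sign A :=
  (\forall t \near +oo, 0 < A t) \/ (\forall t \near +oo, A t < 0).

Definition second_order_condition U A (gamma rho : R) :=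
  forall x, 0 < x ->
    (U (t * x) / U t - x `^ gamma) / A t @[t --> +oo]
      --> second_order_limit gamma rho x.

End quantile.

Section order_statistics.
Context {R : realType} {n : nat}.
Implicit Type x : 'I_n -> R.

(* The i-th largest entry x_(i), counted from 1: meaningful for 1 <= i <= n. *)
Definition order_stat x (i : nat) : R := nth 0 (sort >=%R (codom x)) i.-1.

Definition pwm_moment x (k q : nat) : R :=
  (k.-1)%:R^-1 *
  \sum_(1 <= i < k)
    (i%:R / (k.-1)%:R) ^+ q.-1 * (order_stat x i - order_stat x k).

Definition pwm_estimator x (k : nat) : R :=
  (pwm_moment x k 1 - 4 * pwm_moment x k 2) /
  (pwm_moment x k 1 - 2 * pwm_moment x k 2).

End order_statistics.

Section probability_notions.
Context {d : measure_display} {T : measurableType d} {R : realType}.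
Variable P : probability T R.
Implicit Types (G : set (set T)) (E : set T).

(* Taking some of the S i to be setT gives the product rule for subfamilies. *)
Definition mutually_independent {d'} {T' : measurableType d'} {I : finType}
    (X : I -> {RV P >-> T'}) :=
  forall S : I -> set T', (forall i, measurable (S i)) ->
    P [set w | forall i, S i (X i w)] = (\prod_i P (X i @^-1` S i))%E.

(* f is a version of the conditional probability P(E | <<s G >>); below, G is
   always a sub-sigma-algebra, so that <<s G >> is G itself. *)
Definition is_cond_prob G E (f : T -> \bar R) :=
  measurable_fun [set: g_sigma_algebraType G] (f : g_sigma_algebraType G -> \bar R)
  /\ forall B, <<s G >> B -> (\int[P]_(w in B) f w)%E = P (E `&` B).

Definition cond_law {d'} {T' : measurableType d'} G (X : {RV P >-> T'})
    (kappa : T -> set T' -> \bar R) :=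
  forall S, measurable S -> is_cond_prob G (X @^-1` S) (kappa ^~ S).

(* The choice of the versions f i is immaterial, since they are a.s. unique. *)
Definition cond_independent {d'} {T' : measurableType d'} {I : finType}
    G (D : pred I) (X : I -> {RV P >-> T'}) :=
  forall (S : I -> set T') (f : I -> T -> \bar R),
    (forall i, D i -> measurable (S i)) ->
    (forall i, D i -> is_cond_prob G (X i @^-1` S i) (f i)) ->
    is_cond_prob G [set w | forall i, D i -> S i (X i w)]
      (fun w => \prod_(i | D i) f i w)%E.

End probability_notions.

(* The X n may live on different probability spaces; their measurability is part
   of the definition. *)
Definition cvg_in_distribution {R : realType} (d : nat -> measure_display)
    (T : forall n, measurableType (d n)) (P : forall n, probability (T n) R)
    (X : forall n, T n -> R) (mu : set R -> \bar R) :=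
  (forall n, measurable_fun [set: T n] (X n)) /\
  (forall x : R, {for x, continuous (fun y : R => mu `]-oo, y]%classic)} ->
    P n [set w | X n w <= x] @[n --> \oo] --> mu `]-oo, x]%classic).

Section ordered_graph.
Context {d : measure_display} {T : measurableType d} {R : realType}.
Context {P : probability T R} {n : nat}.
Variables (W : 'I_n -> {RV P >-> R}) (A : 'I_n -> 'I_n -> {RV P >-> nat}).

Definition ordered_weight (i : 'I_n) (w : T) : R :=
  order_stat (fun l => W l w) i.+1.

Definition edge_parameter (i j : 'I_n) (w : T) : R :=
  ordered_weight i w * ordered_weight j w / \sum_l W l w.

(* law r is the conditional distribution of an entry with parameter r. *)
Definition ordered_graph_model (law : R -> set nat -> \bar R) :=
  let G := g_sigma_preimage ordered_weight in
  [/\ forall i j w, A i j w = A j i w,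
      forall i j : 'I_n, (i <= j)%N ->
        cond_law G (A i j) (fun w => law (edge_parameter i j w)) &
      cond_independent G (fun p : 'I_n * 'I_n => p.1 <= p.2)%N
        (fun p => A p.1 p.2)].

(* The second argument of poisson_prob is a dummy. *)
Definition norros_reittu :=
  ordered_graph_model (fun r => poisson_prob r 0%N).

(* bernoulli_prob lives on bool and is transported to {0, 1} in nat. *)
Definition chung_lu :=
  ordered_graph_model
    (fun r => pushforward (bernoulli_prob (Num.min r 1)) nat_of_bool).

Definition degree (w : T) (i : 'I_n) : R := (\sum_j A i j w)%N%:R.

End ordered_graph.

(* Main.v *)
Require Import Defs.
From HB Require Import structures.
From mathcomp Require Import all_boot all_order all_algebra.
From mathcomp Require Import all_classical all_reals all_analysis.
From mathcomp Require Import measurable_realfun ring lra zify.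

Set Implicit Arguments.
Unset Strict Implicit.
Unset Printing Implicit Defensive.

Import Order.TTheory GRing.Theory Num.Theory.
Import numFieldNormedType.Exports.

Local Open Scope classical_set_scope.
Local Open Scope ring_scope.

(** Up to the flat parts of [F], the weights are [W_i = U (exp E_i)] with
[E_i = - ln (1 - F W_i)]: the [E_i] are independent standard exponential
variables ([exp_coord_law]), and ordering the weights orders the [E_i].

The spacings [E_(i) - E_(k)], [i < k], have, up to the order of the entries,
the law of [k - 1] independent exponential variables ([top_spacings_law]): this
is the lack of memory above the random level [E_(k)].  The second order
condition turns [W_(i) / W_(k)] into [exp (gamma (E_(i) - E_(k)))] with a
relative error of order [a (n / k) * sqrt k] ([log_quantile_increment],
[weight_ratio_le]), which is [o (1 / sqrt k)] because [k * a (n / k)] goes to 0.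
The uniformity needed there, up to spacings of order [2 ln k], is a Potter bound
for the second order condition ([potter_bound]).

The two models satisfy the same Chernoff bound given the weights, since the
Bernoulli and Poisson entries both have a moment generating function below the
Poisson one ([degree_concentration]).  Hence all the [n] degrees are, with high
probability, within a power of [n] of the corresponding ordered weights, with an
exponent as close to [gamma / 2] as desired.  Order statistics are Lipschitz for the sup norm, so the ordered
degrees are as close to the ordered weights, although the degrees are not ordered
as the weights are.  The growth condition on [k] makes this error
negligible with respect to [W_(k) / sqrt k] ([near_degree_error]).

The estimator being invariant under scaling, dividing by [W_(k)] replaces it by
the same ratio computed from [exp (gamma t_i)] for an exponential sample [t].
The second moment, written over all pairs as a mean of minima, is symmetric in
[t]; its Hoeffding decomposition ([sum_min_hoeffding]) leaves a sum of
independent centred scores and a degenerate part of variance [O (1 / k^2)]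
([degenerate_ustat_variance]).  The variance of the score [pwm_score] divided by
the square of the limit [den_limit] of the denominator is the variance in the
theorem.  The central limit theorem for the scores is obtained from the bounded
solutions of Stein's equation for piecewise linear test functions
([stein_solution], [stein_bound], [clt]).  Slutsky's lemma, in a form with a
relative error ([slutsky]), puts the pieces together. *)

(** * Joint laws of finitely many random variables *)

Section tuple_measures.
Context {d} {T : measurableType d} {R : realType} {n : nat}.

Definition box (S : 'I_n -> set T) : set (n.-tuple T) :=
  [set t | forall i, S i (tnth t i)].

Lemma measurable_box (S : 'I_n -> set T) :
  (forall i, measurable (S i)) -> measurable (box S).
Proof.
move=> mS.
have -> : box S = \bigcap_(i in [set: 'I_n]) ((@tnth n T ^~ i) @^-1` S i).
  by apply/seteqP; split => [t St i _|t St i]; exact: St.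
apply: fin_bigcap_measurable => // i _.
by rewrite -[X in measurable X]setTI; exact: measurable_tnth.
Qed.

(** Boxes form a pi-system generating the product sigma-algebra. *)
Lemma eq_measure_tuple (m1 m2 : {measure set (n.-tuple T) -> \bar R}) :
  (m1 setT < +oo)%E ->
  (forall S : 'I_n -> set T, (forall i, measurable (S i)) ->
     m1 (box S) = m2 (box S)) ->
  forall A, measurable A -> m1 A = m2 A.
Proof.
move=> m1oo m12 A mA.
pose G := [set B | exists2 S : 'I_n -> set T, (forall i, measurable (S i)) & B = box S].
have GT : G setT by exists (fun=> setT) => //; apply/seteqP; split.
apply: (measure_unique G (fun=> setT)) => //.
- rewrite eqEsubset; split.
    apply: smallest_sub; first exact: smallest_sigma_algebra.
    move=> B; rewrite -bigcup_seq => -[/= i _ [S mS <-]].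
    apply: sub_sigma_algebra; exists (fun j => if j == i then S else setT).
      by move=> j; case: ifP.
    apply/seteqP; split => t /=.
      by move=> [_ St] j; case: eqP => [->|].
    by move=> /(_ i); rewrite eqxx.
  apply: smallest_sub; first exact: sigma_algebra_measurable.
  by move=> _ [S mS ->]; exact: measurable_box.
- move=> _ _ [S mS ->] [S' mS' ->]; exists (fun i => S i `&` S' i).
    by move=> i; exact: measurableI.
  apply/seteqP; split => t /=.
    by move=> [h h'] i; split; [exact: h|exact: h'].
  by move=> h; split => i; have [] := h i.
- by rewrite bigcup_const.
- by move=> _ [S mS ->]; exact: m12.
Qed.
End tuple_measures.

Section freezing.
Context {d d1 d2} {T : measurableType d} {T1 : measurableType d1}
  {T2 : measurableType d2} {R : realType} (P : probability T R).
Variables (X : {RV P >-> T1}) (Y : {RV P >-> T2}).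
Hypothesis XY_indep : forall A B, measurable A -> measurable B ->
  P (X @^-1` A `&` Y @^-1` B) = (P (X @^-1` A) * P (Y @^-1` B))%E.

Let XY := fun w => (X w, Y w).

Let mXY : measurable_fun setT XY.
Proof. exact: measurable_fun_pair. Qed.

HB.instance Definition _ := isMeasurableFun.Build _ _ _ _ XY mXY.

Lemma distribution_pair A : measurable A ->
  distribution P XY A = (distribution P X \x distribution P Y)%E A.
Proof.
move=> mA; apply/esym; apply: product_measure_unique; last exact: mA.
by move=> B C mB mC; exact: XY_indep.

Qed.

Lemma freezing_ge0 (g : T1 * T2 -> \bar R) : measurable_fun setT g ->
  (forall z, 0 <= g z)%E ->
  (\int[P]_w g (X w, Y w) = \int[P]_w \int[distribution P Y]_y g (X w, y))%E.
Proof.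
move=> mg g0.
transitivity (\int[distribution P X \x distribution P Y]_z g z)%E.
  rewrite (eq_measure_integral (distribution P XY)); last first.
    by move=> A mA _; apply/esym; exact: distribution_pair.
  by rewrite ge0_integral_distribution.
rewrite fubini_tonelli1// ge0_integral_distribution //.
  exact: measurable_fun_fubini_tonelli_F.
by move=> x; apply: integral_ge0.
Qed.

Section freezing_integrable.
Variables (g : T1 * T2 -> R) (mg : measurable_fun setT g).
Hypothesis g_int : P.-integrable setT (EFin \o (fun w => g (X w, Y w))).

Let mEg : measurable_fun setT (EFin \o g). Proof. exact/measurable_EFinP. Qed.

Let g_law_int :
  (distribution P X \x distribution P Y)%E.-integrable setT (EFin \o g).
Proof.
apply/integrableP; split => //.
have /integrableP[_] := integrable_pushforward (mu := P) mXY mEg (D := setT) g_int measurableT.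
rewrite (eq_measure_integral (distribution P X \x distribution P Y)%E)// => A mA _.
exact: distribution_pair.
Qed.

Lemma freezing :
  (\int[P]_w (g (X w, Y w))%:E =
   \int[P]_w \int[distribution P Y]_y (g (X w, y))%:E)%E.
Proof.
transitivity (\int[distribution P X \x distribution P Y]_z (g z)%:E)%E.
  rewrite (eq_measure_integral (distribution P XY)); last first.
    by move=> A mA _; apply/esym; exact: distribution_pair.
  by rewrite integral_distribution.
rewrite -(integral12_prod_meas1 g_law_int) /= integral_distribution //.
  exact: measurable_fubini_F g_law_int.
have /integrableP[mF Foo] := integrable_fubini_F g_law_int.
apply/integrableP; split; first exact: measurableT_comp.
move: Foo; rewrite ge0_integral_distribution //.
exact: measurableT_comp.
Qed.

(** A bound on the conditional mean that is uniform in the frozen variable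
needs no integrability of the conditional mean itself. *)
Lemma freezing_norm_le (K : R) :
  (forall x, `|\int[distribution P Y]_y (g (x, y))%:E| <= K%:E)%E ->
  (`|\int[P]_w (g (X w, Y w))%:E| <= K%:E)%E.
Proof.
move=> gK; rewrite freezing.
have mF := measurableT_comp (measurable_fubini_F g_law_int) (measurable_funPT X).
apply: le_trans (le_abse_integral P measurableT mF) _.
have K0 : (0 <= K%:E)%E by apply: le_trans (gK point); exact: abse_ge0.
apply: (@le_trans _ _ (\int[P]_w K%:E)%E).
  apply: ge0_le_integral => //.
    by apply: measurableT_comp.
  by move=> w _; exact: gK.
by rewrite integral_cst// [X in (_ * X)%E](@probability_setT _ _ _ P) mule1.
Qed.

End freezing_integrable.

End freezing.

Section independence.
Context {d} {T : measurableType d} {R : realType} (P : probability T R) {n : nat}.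
Context {d'} {T' : measurableType d'}.
Variables (X : 'I_n -> {RV P >-> T'}) (X_indep : mutually_independent X).

(** Every coordinate but [X i]; the entry of rank [i] is the junk value [x0]. *)
Definition rest_tuple (x0 : T') (i : 'I_n) (w : T) : n.-tuple T' :=
  [tuple if j == i then x0 else X j w | j < n].

Lemma measurable_rest_tuple x0 i : measurable_fun setT (rest_tuple x0 i).
Proof.
apply/measurable_fun_tnthP => j; rewrite /comp /=.
under eq_fun do rewrite tnth_mktuple.
by case: (j == i); [exact: measurable_cst|exact: measurable_funPT].
Qed.

HB.instance Definition _ x0 i :=
  isMeasurableFun.Build _ _ _ _ (rest_tuple x0 i) (measurable_rest_tuple x0 i).

Lemma rest_tuple_indep x0 i A B : measurable A -> measurable B ->
  P (rest_tuple x0 i @^-1` B `&` X i @^-1` A) =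
  (P (rest_tuple x0 i @^-1` B) * P (X i @^-1` A))%E.
Proof.
move=> mA mB; have mXA : measurable (X i @^-1` A) by exact: measurable_funPTI.
pose m1 := pushforward (mrestr P mXA) (rest_tuple x0 i).
pose m2 := mscale (NngNum (fine_ge0 (measure_ge0 P (X i @^-1` A)))) (distribution P (rest_tuple x0 i)).
have PXA : (fine (P (X i @^-1` A)))%:E = P (X i @^-1` A).
  by rewrite fineK// fin_num_measure.
have prodE (S : 'I_n -> set T') C : (forall j, measurable (S j)) -> measurable C ->
    P [set w | forall j, (if j == i then C else S j) (X j w)] =
    (P (X i @^-1` C) * \prod_(j | j != i) P (X j @^-1` S j))%E.
  move=> mS mC; have := X_indep (S := fun j => if j == i then C else S j).
  rewrite (bigD1 i)//= eqxx => ->; last by move=> j; case: ifP.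
  by congr (_ * _)%E; apply: eq_bigr => j /negbTE ->.
suff <- : m1 B = P (rest_tuple x0 i @^-1` B `&` X i @^-1` A).
  suff -> : m1 B = m2 B by rewrite /m2 /= /mscale /= PXA muleC.
  apply: (eq_measure_tuple (m1 := m1)) => // [|S mS].
    rewrite /m1 /= /pushforward /= /mrestr preimage_setT setTI.
    by rewrite (le_lt_trans (probability_le1 P mXA)) ?ltry.
  rewrite /m1 /m2 /= /pushforward /mscale /= PXA /distribution /pushforward /mrestr /=.
  have [Sx0|Sx0] := pselect (S i x0); last first.
    rewrite (_ : _ @^-1` _ = set0) ?set0I ?measure0 ?mule0//.
    apply/seteqP; split => // w /= /(_ i).
    by rewrite tnth_mktuple eqxx.
  have -> : rest_tuple x0 i @^-1` box S =
      [set w | forall j, (if j == i then setT else S j) (X j w)].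
    apply/seteqP; split => w /= wS j; have := wS j; rewrite tnth_mktuple;
      by case: eqVneq => // ->.
  have -> : [set w | forall j, (if j == i then setT else S j) (X j w)] `&` X i @^-1` A =
      [set w | forall j, (if j == i then A else S j) (X j w)].
    apply/seteqP; split => w /=.
      by move=> [wS wA] j; have := wS j; case: eqVneq => // ->.
    move=> wS; split; last by have := wS i; rewrite eqxx.
    by move=> j; have := wS j; case: eqVneq.
  rewrite !prodE// preimage_setT probability_setT mul1e muleC.
  by [].
by [].
Qed.

Lemma freezing_coordinate_norm_le x0 i (mu : probability T' R)
    (g : n.-tuple T' * T' -> R) (K : R) :
  (forall A, measurable A -> P (X i @^-1` A) = mu A) ->
  measurable_fun setT g ->
  P.-integrable setT (EFin \o (fun w => g (rest_tuple x0 i w, X i w))) ->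
  (forall t, mu.-integrable setT (EFin \o (fun x => g (t, x)))) ->
  (forall t, `|\int[mu]_x g (t, x)| <= K) ->
  `|\int[P]_w g (rest_tuple x0 i w, X i w)| <= K.
Proof.
move=> X_law mg ig igt gK.
have XY A B : measurable A -> measurable B ->
    P (rest_tuple x0 i @^-1` A `&` X i @^-1` B) =
    (P (rest_tuple x0 i @^-1` A) * P (X i @^-1` B))%E.
  by move=> mA mB; exact: rest_tuple_indep.
rewrite -lee_fin EFin_normr_Rintegral//.
apply: (freezing_norm_le XY mg ig) => t.
rewrite (eq_measure_integral mu); last by move=> A mA _; exact: X_law.
by rewrite -EFin_normr_Rintegral// lee_fin.
Qed.

End independence.

(** * Order statistics *)

Section order_statistics_theory.
Context {R : realType} {n : nat}.
Implicit Types (x y : 'I_n -> R) (c : R) (i j : 'I_n).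

Lemma size_codomI x : size (codom x) = n.
Proof. by rewrite size_codom card_ord. Qed.

Lemma sorted_order_stat x : sorted >=%R (sort >=%R (codom x)).
Proof. by apply: sort_sorted => a b; exact: le_total. Qed.

Lemma order_stat_le x (k l : nat) : (0 < k)%N -> (k <= l <= n)%N ->
  order_stat x l <= order_stat x k.
Proof.
move=> k0 /andP[kl ln]; rewrite /order_stat.
have tr : transitive (>=%R : rel R) by move=> a b c' /[swap]; exact: le_trans.
apply: (sorted_leq_nth tr (@lexx _ R) 0 (sorted_order_stat x)); rewrite ?inE ?size_sort ?size_codomI; lia.
Qed.

Lemma order_stat_gt x c (k : nat) : (0 < k <= n)%N ->
  (c < order_stat x k) = (k <= #|[set j | (c < x j)%R]%SET|)%N.
Proof.
move=> /andP[k0 kn]; set s := sort >=%R (codom x).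
have -> : #|[set j | (c < x j)%R]%SET| = count (fun r => c < r) s.
  rewrite /s (permP (permEl (perm_sort _ _))) /codom /image_mem count_map.
  by rewrite -sum1_card -sum1_count big_enum_cond/=; apply: eq_bigl => j; rewrite inE.
rewrite /order_stat -/s.
have ss : size s = n by rewrite size_sort size_codomI.
have tr : transitive (>=%R : rel R) by move=> a b c' /[swap]; exact: le_trans.
have srt : sorted >=%R s := sorted_order_stat x.
have st : size (take k s) = k by rewrite size_takel ?ss.
rewrite -{2}(cat_take_drop k s) count_cat.
apply/idP/idP => [ck|].
  rewrite (@leq_trans (count (fun r => c < r) (take k s)))// ?leq_addr//.
  suff : all (fun r => c < r) (take k s).
    by rewrite all_count => /eqP ->; rewrite st.
  apply/(all_nthP 0) => i; rewrite st => ik.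
  rewrite nth_take//; apply: lt_le_trans ck _.
  by apply: (sorted_leq_nth tr (@lexx _ R) 0 srt); rewrite ?inE ?ss; lia.
apply: contraTT; rewrite -leNgt -ltnNge => ck.
have /eqP -> : count (fun r => c < r) (drop k s) == 0%N.
  rewrite -leqn0 leqNgt -has_count; apply/hasPn => r /(nthP 0)[i].
  rewrite size_drop ss nth_drop => ik <-; rewrite -leNgt.
  apply: le_trans ck; apply: (sorted_leq_nth tr (@lexx _ R) 0 srt); rewrite ?inE ?ss; lia.
have -> : take k s = rcons (take k.-1 s) s`_k.-1.
  by rewrite -take_nth ?prednK// ss; lia.
rewrite -cats1 count_cat /= ltNge ck /= !addn0.
by rewrite -[ltnRHS](prednK k0) ltnS (leq_trans (count_size _ _))// size_takel ?ss//; lia.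
Qed.

Lemma order_stat_homo x y e (k : nat) : (0 < k <= n)%N ->
  (forall j, x j <= y j + e) -> order_stat x k <= order_stat y k + e.
Proof.
move=> kn xy; rewrite leNgt; apply/negP; rewrite -ltrBrDr.
rewrite -ltrBlDr opprK => h.
suff: order_stat y k < order_stat y k by rewrite ltxx.
rewrite order_stat_gt//; move: h; rewrite order_stat_gt// => /leq_trans; apply.
apply: subset_leq_card; apply/fintype.subsetP => j; rewrite !inE => /lt_le_trans/(_ (xy j)).
by rewrite ltrD2r.
Qed.

(** Order statistics are 1-Lipschitz for the sup norm, whatever the reordering. *)
Lemma order_stat_lipschitz x y e (k : nat) : (0 < k <= n)%N ->
  (forall j, `|x j - y j| <= e) -> `|order_stat x k - order_stat y k| <= e.
Proof.
move=> kn xy; rewrite ler_distl; apply/andP; split.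
  rewrite lerBlDr; apply: order_stat_homo => // j.
  by have := xy j; rewrite ler_distl => /andP[]; rewrite lerBlDr.
by apply: order_stat_homo => // j; have := xy j; rewrite ler_distl => /andP[].
Qed.

Lemma order_stat_mem x (k : nat) : (0 < k <= n)%N -> exists j, order_stat x k = x j.
Proof.
move=> kn; have : order_stat x k \in codom x.
  by rewrite -(mem_sort >=%R) mem_nth// size_sort size_codomI; lia.
by move=> /codomP.
Qed.

Lemma order_stat_sum (f : R -> R) x :
  \sum_(i < n) f (order_stat x i.+1) = \sum_(i < n) f (x i).
Proof.
transitivity (\sum_(r <- sort >=%R (codom x)) f r).
  by rewrite [RHS](big_nth 0) size_sort size_codomI big_mkord.
rewrite (perm_big (codom x)) ?perm_sort//= big_map.
by rewrite big_enum.
Qed.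

(** Monotonicity of [h] is only asked between values of [x]. *)
Lemma order_stat_comp (h : R -> R) x (k : nat) : (0 < k <= n)%N ->
  (forall i j, x i <= x j -> h (x i) <= h (x j)) ->
  order_stat (h \o x) k = h (order_stat x k).
Proof.
move=> kn hx; rewrite /order_stat.
suff -> : sort >=%R (codom (h \o x)) = map h (sort >=%R (codom x)).
  by rewrite (nth_map 0)// size_sort size_codomI; lia.
have tr : transitive (>=%R : rel R) by move=> a b c' /[swap]; exact: le_trans.
have asym : antisymmetric (>=%R : rel R) by move=> a b /= ab; apply/le_anti; rewrite andbC.
apply: (sorted_eq tr asym).
- exact: sorted_order_stat.
- rewrite sorted_map.
  have := sorted_order_stat x.
  apply: (@sub_in_sorted _ (mem (codom x))).
    by move=> _ _ /codomP[i ->] /codomP[j ->] /=; exact: hx.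
  by apply/allP => r; rewrite mem_sort.
- rewrite perm_sort perm_sym; apply: (@perm_trans _ (map h (codom x))).
    by rewrite perm_map// perm_sort.
  by rewrite /codom /image_mem -map_comp.
Qed.

End order_statistics_theory.

Section top_order_statistics.
Context {R : realType} {n : nat}.
Implicit Types (x : 'I_n -> R) (i j l : 'I_n).

(** The indices beating [l], ties being broken in favour of small indices: with
    this tie-break each rank is held by exactly one index. *)
Definition above x l : {set 'I_n} :=
  [set j | (x l < x j) || ((x l == x j) && (j < l)%N)]%SET.

Lemma above_irr x l : l \notin above x l.
Proof. by rewrite !inE ltxx ltnn andbF. Qed.

Lemma above_trans x j l i : j \in above x l -> i \in above x j -> i \in above x l.
Proof.
rewrite !inE => /orP[lj|/andP[/eqP lj jl]] /orP[ji|/andP[/eqP ji ij]].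
- by rewrite (lt_trans lj ji).
- by rewrite -ji lj.
- by rewrite lj ji.
- by rewrite lj ji eqxx (ltn_trans ij jl) orbT.
Qed.

Lemma above_total x j l : j != l -> (j \in above x l) || (l \in above x j).
Proof.
move=> jl; rewrite !inE; case: (ltgtP (x l) (x j)) => //= _.
by rewrite -neq_ltn.
Qed.

Lemma card_above_inj x : injective (fun l => #|above x l|).
Proof.
have lt j l : j \in above x l -> (#|above x j| < #|above x l|)%N.
  move=> jl; apply: proper_card; apply/fintype.properP; split.
    by apply/fintype.subsetP => i; exact: above_trans.
  by exists j => //; exact: above_irr.
move=> j l jl; apply/eqP; apply: contraT => /(above_total x).
by case/orP => /lt; rewrite jl ltnn.
Qed.

Lemma above_rank x (m : nat) : (m < n)%N -> exists l, #|above x l| = m.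
Proof.
move=> mn; have bnd l : (#|above x l| < n)%N.
  rewrite -[ltnRHS](card_ord n) ltn_neqAle subset_leq_card ?subset_predT ?andbT//.
  apply/eqP => h; have := above_irr x l.
  have -> : above x l = [set: 'I_n]%SET by apply/eqP; rewrite eqEcard finset.subsetT cardsT h leqnn.
  by rewrite finset.in_setT.
pose r l := Ordinal (bnd l).
have rinj : injective r by move=> j l /(congr1 val)/= /card_above_inj.
have [g rg gr] := injF_bij rinj.
by exists (g (Ordinal mn)); rewrite -[LHS]/(val (r (g (Ordinal mn)))) gr.
Qed.

Lemma top_order_stat x l (m := #|above x l|) :
  order_stat x m.+1 = x l /\
  perm_eq [seq order_stat x i.+1 | i : nat <- iota 0 m] [seq x j | j <- enum (above x l)].
Proof.
have tr : transitive (>=%R : rel R) by move=> a b c' /[swap]; exact: le_trans.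
have asym : antisymmetric (>=%R : rel R).
  by move=> a b /= ab; apply/le_anti; rewrite andbC.
have tot : total (>=%R : rel R) by move=> a b; exact: le_total.
pose s1 := sort >=%R [seq x j | j <- enum (above x l)].
pose s2 := sort >=%R [seq x j | j <- enum ((~: above x l) :\ l)].
have ss1 : size s1 = m by rewrite size_sort size_map -cardE.
have E : sort >=%R (codom x) = s1 ++ x l :: s2.
  apply: (sorted_eq tr asym); first exact: sorted_order_stat.
    rewrite sorted_pairwise// pairwise_cat/= -!sorted_pairwise// !sort_sorted// !andbT.
    have le1 a : a \in s1 -> x l <= a.
      rewrite mem_sort => /mapP[j]; rewrite mem_enum inE => /orP[/ltW + ->//|/andP[/eqP -> _] ->//].
    have le2 a : a \in s2 -> a <= x l.
      rewrite mem_sort => /mapP[j]; rewrite mem_enum !inE => /andP[_ +] ->.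
      by rewrite negb_or -leNgt => /andP[].
    apply/andP; split; last by apply/allP => a; exact: le2.
    apply/allrelP => a b /le1 la; rewrite inE => /orP[/eqP ->//|/le2 bl].
    exact: le_trans bl la.
  rewrite perm_sort.
  apply: (@perm_trans _ [seq x j | j <- enum (above x l) ++ l :: enum ((~: above x l) :\ l)]).
    rewrite /codom /image_mem; apply: perm_map; apply: uniq_perm.
    - exact: enum_uniq.
    - rewrite cat_uniq/= !enum_uniq/= !mem_enum in_setD1 eqxx/= !andbT negb_or.
      rewrite above_irr/=; apply/hasPn => j.
      by rewrite mem_enum in_setD1 finset.in_setC => /andP[_ jl]; rewrite /= mem_enum.
    - move=> j; rewrite mem_enum mem_cat in_cons !mem_enum; symmetry.
      rewrite in_setD1 finset.in_setC; have := above_irr x l.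
      by case: eqVneq => [->|_] /=; [rewrite orbT|case: (j \in above x l)].
  rewrite map_cat/= perm_sym; apply: perm_cat; first by rewrite perm_sort.
  by rewrite perm_cons perm_sort.
split; first by rewrite /order_stat E nth_cat ss1 ltnn subnn.
have -> : [seq order_stat x i.+1 | i : nat <- iota 0 m] = s1; last by rewrite perm_sort.
apply: (@eq_from_nth _ 0); rewrite ?size_map ?size_iota ?ss1// => i im.
by rewrite (nth_map 0%N) ?size_iota// nth_iota// /order_stat E nth_cat ss1 add0n/= im.
Qed.

End top_order_statistics.

(** * The exponential law *)

(** The standard exponential law, as a measure for the Borel structure carried
    by [R] itself: [exponential_prob] lives on an alias of [R]. *)
Definition exp_law {R : realType} : set R -> \bar R := exponential_prob 1.

Section exp_law_probability.
Context {R : realType}.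
Local Notation exp1 :=
  (exponential_distribution_exponential_prob__canonical__probability_measure_Probability
     (ltr01 : 0 < (1 : R))).

Let exp_law0 : exp_law (set0 : set R) = 0%E.
Proof. exact: (measure0 exp1). Qed.

Let exp_law_nneg (A : set R) : (0 <= exp_law A)%E.
Proof. exact: (measure_ge0 exp1). Qed.

Let exp_law_sigma_additive : semi_sigma_additive (@exp_law R).
Proof. exact: (@measure_semi_sigma_additive _ _ _ exp1). Qed.

HB.instance Definition _ := isMeasure.Build _ _ _ (@exp_law R)
  exp_law0 exp_law_nneg exp_law_sigma_additive.

Let exp_law_setT : exp_law [set: R] = 1%E.
Proof. exact: (@probability_setT _ _ _ exp1). Qed.

HB.instance Definition _ :=
  Measure_isProbability.Build _ _ _ (@exp_law R) exp_law_setT.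

End exp_law_probability.

Section exponential_law.
Context {R : realType}.
Local Notation mu := (@exp_law R).

Lemma exp_law_set1 (c : R) : mu [set c] = 0%E.
Proof.
rewrite /exp_law /exponential_prob; apply: null_set_integral; [exact: measurable_set1| |exact: lebesgue_measure_set1].
by apply/measurable_EFinP/measurable_funTS; exact: measurable_exponential_pdf.
Qed.

Lemma exp_law_ccdf (c : R) : 0 <= c -> mu `]c, +oo[ = (expR (- c))%:E.
Proof.
move=> c0.
have neg : mu `]-oo, 0[ = 0%E.
  rewrite /exp_law /exponential_prob; apply: integral0_eq => x; rewrite /= in_itv/= => x0.
  by rewrite lt0_exponential_pdf.
have c1 : mu `[0, c] = (1 - expR (- c))%:E.
  move: c0; rewrite le_eqVlt => /predU1P[<-|c0]; last first.
    by rewrite /exp_law exponential_prob_itv0c// mulN1r EFinB.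
  by rewrite oppr0 expR0 subrr set_itv1; exact: exp_law_set1.
have E : `]c, +oo[%classic = ~` (`]-oo, 0[ `|` `[0, c]) :> set R.
  by rewrite -(@itv_bndbnd_setU _ _ -oo%O (BLeft 0) (BRight c)) ?setCitvl.
rewrite E probability_setC; last exact: measurableU.
rewrite measureU//=; last first.
  by apply/seteqP; split => // x /= []; rewrite !in_itv/= => /lt_geF ->.
by rewrite neg c1 add0e -EFinB opprB addrC subrK.
Qed.

Lemma exp_law_cccdf (c : R) : 0 <= c -> mu `[c, +oo[ = (expR (- c))%:E.
Proof.
move=> c0; rewrite -(@setU1itv _ _ _ _ false)// measureU//=; last first.
  by apply/seteqP; split => // x /= [->]; rewrite in_itv/= ltxx.
by rewrite exp_law_ccdf// exp_law_set1 add0e.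
Qed.

Lemma exp_law_ge0 : mu `[0, +oo[ = 1%E.
Proof. by rewrite exp_law_cccdf// oppr0 expR0. Qed.

(** Lack of memory; [b] selects whether the threshold itself is included. *)
Lemma exp_law_memoryless (b : bool) (y : R) (D : set R) :
  0 <= y -> measurable D ->
  mu [set x | (y < x ?<= if b) /\ D (x - y)] = ((expR (- y))%:E * mu D)%E.
Proof.
move=> y0 mD.
pose sh (x : R) : R := x - y.
have msh : measurable_fun setT sh by exact: measurable_funB.
pose H : set R := [set x | y < x ?<= if b].
have mH : measurable H.
  have -> : H = [set` Interval (BSide b y) +oo%O].
    by apply/seteqP; split => x; rewrite /H /= in_itv/= andbT; case: (b).
  exact: measurable_itv.
have muH : mu H = (expR (- y))%:E.
  have -> : H = [set` Interval (BSide b y) +oo%O].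
    by apply/seteqP; split => x; rewrite /H /= in_itv/= andbT; case: (b).
  by case: (b); [exact: exp_law_cccdf|exact: exp_law_ccdf].
pose m1 := pushforward (mrestr mu mH) sh.
pose m2 := mscale (NngNum (expR_ge0 (- y))) mu.
suff : m1 D = m2 D.
  rewrite /m1 /m2 /= /mscale/= /pushforward /mrestr /= => <-.
  by congr (mu _); apply/seteqP; split => x /= [].
apply: (measure_unique (@RGenOInfty.G R) (fun k : nat => `](- k%:R), +oo[%classic) _ _ _ _ m1 m2) => //.
- exact: RGenOInfty.measurableE.
- move=> _ _ [c ->] [c' ->]; exists (Num.max c c').
  by apply/seteqP; split => x /=; rewrite !in_itv/= !andbT gt_max => /andP.
- by move=> k; exists (- k%:R).
- apply/seteqP; split => // x _; exists (Num.bound `|x|) => //=.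
  rewrite in_itv/= andbT ltrNl (le_lt_trans (ler_norm _))// normrN.
  exact: archi_boundP.
- move=> _ [c ->]; rewrite /m1 /m2 /= /mscale /pushforward /mrestr /=.
  have [c0|c0] := leP 0 c.
    rewrite exp_law_ccdf// -EFinM -expRD -opprD.
    rewrite -exp_law_ccdf ?addr_ge0//; congr (mu _).
    apply/seteqP; split => x /=; rewrite !in_itv/= !andbT /sh ltrBrDl.
      by case.
    move=> h; split=> //; rewrite /H /=.
    move: c0; rewrite -(lerDl y) => /le_lt_trans/(_ h).
    by case: (b) => //= /ltW.
  have -> : mu `]c, +oo[ = 1%E.
    apply/eqP; rewrite eq_le probability_le1//= -exp_law_ge0.
    apply: le_measure; rewrite ?inE//.
    by move=> x /=; rewrite !in_itv/= !andbT; exact: lt_le_trans.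
  rewrite mule1 -muH; congr (mu _); apply/seteqP; split => x /=; first by case.
  move=> h; split => //; rewrite in_itv/= andbT /sh ltrBrDl.
  have yx : y <= x by move: h; rewrite /H /=; case: (b) => //= /ltW.
  by apply: lt_le_trans yx; rewrite gtrDl.
- move=> k; rewrite /m1 /= /pushforward /mrestr /= (le_lt_trans _ (ltry (1:R)))//.
  apply: probability_le1; apply: measurableI => //.
  by rewrite -[X in measurable X]setTI; exact: msh.
Qed.

End exponential_law.

Section measurable_order_statistics.
Context {d} {T : measurableType d} {R : realType} {n : nat}.

Lemma measurable_order_stat (X : 'I_n -> T -> R) (k : nat) :
  (forall j, measurable_fun setT (X j)) ->
  measurable_fun setT (fun w => order_stat (X^~ w) k).
Proof.
move=> mX.
wlog k0 : k / (0 < k)%N.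
  by move=> wl; case: k => [|k]; [exact: (wl 1%N)|exact: wl].
have [kn|nk] := leqP k n; last first.
  rewrite (_ : (fun w => _) = cst 0)//.
  by apply/funext => w; rewrite /order_stat nth_default// size_sort size_codomI; lia.
apply: (measurability _ (RGenOInfty.measurableE R)) => //.
move=> _ [_ [c ->] <-]; rewrite setTI.
pose N w : R := \sum_(j < n) \1_[set v | c < X j v] w.
have mN : measurable_fun setT N.
  apply: measurable_sum => j; apply: measurable_indic.
  rewrite (_ : [set v | _] = X j @^-1` `]c, +oo[).
    by rewrite -[X in measurable X]setTI; apply: mX.
  by apply/seteqP; split => v /=; rewrite in_itv/= andbT.
rewrite (_ : _ @^-1` _ = N @^-1` `[k%:R, +oo[).
  by rewrite -[X in measurable X]setTI; apply: mN.
have NE w : N w = #|[set j | (c < X j w)%R]%SET|%:R.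
  rewrite -sum1_card natr_sum big_mkcond /N/=; apply: eq_bigr => j _.
  by rewrite indicE inE; case: ifP => [h|/negP h]; [rewrite mem_set|rewrite memNset].
apply/seteqP; split => w /=; rewrite !in_itv/= !andbT NE ler_nat order_stat_gt ?k0//.
Qed.

End measurable_order_statistics.

(** * Spacings of exponential order statistics *)

Section top_spacings.
Context {d} {T : measurableType d} {R : realType} (P : probability T R) {n : nat}.
Variables (X : 'I_n -> {RV P >-> R}) (X_indep : mutually_independent X).
Hypothesis X_exp : forall i A, measurable A -> P (X i @^-1` A) = exp_law A.
Hypothesis X_ge0 : forall i w, 0 <= X i w.

Let X_rest_indep l A B : measurable A -> measurable B ->
  P (X l @^-1` A `&` rest_tuple X 0%R l @^-1` B) =
  (P (X l @^-1` A) * P (rest_tuple X 0%R l @^-1` B))%E.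
Proof. by move=> mA mB; rewrite setIC rest_tuple_indep// muleC. Qed.

Lemma prob_differences l (D : 'I_n -> set R) : (forall j, measurable (D j)) ->
  P [set w | forall j, j != l -> D j (X j w - X l w)] =
  (\int[P]_w \prod_(j | j != l) exp_law [set x | D j (x - X l w)%R])%E.
Proof.
move=> mD.
pose G : set (R * n.-tuple R) :=
  \bigcap_(j in [set: 'I_n]) [set z | j != l -> D j (tnth z.2 j - z.1)].
have mG : measurable G.
  apply: fin_bigcap_measurable => // j _.
  have [->|jl] := eqVneq j l.
    by rewrite (_ : [set _ | _] = setT)//; apply/seteqP; split => // z _ /=; rewrite ?eqxx.
  rewrite (_ : [set _ | _] = (fun z : R * n.-tuple R => tnth z.2 j - z.1) @^-1` (D j)).
    rewrite -[X in measurable X]setTI.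
    apply: (measurable_funB (f := fun z : R * n.-tuple R => tnth z.2 j)) => //.
    by apply: (measurableT_comp (measurable_tnth j)).
  by apply/seteqP; split => z /= h; [exact: h|move=> _].
have GE y w : G (y, rest_tuple X 0%R l w) <-> forall j, j != l -> D j (X j w - y).
  split=> [h j jl|h j _ jl]; last by rewrite /= tnth_mktuple (negbTE jl); exact: h.
  by have := h j Logic.I jl; rewrite /= tnth_mktuple (negbTE jl).
have mGp : measurable [set w | forall j, j != l -> D j (X j w - X l w)].
  rewrite (_ : [set _ | _] = (fun w => (X l w, rest_tuple X 0%R l w)) @^-1` G).
    by rewrite -[X in measurable X]setTI; apply: measurable_fun_pair.
  by apply/seteqP; split => w /= /GE.
rewrite -(setIT [set w | _]) -integral_indic//.
transitivity (\int[P]_w (fun z => (\1_G z)%:E) (X l w, rest_tuple X 0%R l w))%E.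
  apply: eq_integral => w _; rewrite /= !indicE; congr (_%:R%:E).
  by congr nat_of_bool; apply/idP/idP; rewrite !inE => /GE.
rewrite (freezing_ge0 (@X_rest_indep l) (g := fun z => (\1_G z)%:E))//; last first.
  by apply/measurable_EFinP; exact: measurable_indic.
apply: eq_integral => w _; set y := X l w.
have mGy : measurable [set t | G (y, t)].
  rewrite -[X in measurable X]setTI.
  by apply: (measurableT_comp (f := @id _) _ (pair1_measurable y)).
rewrite integral_indic//.
rewrite setIT /distribution /= /pushforward /=.
pose S j := if j == l then setT else [set x | D j (x - y)].
have mS j : measurable (S j).
  rewrite /S; case: ifP => // _.
  rewrite (_ : [set _ | _] = (fun x => x - y) @^-1` D j)//.
  by rewrite -[X in measurable X]setTI; apply: measurable_funB => //; exact: mD.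
transitivity (P [set w | forall j, S j (X j w)]).
  congr (P _); apply/seteqP; split => w' /=.
    by move=> /GE h j; rewrite /S; case: eqVneq => // jl; exact: h.
  by move=> h; apply/GE => j jl; have := h j; rewrite /S (negbTE jl).
rewrite X_indep// (bigD1 l)//= {1}/S eqxx preimage_setT probability_setT mul1e.
by apply: eq_bigr => j jl; rewrite X_exp//; congr exp_law; rewrite /S (negbTE jl).
Qed.

Let gap_side j l : set R := [set z | 0 < z ?<= if (j < l)%N].

Let measurable_gap_side j l : measurable (gap_side j l).
Proof.
have -> : gap_side j l = [set` Interval (BSide (j < l)%N 0) +oo%O].
  by apply/seteqP; split => z; rewrite /gap_side /= in_itv/= andbT; case: (j < l)%N.
exact: measurable_itv.
Qed.

Let aboveE (x : 'I_n -> R) l (S : {set 'I_n}) : l \notin S ->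
  (above x l = S) <->
  (forall j, j != l -> if j \in S then gap_side j l (x j - x l) else ~ gap_side j l (x j - x l)).
Proof.
move=> lS.
have E j : (j \in above x l) = (0 < x j - x l ?<= if (j < l)%N).
  rewrite inE /Order.lteif; case: ifP => jl; rewrite ?andbT ?andbF ?orbF ?subr_gt0//.
  by rewrite subr_ge0 le_eqVlt orbC.
split => [<- j jl|h]; first by rewrite E /gap_side /=; case: ifP => // ->.
apply/setP => j; have [->|jl] := eqVneq j l.
  by rewrite (negbTE lS) (negbTE (above_irr x l)).
by have := h _ jl; rewrite E /gap_side /=; case: ifP => _ // /negP/negbTE.
Qed.

(** The probability of a box of spacings factors because, given the value of
    [X l], the other variables are independent and those above it are, by lack
    of memory, again standard exponential beyond it. *)
Lemma prob_above_box l (S : {set 'I_n}) (C : 'I_n -> set R) :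
  l \notin S -> (forall j, measurable (C j)) ->
  P [set w | above (X^~ w) l = S /\ forall j, j \in S -> C j (X j w - X l w)] =
  ((\prod_(j in S) exp_law (C j)) * P [set w | above (X^~ w) l = S])%E.
Proof.
move=> lS mC.
pose h (w : T) : R := \prod_(j | j != l) (if j \in S then expR (- X l w) else 1 - expR (- X l w)).
have key (C' : 'I_n -> set R) : (forall j, measurable (C' j)) ->
    P [set w | above (X^~ w) l = S /\ forall j, j \in S -> C' j (X j w - X l w)] =
    ((\prod_(j in S) exp_law (C' j)) * \int[P]_w (h w)%:E)%E.
  move=> mC'.
  pose D j := if j \in S then gap_side j l `&` C' j else ~` gap_side j l.
  have mD j : measurable (D j).
    by rewrite /D; case: ifP => _; [apply: measurableI => //|apply: measurableC].
  rewrite (_ : [set w | _] = [set w | forall j, j != l -> D j (X j w - X l w)]); last first.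
    apply/seteqP; split => w /=.
      move=> [/(aboveE _ lS) aS hC] j jl; have := aS j jl; rewrite /D.
      by case: ifP => // jS; split => //; exact: hC.
    move=> hD; split.
      apply/(aboveE _ lS) => j jl; have := hD j jl; rewrite /D.
      by case: ifP => // jS [].
    move=> j jS; have jl : j != l by apply: contraNneq lS => <-.
    by have := hD j jl; rewrite /D jS => -[].
  rewrite prob_differences//.
  have fC j : exp_law (C' j) = (fine (exp_law (C' j)))%:E.
    by rewrite fineK// fin_num_measure.
  have h0 w : 0 <= h w.
    apply: prodr_ge0 => j _; case: ifP => _; rewrite ?expR_ge0//.
    by rewrite subr_ge0 -expR0 ler_expR oppr_le0.
  have mh : measurable_fun setT h.
    pose f (j : 'I_n) (w : T) : R := if j != l then
      (if j \in S then expR (- X l w) else 1 - expR (- X l w)) else 1.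
    rewrite (_ : h = fun w => \prod_j f j w); last first.
      by apply/funext => w; rewrite /h big_mkcond.
    apply: measurable_prod => j _; rewrite /f; case: (j != l) => //; case: (j \in S).
      by apply: measurableT_comp => //; apply: measurableT_comp.
    by apply: measurable_funB => //; apply: measurableT_comp => //; apply: measurableT_comp.
  rewrite -ge0_integralZl//; last 3 first.
  - by apply/measurable_EFinP.
  - by move=> w _; rewrite lee_fin.
  - by apply: prode_ge0.
  apply: eq_integral => w _; set y := X l w.
  have y0 : 0 <= y by exact: X_ge0.
  transitivity (\prod_(j | j != l) ((if j \in S then exp_law (C' j) else 1) *
     (if j \in S then expR (- y) else 1 - expR (- y))%:E))%E.
    apply: eq_bigr => j jl; rewrite /D; case: ifP => jS.
      rewrite muleC -(exp_law_memoryless (j < l)%N)//; congr exp_law.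
      by apply/seteqP; split => x /=; rewrite /gap_side /= /Order.lteif subr_gt0 subr_ge0.
    rewrite mul1e.
    have -> : [set x | (~` gap_side j l) (x - y)] = ~` [set x | (y < x ?<= if (j < l)%N) /\ setT (x - y)].
      apply/seteqP; split => x /=; rewrite /gap_side /= /Order.lteif subr_gt0 subr_ge0.
        by move=> h1 [].
      by move=> h1 h2; apply: h1.
    rewrite probability_setC.
      have E := exp_law_memoryless (j < l)%N y0 (@measurableT _ R).
      by rewrite [X in (1 - X)%E]E probability_setT mule1 EFinB.
    rewrite (_ : [set x | _] = [set` Interval (BSide (j < l)%N y) +oo%O]).
      exact: measurable_itv.
    by apply/seteqP; split => x /=; rewrite in_itv/= andbT; case: (j < l)%N => //= -[].
  rewrite big_split/=; congr (_ * _)%E.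
    rewrite -big_mkcondr/=; apply: eq_bigl => j.
    by case: eqVneq => [->|//]; rewrite (negbTE lS).
  by rewrite /h; elim/big_ind2 : _ => // a b a' b' -> ->.
rewrite key//; congr (_ * _)%E.
transitivity (P [set w | above (X^~ w) l = S /\ forall j, j \in S -> setT (X j w - X l w)]).
  rewrite (key (fun=> setT))// big1 ?mul1e// => j _.
  exact: probability_setT.
by congr (P _); apply/seteqP; split => w /= => [[]|].
Qed.
Let measurable_above l (S : {set 'I_n}) :
  measurable [set w | above (X^~ w) l = S].
Proof.
rewrite (_ : [set w | _] =
    \bigcap_(j in [set: 'I_n]) [set w | (j \in above (X^~ w) l) = (j \in S)]); last first.
  apply/seteqP; split => w /= h; first by move=> j _ /=; rewrite h.
  by apply/setP => j; exact: h.
apply: fin_bigcap_measurable => // j _.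
pose b w := (X l w < X j w) || ((X l w <= X j w) && (X j w <= X l w) && (j < l)%N).
have mb : measurable_fun setT b.
  apply: measurable_or; first exact: measurable_fun_ltr.
  by apply: measurable_and => //; apply: measurable_and; exact: measurable_fun_ler.
rewrite (_ : [set w | _] = b @^-1` [set (j \in S)]).
  by rewrite -[X in measurable X]setTI; apply: mb.
by apply/seteqP; split => w /=; rewrite inE /b -eq_le.
Qed.

Definition top_spacings (m : nat) (w : T) : m.-tuple R :=
  [tuple order_stat (X^~ w) i.+1 - order_stat (X^~ w) m.+1 | i < m].

Lemma measurable_top_spacings m : measurable_fun setT (top_spacings m).
Proof.
apply/measurable_fun_tnthP => i; rewrite /comp /=.
under eq_fun do rewrite tnth_mktuple.
by apply: measurable_funB; apply: measurable_order_stat => j; exact: measurable_funPT.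
Qed.

Definition sample_prefix (m : nat) (mn : (m <= n)%N) (w : T) : m.-tuple R :=
  [tuple X (widen_ord mn i) w | i < m].

Lemma measurable_sample_prefix m (mn : (m <= n)%N) :
  measurable_fun setT (sample_prefix mn).
Proof.
apply/measurable_fun_tnthP => i; rewrite /comp /=.
by under eq_fun do rewrite tnth_mktuple; exact: measurable_funPT.
Qed.

HB.instance Definition _ m (mn : (m <= n)%N) :=
  isMeasurableFun.Build _ _ _ _ (sample_prefix mn) (measurable_sample_prefix mn).

Lemma sample_prefix_box m (mn : (m <= n)%N) (C : 'I_m -> set R) :
  (forall i, measurable (C i)) ->
  P (sample_prefix mn @^-1` box C) = (\prod_(i < m) exp_law (C i))%E.
Proof.
move=> mC.
pose C' (j : 'I_n) := \bigcap_(i in [set i : 'I_m | widen_ord mn i = j]) C i.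
have C'E i : C' (widen_ord mn i) = C i.
  apply/seteqP; split => x; first by apply.
  move=> Cx i' /= /(congr1 val)/= ii'.
  by have -> : i' = i by apply/val_inj.
transitivity (P [set w | forall j, C' j (X j w)]).
  congr (P _); apply/seteqP; split => w /= h.
    by move=> j i /= <-; have := h i; rewrite tnth_mktuple.
  by move=> i; rewrite tnth_mktuple; have := h (widen_ord mn i); rewrite C'E.
have mC' j : measurable (C' j) by apply: fin_bigcap_measurable.
rewrite X_indep//.
rewrite (eq_bigr (fun j => exp_law (C' j))); last by move=> j _; rewrite X_exp.
rewrite (bigID (fun j : 'I_n => (j < m)%N))/= [X in (_ * X)%E]big1 ?mule1; last first.
  move=> j; rewrite -leqNgt => mj; rewrite (_ : C' j = setT) ?probability_setT//.
  apply/seteqP; split => // x _ i /= /(congr1 val)/= ij.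
  by have := ltn_ord i; rewrite ij ltnNge mj.
rewrite (big_ord_narrow mn)/=.
by apply: eq_bigr => i _; rewrite C'E.
Qed.

(** Conditionally on which index has rank [m.+1] and on the set of indices above
    it, the spacings are i.i.d. standard exponential; the conditioning events
    partition the space, so the factor common to all of them comes out. *)
Theorem top_spacings_law (m : nat) (mn : (m < n)%N) (E : set (m.-tuple R)) :
  measurable E -> (forall t t' : m.-tuple R, perm_eq t t' -> E t -> E t') ->
  P (top_spacings m @^-1` E) = P (sample_prefix (ltnW mn) @^-1` E).
Proof.
move=> mE Esym; set nu := P (sample_prefix (ltnW mn) @^-1` E).
pose ok (p : 'I_n * {set 'I_n}) := (#|p.2| == m) && (p.1 \notin p.2).
pose B (p : 'I_n * {set 'I_n}) := [set w | above (X^~ w) p.1 = p.2].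
have mB p : measurable (B p) by exact: measurable_above.
have part A : measurable A -> P A = (\sum_(p | ok p) P (A `&` B p))%E.
  move=> mA; rewrite -(setIT A) -integral_indic//.
  rewrite [RHS](eq_bigr (fun p => \int[P]_w (\1_(A `&` B p) w)%:E)%E); last first.
    by move=> p _; rewrite integral_indic ?setIT//; exact: measurableI.
  rewrite -big_filter -ge0_integral_sum//; last first.
    by move=> p; apply/measurable_EFinP/measurable_indic/measurableI.
  apply: eq_integral => w _; rewrite big_filter sumEFin; congr EFin.
  have [l lm] := above_rank (X^~ w) mn.
  have okl : ok (l, above (X^~ w) l) by rewrite /ok /= lm eqxx above_irr.
  rewrite (bigD1 _ okl)/= big1 ?addr0.
    rewrite !indicE; congr (_%:R); congr nat_of_bool.
    by apply/idP/idP; rewrite !inE => // -[].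
  move=> [j S] /andP[/andP[/= /eqP Sm _] jl]; rewrite indicE memNset// => -[_].
  rewrite /B /= => jS; move/eqP: jl; apply.
  have jl : j = l by apply: (@card_above_inj _ _ (X^~ w)); rewrite /= jS lm Sm.
  by rewrite -jl jS.
have mtop : measurable (top_spacings m @^-1` E).
  by rewrite -[X in measurable X]setTI; apply: measurable_top_spacings.
have mnu : measurable (sample_prefix (ltnW mn) @^-1` E).
  by rewrite -[X in measurable X]setTI; apply: measurable_sample_prefix.
rewrite part//.
suff key p : ok p -> P (top_spacings m @^-1` E `&` B p) = (nu * P (B p))%E.
  have nuE : nu = (fine nu)%:E by rewrite fineK// fin_num_measure.
  rewrite (eq_bigr (fun p => (fine nu)%:E * P (B p))%E); last by move=> p /key ->; rewrite -nuE.
  rewrite -ge0_sume_distrr//; have := part setT measurableT.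
  rewrite probability_setT; under eq_bigr do rewrite setTI.
  by move=> <-; rewrite mule1 -nuE.
case: p => l S /andP[/= /eqP Sm lS].
pose e (i : 'I_m) := nth l (enum S) i.
have se : size (enum S) = m by rewrite -cardE.
have eS i : e i \in S by rewrite -mem_enum mem_nth// se.
have einj : injective e.
  by move=> i j /eqP; rewrite nth_uniq ?enum_uniq ?se// => /eqP/val_inj.
pose Z w : m.-tuple R := [tuple X (e i) w - X l w | i < m].
have mZ : measurable_fun setT Z.
  apply/measurable_fun_tnthP => i; rewrite /comp /=.
  by under eq_fun do rewrite tnth_mktuple; apply: measurable_funB; exact: measurable_funPT.
have topZ w : above (X^~ w) l = S -> perm_eq (top_spacings m w) (Z w).
  move=> aS; have [os pm] := top_order_stat (X^~ w) l; rewrite aS Sm in os pm.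
  have -> : top_spacings m w = [seq r - X l w | r <- [seq order_stat (X^~ w) i.+1 | i : nat <- iota 0 m]] :> seq R.
    by rewrite /= -val_enum_ord -!map_comp os.
  have -> : Z w = [seq r - X l w | r <- [seq X j w | j <- enum S]] :> seq R.
    by rewrite -[in RHS](mkseq_nth l (enum S)) se /mkseq -val_enum_ord -3!map_comp.
  exact: perm_map.
transitivity (P (Z @^-1` E `&` B (l, S))).
  congr (P _); apply/seteqP; split => w /= [Ew]; rewrite /B /= => aS; split => //.
    by apply: Esym Ew; exact: topZ.
  by apply: Esym Ew; rewrite perm_sym; exact: topZ.
pose m1 := pushforward (mrestr P (mB (l, S))) Z.
pose m2 := mscale (NngNum (fine_ge0 (measure_ge0 P (B (l, S)))))
  (distribution P (sample_prefix (ltnW mn))).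
have PB : (fine (P (B (l, S))))%:E = P (B (l, S)) by rewrite fineK// fin_num_measure.
suff : m1 E = m2 E.
  by rewrite /m1 /m2 /= /mscale /= /distribution /pushforward /mrestr /= PB muleC => ->.
apply: (@eq_measure_tuple _ _ _ _ m1 m2) => //.
- rewrite /m1 /= /pushforward /mrestr preimage_setT setTI.
  by rewrite (le_lt_trans (probability_le1 P _)) ?ltry.
move=> C mC; rewrite /m1 /m2 /= /mscale /= /distribution /pushforward /mrestr /= PB.
rewrite sample_prefix_box//.
pose C' (j : 'I_n) := \bigcap_(i in [set i : 'I_m | e i = j]) C i.
have C'E i : C' (e i) = C i.
  apply/seteqP; split => x; first by apply.
  by move=> Cx i' /= /einj ->.
have mC' j : measurable (C' j) by apply: fin_bigcap_measurable.
transitivity (P [set w | above (X^~ w) l = S /\ forall j, j \in S -> C' j (X j w - X l w)]).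
  congr (P _); apply/seteqP; split => w /= [].
    move=> h aS; split => // j jS i /= <-.
    by have := h i; rewrite tnth_mktuple.
  move=> aS h; split => // i; rewrite tnth_mktuple.
  by have := h _ (eS i); rewrite C'E.
rewrite prob_above_box// muleC; congr (_ * _)%E.
rewrite -big_enum/= (big_nth l) se big_mkord.
by apply: eq_bigr => i _; rewrite -C'E.
Qed.
End top_spacings.

(** * Stein's equation for the normal law *)

Section real_limits.
Context {R : realType}.

Lemma cvg0_mull {T : Type} {F : set_system T} {FF : Filter F} (k : R) (f : T -> R) :
  f x @[x --> F] --> 0 -> k * f x @[x --> F] --> 0.
Proof. by move=> f0; rewrite -[X in _ --> X](mulr0 k); apply: cvgM => //; exact: cvg_cst. Qed.

Lemma cvg_inv_pinfty : (x : R)^-1 @[x --> +oo] --> 0.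
Proof.
apply/gtr0_cvgV0; last exact: cvg_id.
exact: nbhs_pinfty_gt.
Qed.

End real_limits.

Section real_function_bounds.
Context {R : realType}.
Implicit Types (f df : R -> R) (a b K : R).

Lemma is_derive_continuous f df : (forall x : R, is_derive x 1 f (df x)) -> continuous f.
Proof.
move=> fd x; apply: differentiable_continuous; apply/derivable1_diffP.
by have [] := fd x.
Qed.

Lemma is_derive_within f df a b : (forall x : R, a <= x <= b -> is_derive x 1 f (df x)) ->
  {within `[a, b], continuous f}.
Proof.
move=> fd; apply: derivable_within_continuous => x; rewrite in_itv/= => xab.
by have [] := fd x xab.
Qed.

Lemma derive_nonincr f df a b : a <= b ->
  (forall x : R, a <= x <= b -> is_derive x 1 f (df x)) ->
  (forall x, a <= x <= b -> df x <= 0) -> f b <= f a.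
Proof.
rewrite le_eqVlt => /predU1P[->//|ab] fd df0.
have fd' (x : R) : x \in `]a, b[ -> is_derive x 1 f (df x).
  by rewrite in_itv/= => /andP[ax xb]; apply: fd; rewrite !ltW.
have [c cab fE] := MVT ab fd' (is_derive_within fd).
rewrite -subr_le0 fE mulr_le0_ge0//; last by rewrite subr_ge0 ltW.
by apply: df0; move: cab; rewrite in_itv/= => /andP[ac cb]; rewrite !ltW.
Qed.

Lemma derive_lipschitz f df (L : R) : (forall x : R, is_derive x 1 f (df x)) ->
  (forall x, `|df x| <= L) -> forall x y, `|f x - f y| <= L * `|x - y|.
Proof.
move=> fd dfL x y; wlog xy : x y / x <= y.
  by move=> wl; have [/wl//|/ltW/wl] := leP x y; rewrite distrC [X in _ <= _ * X]distrC.
move: xy; rewrite le_eqVlt => /predU1P[->|xy]; first by rewrite !subrr normr0 mulr0.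
have [c cab fE] := MVT xy (fun z _ => fd z) (is_derive_within (fun z _ => fd z)).
by rewrite distrC fE [X in _ <= _ * X]distrC normrM ler_wpM2r.
Qed.

Lemma continuous_bounded f K : continuous f ->
  exists M : R, forall x : R, `|x| <= K -> `|f x| <= M.
Proof.
move=> cf; have [K0|K0] := ltP K 0.
  by exists 0 => x xK; have := le_lt_trans xK K0; rewrite ltNge normr_ge0.
have NKK : - K <= K by rewrite (le_trans _ K0)// oppr_le0.
have cnf : {within `[- K, K], continuous (fun x => `|f x|)}.
  by apply: continuous_subspaceT => x; apply: cvg_norm; exact: cf.
have [c _ cmax] := EVT_max NKK cnf.
by exists `|f c| => x; rewrite ler_norml => xK; apply: cmax; rewrite in_itv.
Qed.

End real_function_bounds.

Section stein_equation.
Context {R : realType}.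
Implicit Types (x y : R).
Local Notation mu := (@lebesgue_measure R).

Definition std_pdf x : R := normal_pdf 0 1 x.

Lemma std_pdfE x : std_pdf x = normal_peak 1 * expR (- x ^+ 2 / 2).
Proof.
rewrite /std_pdf normal_pdfE ?oner_eq0// /normal_fun subr0 expr1n.
by rewrite -mulr_natr mul1r.
Qed.

Lemma std_pdf_gt0 x : 0 < std_pdf x.
Proof. by rewrite std_pdfE mulr_gt0 ?expR_gt0// normal_peak_gt0 ?oner_eq0. Qed.

Lemma std_pdf_even x : std_pdf (- x) = std_pdf x.
Proof. by rewrite !std_pdfE sqrrN. Qed.

Lemma is_derive_std_pdf x : is_derive x 1 std_pdf (- x * std_pdf x).
Proof.
rewrite (_ : std_pdf = (fun y => normal_peak 1 * expR (- y ^+ 2 / 2))); last first.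
  by apply/funext => y; rewrite std_pdfE.
apply: is_derive_eq.
rewrite /GRing.scale /=; by field.
Qed.

Lemma std_pdf_le_inv x : 0 < x -> std_pdf x <= normal_peak 1 * (2 / x ^+ 2).
Proof.
move=> x0; rewrite std_pdfE ler_wpM2l ?normal_peak_ge0// mulNr expRN.
rewrite -[leRHS]invf_div lef_pV2 ?posrE ?expR_gt0 ?divr_gt0 ?exprn_gt0//.
by apply: le_trans (expR_ge1Dx _); rewrite lerDr.
Qed.

Lemma std_pdf_cvgy : std_pdf x @[x --> +oo] --> 0.
Proof.
apply: (@squeeze_cvgr _ _ _ _ (fun=> 0) (fun x => (normal_peak 1 * 2) * x^-1)).
- near=> x; rewrite ltW ?std_pdf_gt0//=.
  have x1 : 1 <= x by near: x; exact: nbhs_pinfty_ge.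
  have x0 : 0 < x by apply: lt_le_trans x1.
  apply: le_trans (std_pdf_le_inv x0) _; rewrite mulrA ler_wpM2l ?mulr_ge0 ?normal_peak_ge0//.
  by rewrite lef_pV2 ?posrE ?exprn_gt0// expr2 ler_peMl// ltW.
- exact: cvg_cst.
- by apply: cvg0_mull; exact: cvg_inv_pinfty.
Unshelve. all: by end_near. Qed.

(** Mills ratio bounds, for a function vanishing at infinity whose derivative is
    a multiple of the normal density: both sides differ from [G] by a monotone
    function vanishing at infinity. *)
Lemma mills_ratio (G : R -> R) (c b : R) : 0 <= c -> 0 < b ->
  (forall x : R, b <= x -> is_derive x 1 G (- c * std_pdf x)) ->
  G x @[x --> +oo] --> 0 ->
  forall x, b <= x ->
    c * (x / (1 + x ^+ 2)) * std_pdf x <= G x <= c * x^-1 * std_pdf x.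
Proof.
move=> c0 b0 Gd G0 x bx.
have pos y : b <= y -> 0 < y by apply: lt_le_trans.
have dpdf := is_derive_std_pdf.
have up0 : c * y^-1 * std_pdf y - G y @[y --> +oo] --> 0.
  rewrite -(subr0 0); apply: cvgB => //.
  rewrite -(mulr0 0); apply: cvgM; last exact: std_pdf_cvgy.
  by apply: cvg0_mull; exact: cvg_inv_pinfty.
have dn0 : G y - c * (y / (1 + y ^+ 2)) * std_pdf y @[y --> +oo] --> 0.
  rewrite -(subr0 0); apply: cvgB => //.
  apply: (@squeeze_cvgr _ _ _ _ (fun=> 0) (fun y => c * std_pdf y)).
  - near=> y.
    have y1 : 1 <= y by near: y; exact: nbhs_pinfty_ge.
    have y0 : 0 < y by apply: lt_le_trans y1.
    have D0 : 0 < 1 + y ^+ 2 by rewrite ltr_wpDr ?sqr_ge0.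
    rewrite !mulr_ge0 ?(ltW (std_pdf_gt0 _))// ?invr_ge0 ?(ltW y0) ?(ltW D0)//=.
    rewrite ler_wpM2r ?(ltW (std_pdf_gt0 _))// -[leRHS]mulr1 ler_wpM2l//.
    rewrite ler_pdivrMr// mul1r.
    by rewrite (le_trans (ler_eXnr (n := 2) _ y1))// lerDr.
  - exact: cvg_cst.
  - by apply: cvg0_mull; exact: std_pdf_cvgy.
apply/andP; split; rewrite -subr_ge0.
  apply: (cvgr_to_le dn0); near=> z.
  have xz : x <= z by near: z; apply: nbhs_pinfty_ge; exact: num_real.
  pose B (y : R) : R := G y - c * (y * (1 + y ^+ 2)^-1) * std_pdf y.
  pose dB (y : R) : R := - (2 * c) * std_pdf y / (1 + y ^+ 2) ^+ 2.
  apply: (derive_nonincr (f := B) (df := dB)) => // y /andP[xy yz].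
    have y0 := pos _ (le_trans bx xy).
    have ne : 1 + y ^+ 2 != 0 by rewrite gt_eqF// ltr_wpDr ?sqr_ge0.
    have dG := Gd _ (le_trans bx xy).
    have dS : is_derive y 1 (fun y : R => 1 + y ^+ 2) (2 * y).
      by apply: is_derive_eq; rewrite /GRing.scale /=; ring.
    have dV := is_deriveV (f := fun y : R => 1 + y ^+ 2) ne dS.
    rewrite /B; apply: is_derive_eq; rewrite /GRing.scale /= /dB; field.
    exact: ne.
  rewrite /dB !mulNr oppr_le0 divr_ge0 ?sqr_ge0// !mulr_ge0//.
  exact: ltW (std_pdf_gt0 _).
apply: (cvgr_to_le up0); near=> z.
have xz : x <= z by near: z; apply: nbhs_pinfty_ge; exact: num_real.
pose B (y : R) : R := c * y^-1 * std_pdf y - G y.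
pose dB (y : R) : R := - c * std_pdf y / y ^+ 2.
apply: (derive_nonincr (f := B) (df := dB)) => // y /andP[xy yz].
  have y0 := pos _ (le_trans bx xy).
  have ne : y != 0 by rewrite gt_eqF.
  have dG := Gd _ (le_trans bx xy).
  have dV := is_deriveV (f := id) ne (is_derive_id y 1).
  rewrite /B; apply: is_derive_eq; rewrite /GRing.scale /= /dB; field.
  exact: ne.
rewrite /dB !mulNr oppr_le0 divr_ge0 ?sqr_ge0// mulr_ge0//.
exact: ltW (std_pdf_gt0 _).
Unshelve. all: by end_near. Qed.

End stein_equation.

Section stein_solution.
Context {R : realType}.
Local Notation mu := (@lebesgue_measure R).
Local Notation gauss := (@normal_prob R 0 1).

Definition std_cdf (x : R) : R := fine (gauss `]-oo, x]).

Lemma std_cdfE x : std_cdf x = \int[mu]_(t in `]-oo, x]) std_pdf t.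
Proof. by []. Qed.

Let idR : measurableTypeR R -> R := idfun.

#[local] HB.instance Definition _ :=
  @isMeasurableFun.Build _ _ _ _ idR (@measurable_id _ _ setT).

Lemma std_cdf_cvgNy : std_cdf x @[x --> -oo] --> (0 : R).
Proof. exact: (fine_cvg (cvg_cdfNy0 (idR : {RV gauss >-> R}))). Qed.

Lemma std_cdf_cvgy : std_cdf x @[x --> +oo] --> (1 : R).
Proof. exact: (fine_cvg (cvg_cdfy1 (idR : {RV gauss >-> R}))). Qed.

Lemma integrable_std_pdf (D : set (measurableTypeR R)) : measurable D -> mu.-integrable D (EFin \o std_pdf).
Proof.
move=> mD; have h := @integrable_normal_pdf R 0 1.
exact: (integrableS measurableT mD (@subsetT _ D) h).
Qed.

Lemma continuous_std_pdf : continuous (@std_pdf R).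
Proof. by apply: continuous_normal_pdf; rewrite oner_eq0. Qed.

Section weighted.
Variables (h : R -> R) (hc : continuous h) (B : R) (hB : forall x, `|h x| <= B).

Let w x := h x * std_pdf x.

Let cw : continuous w.
Proof. by move=> x; apply: cvgM; [exact: hc|exact: continuous_std_pdf]. Qed.

Let wB x : `|w x| <= B * std_pdf x.
Proof. by rewrite normrM (ger0_norm (ltW (std_pdf_gt0 x))) ler_wpM2r// ltW// std_pdf_gt0. Qed.

Lemma integrable_std_pdfM (D : set (measurableTypeR R)) : measurable D -> mu.-integrable D (EFin \o w).
Proof.
move=> mD; apply: le_integrable (integrableZl mD B (integrable_std_pdf mD)) => //.
  by apply/measurable_EFinP/measurable_funTS; exact: continuous_measurable_fun.
move=> x _; rewrite /= lee_fin; apply: le_trans (wB x) _; exact: ler_norm.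
Qed.

Lemma is_derive_std_pdfM (x : R) :
  is_derive x 1 (fun y : R => \int[mu]_(t in `]-oo, y]) w t) (w x).
Proof.
have x1 : x < x + 1 by rewrite ltrDl.
have wI : mu.-integrable [set` Interval -oo%O (BRight (x + 1))] (EFin \o w).
  exact: integrable_std_pdfM.
have cwx : {for x, continuous w} by exact: cw.
have [dw dwE] := continuous_FTC1 x1 wI (ltNyr x) cwx.
by apply: DeriveDef; [exact: dw|rewrite -derive1E; exact: dwE].
Qed.

Lemma norm_std_pdfM_le (D : set (measurableTypeR R)) : measurable D ->
  `|\int[mu]_(t in D) w t| <= B * \int[mu]_(t in D) std_pdf t.
Proof.
move=> mD; apply: le_trans (le_normr_Rintegral mD (integrable_std_pdfM mD)) _.
rewrite -RintegralZl//; last exact: integrable_std_pdf.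
apply: le_Rintegral => //.
- exact: (integrable_norm (integrable_std_pdfM mD)).
- exact: (integrableZl mD B (integrable_std_pdf mD)).
Qed.

End weighted.
Variables (h : R -> R) (a b : R).
Hypotheses (hc : continuous h) (h01 : forall x, 0 <= h x <= 1).
Hypotheses (ha : forall x, x <= a -> h x = 1) (hb : forall x, b <= x -> h x = 0).

Definition gauss_mean : R := \int[mu]_t (h t * std_pdf t).
Local Notation c := gauss_mean.

Let hB x : `|h x| <= 1.
Proof. by have /andP[h0 h1] := h01 x; rewrite ger0_norm. Qed.

Lemma std_pdf_Rintegral : \int[mu]_t std_pdf t = 1.
Proof. by rewrite /Rintegral /std_pdf integral_normal_pdf. Qed.

Lemma gauss_mean_ge0 : 0 <= c.
Proof.
apply: Rintegral_ge0 => x _; rewrite mulr_ge0//; first by have /andP[] := h01 x.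
exact: ltW (std_pdf_gt0 _).
Qed.

Let hpdf_int D : measurable D -> mu.-integrable D (EFin \o (fun t => h t * std_pdf t)).
Proof. exact: (integrable_std_pdfM hc hB). Qed.

Lemma gauss_mean_le1 : c <= 1.
Proof.
rewrite -std_pdf_Rintegral; apply: le_Rintegral => //.
- exact: hpdf_int.
- exact: integrable_std_pdf.
- move=> x _; rewrite -[leRHS]mul1r ler_wpM2r ?(ltW (std_pdf_gt0 x))//.
  by have /andP[] := h01 x.
Qed.

Let g x := h x - c.

Let cg : continuous g.
Proof. by move=> x; apply: cvgB; [exact: hc|exact: cvg_cst]. Qed.

Let gB x : `|g x| <= 1.
Proof.
have := h01 x; have := gauss_mean_le1; have := gauss_mean_ge0; rewrite /g => c0 c1 /andP[h0 h1].
by rewrite ler_norml; apply/andP; split; lra.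
Qed.

Let G x : R := \int[mu]_(t in `]-oo, x]) (g t * std_pdf t).

Let G_derive (x : R) : is_derive x 1 G (g x * std_pdf x).
Proof. exact: (@is_derive_std_pdfM g cg 1 gB x). Qed.

Let intG : \int[mu]_t (g t * std_pdf t) = 0.
Proof.
rewrite /g; under eq_Rintegral do rewrite mulrBl.
rewrite RintegralB//; last 2 first.
- exact: hpdf_int.
- exact: (integrableZl measurableT c (integrable_std_pdf measurableT)).
rewrite RintegralZl//; last exact: integrable_std_pdf.
by rewrite std_pdf_Rintegral mulr1 subrr.
Qed.

Let setT_split x : [set: R] = `]-oo, x] `|` `]x, +oo[ :> set (measurableTypeR R).
Proof. by rewrite -itv_bndbnd_setU ?set_itvNyy//. Qed.

Let disj_split (x : R) : [disjoint `]-oo, x]%classic & `]x, +oo[%classic : set (measurableTypeR R)].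
Proof.
by apply/disj_set2P/seteqP; split => // y []/=; rewrite !in_itv/= andbT leNgt => /negbTE ->.
Qed.

Let G_compl x : G x = - \int[mu]_(t in `]x, +oo[) (g t * std_pdf t).
Proof.
apply/eqP; rewrite -addr_eq0; apply/eqP; rewrite -intG (setT_split x) Rintegral_setU//.
rewrite -setT_split; exact: (integrable_std_pdfM cg gB measurableT).
Qed.

Let std_cdf_compl x : \int[mu]_(t in `]x, +oo[) std_pdf t = 1 - std_cdf x.
Proof.
apply/eqP; rewrite eq_sym subr_eq addrC; apply/eqP.
rewrite std_cdfE -std_pdf_Rintegral (setT_split x) Rintegral_setU//.
rewrite -setT_split; exact: integrable_std_pdf.
Qed.

Let G_cvgy : G x @[x --> +oo] --> (0 : R).
Proof.
apply/norm_cvg0P; apply: (@squeeze_cvgr _ _ _ _ (fun=> 0) (fun x => 1 - std_cdf x)).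
- near=> x; rewrite normr_ge0/= G_compl normrN -std_cdf_compl.
  by rewrite -[leRHS]mul1r; exact: (norm_std_pdfM_le cg gB).
- exact: cvg_cst.
- rewrite -(subrr 1); apply: cvgB; [exact: cvg_cst|exact: std_cdf_cvgy].
Unshelve. all: by end_near. Qed.

Let G_cvgNy : G (- x) @[x --> +oo] --> (0 : R).
Proof.
apply/norm_cvg0P; apply: (@squeeze_cvgr _ _ _ _ (fun=> 0) (fun x => std_cdf (- x))).
- near=> x; rewrite normr_ge0/=.
  by rewrite -[leRHS]mul1r std_cdfE; exact: (norm_std_pdfM_le cg gB).
- exact: cvg_cst.
- by apply: (cvg_comp (fun x : R => - x) std_cdf _ std_cdf_cvgNy); apply/cvgNrNy; exact: cvg_id.
Unshelve. all: by end_near. Qed.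

Variables (Lh : R) (h_lipschitz : forall x y, `|h x - h y| <= Lh * `|x - y|).

Let f x := G x / std_pdf x.
Let f' x := g x + x * f x.
Let u x := x * f x.
Let u' x := f x + x * f' x.

Let f_derive (x : R) : is_derive x 1 f (f' x).
Proof.
have dG := G_derive x.
have ne : std_pdf x != 0 by rewrite gt_eqF// std_pdf_gt0.
have dV := is_deriveV ne (is_derive_std_pdf x).
by rewrite /f; apply: is_derive_eq; rewrite /GRing.scale /= /f' /f; field.
Qed.

Let u_derive (x : R) : is_derive x 1 u (u' x).
Proof.
have df := f_derive x; rewrite /u.
by apply: is_derive_eq; rewrite /GRing.scale /= /u'; ring.
Qed.

(** Beyond [a] and [b] the source term is constant and the Mills bounds apply,
    so that [f], [x f] and the derivative of [x f] are bounded by 1. *)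
Let tail_bound (c' y q : R) : 0 <= c' <= 1 -> 1 <= y ->
  c' * (y / (1 + y ^+ 2)) <= q <= c' * y^-1 ->
  [/\ `|q| <= 1, `|y * q| <= 1 & `|q * (1 + y ^+ 2) - c' * y| <= 1].
Proof.
move=> /andP[c0 c1] y1 /andP[lq qu].
have y0 : 0 < y by apply: lt_le_trans y1.
have D0 : 0 < 1 + y ^+ 2 by rewrite ltr_wpDr ?sqr_ge0.
have yV1 : y^-1 <= 1 by rewrite invf_le1.
have yq : y * q <= c'.
  by move: qu; rewrite ler_pdivlMr// mulrC.
have q0 : 0 <= q by apply: le_trans lq; rewrite mulr_ge0// divr_ge0 ?ltW.
have low : c' * y <= q * (1 + y ^+ 2).
  by move: lq; rewrite mulrA ler_pdivrMr.
have up : q <= 1 by nra.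
split.
- by rewrite ger0_norm.
- by rewrite ger0_norm ?(le_trans yq c1)// mulr_ge0// ltW.
- rewrite ger0_norm ?subr_ge0//.
  have -> : q * (1 + y ^+ 2) = q + y * (y * q) by ring.
  nra.
Qed.

Theorem stein_solution : exists (phi dphi : R -> R) (M L : R),
  [/\ forall x : R, is_derive x 1 phi (dphi x),
      forall x, dphi x - x * phi x = h x - gauss_mean,
      forall x, `|phi x| <= M,
      forall x, `|dphi x| <= M &
      forall x y, `|dphi x - dphi y| <= L * `|x - y|].
Proof.
pose K := Num.max 1 (Num.max b (- a)).
have tails x : K <= `|x| -> [/\ `|f x| <= 1, `|u x| <= 1 & `|u' x| <= 1].
  move=> Kx.
  have [x1 bx ax] : [/\ 1 <= `|x|, b <= `|x| & - a <= `|x|].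
    by move: Kx; rewrite /K !ge_max => /andP[-> /andP[-> ->]].
  have K1 : 0 < Num.max 1 b by rewrite lt_max ltr01.
  have K2 : 0 < Num.max 1 (- a) by rewrite lt_max ltr01.
  have c0 := gauss_mean_ge0; have c1 := gauss_mean_le1.
  have p0 := std_pdf_gt0 x.
  have [x0|x0] := leP 0 x.
    rewrite ger0_norm// in x1 bx.
    have Gd (y : R) : Num.max 1 b <= y -> is_derive y 1 G (- c * std_pdf y).
      rewrite ge_max => /andP[_ /hb hy]; have := G_derive y.
      by rewrite /g hy sub0r.
    have xK : Num.max 1 b <= x by rewrite ge_max x1.
    have /andP[lo up] := mills_ratio c0 K1 Gd G_cvgy xK.
    have c01 : 0 <= c <= 1 by rewrite c0 c1.
    have fx : c * (x / (1 + x ^+ 2)) <= f x <= c * x^-1.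
      by rewrite /f ler_pdivlMr// ler_pdivrMr// lo.
    have [A1 A2 A3] := tail_bound c01 x1 fx.
    split=> //; rewrite /u' /f' /g hb//.
    suff -> : f x + x * (0 - c + x * f x) = f x * (1 + x ^+ 2) - c * x by [].
    by ring.
  rewrite ltr0_norm// in x1 ax.
  pose G2 y := G (- y).
  have Gd (y : R) : Num.max 1 (- a) <= y -> is_derive y 1 G2 (- (1 - c) * std_pdf y).
    rewrite ge_max => /andP[_ ay]; have dG := G_derive (- y).
    have := is_derive1_comp dG (is_deriveNid y 1).
    by rewrite /g ha 1?lerNl// std_pdf_even mulrN1 mulNr.
  have xK : Num.max 1 (- a) <= - x by rewrite ge_max x1.
  have c2 : 0 <= 1 - c by rewrite subr_ge0.
  have /andP[lo up] := mills_ratio c2 K2 Gd G_cvgNy xK.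
  have c01 : 0 <= 1 - c <= 1 by rewrite c2 lerBlDr lerDl.
  have fx : (1 - c) * (- x / (1 + (- x) ^+ 2)) <= f x <= (1 - c) * (- x)^-1.
    rewrite /f ler_pdivlMr// ler_pdivrMr//.
    by move: lo up; rewrite /G2 std_pdf_even opprK => -> ->.
  have [A1 A2 A3] := tail_bound c01 x1 fx.
  split=> //; first by rewrite /u -normrN -mulNr.
  rewrite /u' /f' /g ha; last by rewrite -lerN2.
  suff -> : f x + x * (1 - c + x * f x) = f x * (1 + (- x) ^+ 2) - (1 - c) * - x by [].
  by ring.
have cf : continuous f := is_derive_continuous f_derive.
have cu : continuous u := is_derive_continuous u_derive.
have cf' : continuous f' by move=> x; apply: cvgD; [exact: cg|exact: cu].
have cu' : continuous u'.
  by move=> x; apply: cvgD; [exact: cf|apply: cvgM; [exact: cvg_id|exact: cf']].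
have [M1 M1P] := continuous_bounded K cf.
have [M2 M2P] := continuous_bounded K cu.
have [M3 M3P] := continuous_bounded K cu'.
have bnd (v : R -> R) M : (forall x, `|x| <= K -> `|v x| <= M) ->
    (forall x, K <= `|x| -> `|v x| <= 1) -> forall x, `|v x| <= Num.max M 1.
  move=> mid tl x; rewrite le_max; have [/ltW/tl ->|/mid ->//] := ltP K `|x|.
  by rewrite orbT.
have fM := bnd f M1 M1P (fun x Kx => let: And3 p _ _ := tails x Kx in p).
have uM := bnd u M2 M2P (fun x Kx => let: And3 _ p _ := tails x Kx in p).
have u'M := bnd u' M3 M3P (fun x Kx => let: And3 _ _ p := tails x Kx in p).
exists f, f', (Num.max M1 1 + Num.max M2 1 + 1), (Lh + Num.max M3 1).
have M20 : 0 <= Num.max M2 1 by rewrite le_max ler01 orbT.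
have M10 : 0 <= Num.max M1 1 by rewrite le_max ler01 orbT.
split=> //.
- by move=> x; rewrite /f' addrK.
- by move=> x; apply: le_trans (fM x) _; rewrite -addrA lerDl addr_ge0.
- move=> x; rewrite /f'; apply: le_trans (ler_normD _ _) _.
  have := gB x; have := uM x; rewrite /u => h1 h2.
  lra.
- move=> x y; have -> : f' x - f' y = (h x - h y) + (u x - u y) by rewrite /f' /g /u; ring.
  rewrite mulrDl; apply: le_trans (ler_normD _ _) _; apply: lerD => //.
  exact: derive_lipschitz u_derive u'M x y.
Qed.

End stein_solution.

(** * The central limit theorem *)

Lemma lipschitz_continuous {R : realType} (f : R -> R) (L : R) :
  (forall x y, `|f x - f y| <= L * `|x - y|) -> continuous f.
Proof.
move=> fL x; apply/cvgrPdist_le => e e0.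
have L0 : 0 <= L by have := le_trans (normr_ge0 _) (fL 1 0); rewrite subr0 normr1 mulr1.
have e1 : 0 < e / (L + 1) by rewrite divr_gt0// ltr_wpDl.
near=> y; apply: le_trans (fL x y) _.
apply: (@le_trans _ _ ((L + 1) * `|x - y|)); first by rewrite ler_wpM2r// lerDl.
rewrite mulrC -ler_pdivlMr ?ltr_wpDl//.
Unshelve. all: by end_near. Qed.

Lemma Rintegral_prob_cst {d} {T : measurableType d} {R : realType}
  (P : probability T R) (r : R) : \int[P]_w r = r.
Proof.
rewrite Rintegral_cst// -[RHS]mulr1; congr (_ * _).
exact: (congr1 fine (@probability_setT _ _ _ P)).
Qed.

Lemma Rintegral_sum {d} {T : measurableType d} {R : realType}
    (mu : {measure set T -> \bar R}) {I : Type} (s : seq I) (f : I -> T -> R) :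
  (forall i, mu.-integrable setT (EFin \o f i)) ->
  \int[mu]_x (\sum_(i <- s) f i x) = \sum_(i <- s) \int[mu]_x f i x.
Proof.
move=> fI; elim: s => [|i s IHs].
  by under eq_Rintegral do rewrite big_nil; rewrite Rintegral_cst// mul0r big_nil.
under eq_Rintegral do rewrite big_cons.
rewrite RintegralD// ?IHs ?big_cons//.
apply: eq_integrable (integrable_sum measurableT s (P := xpredT) (fun i _ => fI i)) => //.
by move=> x _; rewrite /= sumEFin.
Qed.

Section integral_of_law.
Context {d d'} {T : measurableType d} {T' : measurableType d'} {R : realType}.
Variables (P : probability T R) (X : {RV P >-> T'}) (mu : probability T' R).
Hypothesis X_law : forall A, measurable A -> P (X @^-1` A) = mu A.

Lemma integrable_law (phi : T' -> R) : mu.-integrable setT (EFin \o phi) ->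
  P.-integrable setT (EFin \o (phi \o X)).
Proof.
move=> /integrableP[mphi phioo]; apply/integrableP; split.
  exact: (measurableT_comp mphi (measurable_funPT X)).
move: phioo; rewrite (eq_measure_integral (distribution P X)); last first.
  by move=> A mA _; apply/esym; exact: X_law.
by rewrite ge0_integral_distribution//; exact: measurableT_comp.
Qed.

Lemma Rintegral_law (phi : T' -> R) : mu.-integrable setT (EFin \o phi) ->
  \int[P]_w phi (X w) = \int[mu]_x phi x.
Proof.
move=> iphi; rewrite /Rintegral; congr fine.
rewrite (eq_measure_integral (distribution P X)); last first.
  by move=> A mA _; apply/esym; exact: X_law.
rewrite integral_distribution//; first by case/integrableP: iphi.
exact: integrable_law.
Qed.

End integral_of_law.

Section clt_step.
Context {d} {T : measurableType d} {R : realType} (P : probability T R) {m : nat}.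
Variables (X : 'I_m -> {RV P >-> R}) (X_indep : mutually_independent X).
Variables (mu : probability R R).
Hypothesis X_law : forall i A, measurable A -> P (X i @^-1` A) = mu A.
Variables (psi : R -> R) (mpsi : measurable_fun setT psi).
Hypothesis psi2_int : mu.-integrable setT (EFin \o (fun x => psi x ^+ 2)).
Hypothesis psi_int : mu.-integrable setT (EFin \o psi).
Hypothesis psi_mean : \int[mu]_x psi x = 0.
Hypothesis psi_var : \int[mu]_x (psi x ^+ 2) = 1.
Variables (f f' : R -> R) (M L : R).
Hypothesis f_derive : forall x : R, is_derive x 1 f (f' x).
Hypothesis fM : forall x, `|f x| <= M.
Hypothesis f'M : forall x, `|f' x| <= M.
Hypothesis f'L : forall x y, `|f' x - f' y| <= L * `|x - y|.

Let M0 : 0 <= M. Proof. exact: le_trans (normr_ge0 _) (fM 0). Qed.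

Definition normalized_sum (w : T) : R := (Num.sqrt m%:R)^-1 * \sum_(i < m) psi (X i w).

Definition stein_error : R :=
  \int[mu]_x ((1 + psi x ^+ 2) * Num.min (2 * M) (L * (`|psi x| / Num.sqrt m%:R))).

Hypothesis m_gt0 : (0 < m)%N.

Let sm0 : 0 < Num.sqrt m%:R :> R.
Proof. by rewrite sqrtr_gt0 ltr0n. Qed.

Let xi x := psi x / Num.sqrt m%:R.

Let mxi : measurable_fun setT xi.
Proof. exact: measurable_funM. Qed.

Let xi2E x : xi x ^+ 2 = psi x ^+ 2 / m%:R.
Proof. by rewrite /xi expr_div_n sqr_sqrtr. Qed.

Let cf : continuous f := is_derive_continuous f_derive.

Let f'_cont : continuous f' := lipschitz_continuous f'L.

Let remainder s x :
  `|m%:R^-1 * (f' (s + x) - f' s) - x * (f (s + x) - f s - x * f' s)|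
   <= (m%:R^-1 + x ^+ 2) * Num.min (2 * M) (L * `|x|).
Proof.
pose K := Num.min (2 * M) (L * `|x|).
have f'K z : `|z - s| <= `|x| -> `|f' z - f' s| <= K.
  move=> zx; rewrite /K le_min; apply/andP; split.
    by rewrite mulr2n mulrDl mul1r (le_trans (ler_normB _ _))// lerD.
  apply: le_trans (f'L z s) _; rewrite ler_wpM2l//.
  by have := le_trans (normr_ge0 _) (f'L 1 0); rewrite subr0 normr1 mulr1.
have fK : `|f (s + x) - f s - x * f' s| <= K * `|x|.
  have [c cs ->] : exists2 c, `|c - s| <= `|x| & f (s + x) - f s = x * f' c.
    have [x0|x0|->] := ltgtP x 0.
    - have sx : s + x < s by rewrite gtrDl.
      have [c cI E] := MVT sx (fun z _ => f_derive z) (is_derive_within (fun z _ => f_derive z)).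
      exists c; last by rewrite -opprB E mulrC; ring.
      move: cI; rewrite in_itv/= => /andP[c1 c2]; rewrite ltr0_norm ?subr_lt0// ltr0_norm//.
      lra.
    - have sx : s < s + x by rewrite ltrDl.
      have [c cI E] := MVT sx (fun z _ => f_derive z) (is_derive_within (fun z _ => f_derive z)).
      exists c; last by rewrite E mulrC; ring.
      move: cI; rewrite in_itv/= => /andP[c1 c2]; rewrite gtr0_norm ?subr_gt0// gtr0_norm//.
      lra.
    - by exists s; rewrite ?subrr ?normr0 // addr0 subrr mul0r.
  by rewrite -mulrBr normrM mulrC ler_wpM2r// f'K.
rewrite mulrDl; apply: le_trans (ler_normB _ _) _; apply: lerD.
  rewrite normrM ger0_norm ?invr_ge0// ler_wpM2l ?invr_ge0//.
  by apply: f'K; rewrite addrAC subrr add0r.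
by rewrite normrM -(real_normK (num_real x)) expr2 -mulrA ler_wpM2l// [leRHS]mulrC.
Qed.

Let S_without (i : 'I_m) (t : m.-tuple R) : R := \sum_(j < m | j != i) xi (tnth t j).

Let sumE (i : 'I_m) w : normalized_sum w = S_without i (rest_tuple X 0%R i w) + xi (X i w).
Proof.
rewrite /normalized_sum mulr_sumr (bigD1 i)//= addrC; congr (_ + _); last by rewrite mulrC.
by apply: eq_bigr => j ji; rewrite tnth_mktuple (negbTE ji) mulrC.
Qed.

Let g (i : 'I_m) (z : m.-tuple R * R) : R :=
  m%:R^-1 * f' (S_without i z.1 + xi z.2) - xi z.2 * f (S_without i z.1 + xi z.2).

Let mS i : measurable_fun setT (S_without i).
Proof.
rewrite /S_without; under eq_fun do rewrite big_mkcond/=.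
apply: (@measurable_sum _ _ _ _ _ _ (fun j t => if j != i then xi (tnth t j) else 0)) => j.
by case: (j != i) => //; apply: measurableT_comp => //; exact: measurable_tnth.
Qed.

Let mg i : measurable_fun setT (g i).
Proof.
have mxi2 : measurable_fun setT (fun z : m.-tuple R * R => xi z.2) by apply: measurableT_comp.
have mSx : measurable_fun setT (fun z : m.-tuple R * R => S_without i z.1 + xi z.2).
  by apply: measurable_funD => //; apply: (measurableT_comp (mS i)).
apply: measurable_funB; apply: measurable_funM => //.
  apply: (measurableT_comp (f := f')) => //; exact: continuous_measurable_fun.
apply: (measurableT_comp (f := f)) => //; exact: continuous_measurable_fun.
Qed.

Let bound (x : R) : R := (m%:R^-1 + xi x ^+ 2) * Num.min (2 * M) (L * `|xi x|).

Let int_cst r : mu.-integrable setT (EFin \o (fun=> r : R)).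
Proof. by apply: finite_measure_integrable_cst. Qed.

Let xi_int : mu.-integrable setT (EFin \o xi).
Proof.
apply: eq_integrable (integrableZl measurableT (Num.sqrt m%:R)^-1 psi_int) => //.
by move=> x _; rewrite /= /xi mulrC EFinM.
Qed.

Let xi2_int : mu.-integrable setT (EFin \o (fun x => xi x ^+ 2)).
Proof.
apply: eq_integrable (integrableZl measurableT m%:R^-1 psi2_int) => //.
by move=> x _; rewrite /= xi2E mulrC EFinM.
Qed.

Let xi_mean : \int[mu]_x xi x = 0.
Proof.
rewrite /xi; under eq_Rintegral do rewrite mulrC.
by rewrite RintegralZl// psi_mean mulr0.
Qed.

Let xi_var : \int[mu]_x (xi x ^+ 2) = m%:R^-1.
Proof.
under eq_Rintegral do rewrite xi2E mulrC.
by rewrite RintegralZl// psi_var mulr1.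
Qed.

Let mbound : measurable_fun setT bound.
Proof.
apply: measurable_funM; first by apply: measurable_funD => //; exact: measurable_funX.
apply: measurable_minr => //; apply: measurable_funM => //.
exact: measurableT_comp.
Qed.

Let L0 : 0 <= L.
Proof. by have := le_trans (normr_ge0 _) (f'L 1 0); rewrite subr0 normr1 mulr1. Qed.

Let bound_ge0 x : 0 <= bound x.
Proof.
rewrite /bound mulr_ge0 ?addr_ge0 ?sqr_ge0 ?invr_ge0//.
by rewrite le_min !mulr_ge0.
Qed.

Let bound_int : mu.-integrable setT (EFin \o bound).
Proof.
have I : mu.-integrable setT (EFin \o (fun x => 2 * M * (m%:R^-1 + xi x ^+ 2))).
  apply: eq_integrable (integrableZl measurableT (2 * M) (integrableD measurableT (int_cst m%:R^-1) xi2_int)) => //.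
apply: le_integrable I => //; first exact/measurable_EFinP.
move=> x _; rewrite /= lee_fin ger0_norm//.
apply: le_trans (ler_norm _); rewrite mulrC /bound ler_wpM2l ?addr_ge0 ?sqr_ge0 ?invr_ge0//.
by rewrite ge_min lexx.
Qed.

(* The affine part of [g i (t, -)] has mean zero for every frozen [t]. *)
Let inner i t : mu.-integrable setT (EFin \o (fun x => g i (t, x))) /\
  `|\int[mu]_x (g i (t, x))| <= \int[mu]_x bound x.
Proof.
set s := S_without i t.
pose r x := m%:R^-1 * (f' (s + xi x) - f' s) - xi x * (f (s + xi x) - f s - xi x * f' s).
pose l x := m%:R^-1 * f' s - f s * xi x - f' s * xi x ^+ 2.
have lE x : l x = m%:R^-1 * f' s - f s * xi x - f' s * xi x ^+ 2 by [].
have gE x : g i (t, x) = r x + l x by rewrite /g /r /l /= -/s; ring.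
have Il : mu.-integrable setT (EFin \o l).
  apply: eq_integrable (integrableB measurableT (integrableB measurableT
    (int_cst (m%:R^-1 * f' s)) (integrableZl measurableT (f s) xi_int))
    (integrableZl measurableT (f' s) xi2_int)) => //.
have l0 : \int[mu]_x l x = 0.
  rewrite /l RintegralB//; last 2 first.
  - apply: eq_integrable (integrableB measurableT
      (int_cst (m%:R^-1 * f' s)) (integrableZl measurableT (f s) xi_int)) => //.
  - exact: (integrableZl measurableT (f' s) xi2_int).
  rewrite RintegralB//; last exact: (integrableZl measurableT (f s) xi_int).
  rewrite !RintegralZl// xi_mean xi_var mulr0 subr0 Rintegral_prob_cst.
  by rewrite mulrC subrr.
have mr : measurable_fun setT r.
  have mf : measurable_fun setT f := continuous_measurable_fun cf.
  have mf' : measurable_fun setT f' := continuous_measurable_fun f'_cont.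
  have msx : measurable_fun setT (fun x => s + xi x) by exact: measurable_funD.
  by apply: measurable_funB; apply: measurable_funM => //;
    repeat apply: measurable_funB => //; try apply: measurableT_comp => //; apply: measurable_funM.
have rb x : `|r x| <= bound x by exact: remainder.
have Ir : mu.-integrable setT (EFin \o r).
  apply: le_integrable bound_int => //; first exact/measurable_EFinP.
  by move=> x _; rewrite /= lee_fin (ger0_norm (bound_ge0 x)).
split.
  apply: eq_integrable (integrableD measurableT Ir Il) => //.
  by move=> x _; rewrite /= gE.
under eq_Rintegral do rewrite gE.
rewrite RintegralD// l0 addr0.
apply: le_trans (le_normr_Rintegral measurableT Ir) _.
by apply: le_Rintegral => //; exact: (integrable_norm Ir).
Qed.


Let gI i : P.-integrable setT (EFin \o (fun w => g i (rest_tuple X 0%R i w, X i w))).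
Proof.
have I : P.-integrable setT (EFin \o (fun w => m%:R^-1 * M + M * `|xi (X i w)|)).
  have I1 := integrable_law (X_law i) (integrable_norm xi_int).
  have I2 : P.-integrable setT (EFin \o (fun=> m%:R^-1 * M)).
    exact: finite_measure_integrable_cst.
  exact: (integrableD measurableT I2 (integrableZl measurableT M I1)).
apply: le_integrable I => //.
  apply/measurable_EFinP; apply: (measurableT_comp (mg i)).
  exact: measurable_fun_pair.
move=> w _; rewrite /= lee_fin; apply: le_trans (ler_norm _).
rewrite /g /=; apply: le_trans (ler_normB _ _) _; rewrite !normrM; apply: lerD.
  by rewrite ger0_norm ?invr_ge0// ler_wpM2l ?invr_ge0.
by rewrite mulrC ler_wpM2r.
Qed.

Let stein_term i : `|\int[P]_w g i (rest_tuple X 0%R i w, X i w)| <= \int[mu]_x bound x.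
Proof.
apply: (freezing_coordinate_norm_le X_indep (X_law i)) => // t.
- by case: (inner i t).
- by case: (inner i t).
Qed.

(** [E (S f (S))] and [E (f' (S))] are compared one summand at a time: replacing
[S] by [S - xi_i] inside [f] makes the summand [xi_i] independent of the rest,
and costs at most [min (2 M, L |xi_i|)] in the increments of [f']. *)
Theorem stein_bound (h : R -> R) (c : R) :
  (forall x, f' x - x * f x = h x - c) ->
  `|\int[P]_w h (normalized_sum w) - c| <= stein_error.
Proof.
move=> fh.
have E w : h (normalized_sum w) = c + \sum_(i < m) g i (rest_tuple X 0%R i w, X i w).
  have -> : h (normalized_sum w) =
      c + (f' (normalized_sum w) - normalized_sum w * f (normalized_sum w)).
    by rewrite fh; ring.
  congr (_ + _); rewrite /g /=; under eq_bigr do rewrite -sumE.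
  have sc (r : R) : \sum_(i < m) m%:R^-1 * r = r.
    by rewrite sumr_const card_ord -[LHS]mulr_natl mulVKf// pnatr_eq0 -lt0n.
  rewrite sumrB sc.
  rewrite -mulr_suml; congr (_ - _ * _).
  by rewrite /normalized_sum mulr_sumr; apply: eq_bigr => i _; rewrite mulrC.
under eq_Rintegral do rewrite E.
rewrite RintegralD//; last 2 first.
- exact: finite_measure_integrable_cst.
- apply: eq_integrable (integrable_sum measurableT (index_enum _) (P := xpredT) (fun i _ => gI i)) => //.
  by move=> w _; rewrite /= sumEFin.
rewrite Rintegral_prob_cst addrC addKr Rintegral_sum//.
apply: le_trans (ler_norm_sum _ _ _) _.
apply: (@le_trans _ _ (\sum_(i < m) \int[mu]_x bound x)); first exact: ler_sum.
rewrite sumr_const card_ord /stein_error -[leLHS]mulr_natl -RintegralZl// le_eqVlt.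
apply/orP; left; apply/eqP; apply: eq_Rintegral => x _; rewrite /bound xi2E mulrA.
congr (_ * _); first by field; rewrite pnatr_eq0 -lt0n.
by rewrite /xi normrM (ger0_norm (x := _^-1)) ?invr_ge0 ?sqrtr_ge0.
Qed.

End clt_step.
Arguments stein_error {R} m mu psi M L.

Section central_limit.
Context {R : realType}.

Lemma std_cdf_lipschitz (x y : R) : `|std_cdf x - std_cdf y| <= normal_peak 1 * `|x - y|.
Proof.
have one : continuous ((fun=> 1) : R -> R) by exact: cst_continuous.
have oneB (z : R) : `|((fun=> 1) : R -> R) z| <= 1 by rewrite normr1.
have D (z : R) : is_derive z 1 (@std_cdf R) (1 * std_pdf z).
  rewrite (_ : std_cdf = fun y => \int[lebesgue_measure]_(t in `]-oo, y]) (1 * std_pdf t)).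
    exact: (is_derive_std_pdfM one oneB z).
  by apply/funext => v; rewrite std_cdfE; apply: eq_Rintegral => t _; rewrite mul1r.
apply: (derive_lipschitz D) => z; rewrite mul1r ger0_norm ?(ltW (std_pdf_gt0 z))//.
by apply: normal_pdf_ub; rewrite oner_eq0.
Qed.

(** A Lipschitz surrogate for the indicator of a half-line. *)
Definition ramp (a b x : R) : R := Num.max 0 (Num.min 1 ((b - x) / (b - a))).

Section ramp.
Variables (a b : R) (ab : a < b).

Let ba : 0 < b - a. Proof. by rewrite subr_gt0. Qed.

Lemma ramp_itv x : 0 <= ramp a b x <= 1.
Proof. by rewrite /ramp le_max lexx ge_max ler01 ge_min lexx. Qed.

Lemma ramp_left x : x <= a -> ramp a b x = 1.
Proof.
move=> xa; have h : 1 <= (b - x) / (b - a) by rewrite ler_pdivlMr// mul1r lerD2l lerN2.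
by rewrite /ramp (min_idPl h); apply/max_idPr.
Qed.

Lemma ramp_right x : b <= x -> ramp a b x = 0.
Proof.
move=> bx; have h : (b - x) / (b - a) <= 0 by rewrite ler_pdivrMr// mul0r subr_le0.
rewrite /ramp; apply/max_idPl; rewrite ge_min h orbT//.
Qed.

Lemma ramp_lipschitz x y : `|ramp a b x - ramp a b y| <= (b - a)^-1 * `|x - y|.
Proof.
have E : (b - a)^-1 * `|x - y| = `|(b - x) / (b - a) - (b - y) / (b - a)|.
  rewrite -mulrBl normrM (ger0_norm (x := _^-1)) ?invr_ge0 ?ltW// mulrC; congr (_ * _).
  by rewrite distrC; congr (`|_|); ring.
rewrite E /ramp; move: ((b - x) / (b - a)) ((b - y) / (b - a)) => u v.
have clamp (z : R) : [\/ z <= 0 /\ Num.max 0 (Num.min 1 z) = 0,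
    0 <= z <= 1 /\ Num.max 0 (Num.min 1 z) = z | 1 <= z /\ Num.max 0 (Num.min 1 z) = 1].
  have [z1|z1] := leP z 1; last by apply: Or33; split; [exact: ltW|exact/max_idPr/ler01].
  have [z0|z0] := leP z 0; first by apply: Or31; split => //; exact/max_idPl.
  by apply: Or32; split; [rewrite ?(ltW z0) ?z1|].
have h1 := ler_norm (u - v); have h2 := ler_norm (v - u); rewrite distrC in h2.
by case: (clamp u) => [] [pu ->]; case: (clamp v) => [] [pv ->];
  rewrite ler_norml; apply/andP; split; lra.
Qed.

Lemma ramp_continuous : continuous (ramp a b).
Proof.
exact: lipschitz_continuous ramp_lipschitz.
Qed.

End ramp.

Section stein_error_cvg.
Variables (mu : probability R R) (psi : R -> R) (mpsi : measurable_fun setT psi).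
Hypothesis psi2_int : mu.-integrable setT (EFin \o (fun x => psi x ^+ 2)).

Lemma cvg_sqrt_natr : Num.sqrt (m%:R : R) @[m --> \oo] --> +oo.
Proof.
apply/cvgryPge => A; near=> m.
rewrite (le_trans (ler_norm A))// -sqrtr_sqr ler_wsqrtr//.
by near: m; exact: nbhs_infty_ger.
Unshelve. all: by end_near. Qed.

Lemma cvg_invsqrt_natr : (Num.sqrt (m%:R : R))^-1 @[m --> \oo] --> (0 : R).
Proof.
apply/gtr0_cvgV0; last exact: cvg_sqrt_natr.
by near=> m; rewrite sqrtr_gt0 ltr0n; near: m; exact: nbhs_infty_gt.
Unshelve. all: by end_near. Qed.

(** Dominated convergence: a second moment is enough, as the minimum in the
error is bounded and goes to 0 pointwise. *)
Lemma stein_error_cvg0 (M L : R) : 0 <= M -> 0 <= L ->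
  stein_error m mu psi M L @[m --> \oo] --> (0 : R).
Proof.
move=> M0 L0.
have psi20 x : 0 <= 1 + psi x ^+ 2 by rewrite addr_ge0 ?sqr_ge0.
pose F (m : nat) x := (1 + psi x ^+ 2) * Num.min (2 * M) (L * (`|psi x| / Num.sqrt m%:R)).
pose D x := (1 + psi x ^+ 2) * (2 * M).
have F0 m x : 0 <= F m x.
  by rewrite mulr_ge0// le_min !mulr_ge0 ?invr_ge0 ?sqrtr_ge0.
have mF m : measurable_fun setT (F m).
  apply: measurable_funM; first by apply: measurable_funD => //; exact: measurable_funX.
  apply: measurable_minr => //; apply: measurable_funM => //; apply: measurable_funM => //.
  exact: measurableT_comp.
have ID : mu.-integrable setT (EFin \o D).
  have I1 : mu.-integrable setT (EFin \o (fun=> 1 : R)) by exact: finite_measure_integrable_cst.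
  apply: eq_integrable (integrableZl measurableT (2 * M) (integrableD measurableT I1 psi2_int)) => //.
  by move=> x _; rewrite /= /D -EFinD -EFinM mulrC.
have pt x : F m x @[m --> \oo] --> (0 : R).
  apply: (@squeeze_cvgr _ _ _ _ (fun=> 0) (fun m => ((1 + psi x ^+ 2) * (L * `|psi x|)) * (Num.sqrt m%:R)^-1)).
  - near=> m; rewrite F0/= /F -mulrA ler_wpM2l//.
    by rewrite ge_min mulrA lexx orbT.
  - exact: cvg_cst.
  - by apply: cvg0_mull; exact: cvg_invsqrt_natr.
have := @dominated_cvg _ _ _ mu setT measurableT (fun m x => (F m x)%:E) (fun=> 0%E) (EFin \o D).
rewrite integral0; have -> : (0 = (0:R)%:E)%E by [].
move=> H; apply: fine_cvg; apply: H => //.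
- by move=> m; apply/measurable_EFinP.
- by move=> x _; apply: cvg_EFin; [near=> m|exact: pt].
- move=> m x _; rewrite /= lee_fin ger0_norm// /F /D ler_wpM2l//.
  by rewrite ge_min lexx.
Unshelve. all: by end_near. Qed.

End stein_error_cvg.

Section clt.
Context {d : nat -> measure_display} {T : forall n, measurableType (d n)}.
Variables (P : forall n, probability (T n) R) (m : nat -> nat).
Variables (X : forall n, 'I_(m n) -> {RV (P n) >-> R}).
Arguments X : clear implicits.
Hypothesis X_indep : forall n, mutually_independent (X n).
Variables (mu : probability R R) (psi : R -> R) (mpsi : measurable_fun setT psi).
Hypothesis X_law : forall n i A, measurable A -> P n (X n i @^-1` A) = mu A.
Hypothesis psi2_int : mu.-integrable setT (EFin \o (fun x => psi x ^+ 2)).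
Hypothesis psi_int : mu.-integrable setT (EFin \o psi).
Hypothesis psi_mean : \int[mu]_x psi x = 0.
Hypothesis psi_var : \int[mu]_x (psi x ^+ 2) = 1.
Hypothesis m_infty : m n @[n --> \oo] --> \oo.

Let S n w := normalized_sum (X n) psi w.
Arguments S : clear implicits.

Lemma measurable_normalized_sum n : measurable_fun setT (S n).
Proof.
apply: measurable_funM => //.
apply: (@measurable_sum _ _ _ _ _ _ (fun i w => psi (X n i w))) => i.
exact: measurableT_comp.
Qed.

Let mSle n x : measurable [set w | S n w <= x].
Proof.
rewrite (_ : [set w | _] = S n @^-1` `]-oo, x]).
  by rewrite -[X in measurable X]setTI; apply: measurable_normalized_sum.
by apply/seteqP; split => w /=; rewrite in_itv.
Qed.

Lemma ramp_cvg (a b : R) : a < b ->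
  \int[P n]_w ramp a b (S n w) @[n --> \oo] --> gauss_mean (ramp a b).
Proof.
move=> ab.
have [f [f' [M [L [fd fE fM f'M f'L]]]]] := stein_solution (ramp_continuous ab)
  (ramp_itv a b) (ramp_left ab) (ramp_right ab) (ramp_lipschitz ab).
have M0 : 0 <= M by exact: le_trans (normr_ge0 _) (fM 0).
have L0 : 0 <= L by have := le_trans (normr_ge0 _) (f'L 1 0); rewrite subr0 normr1 mulr1.
have err0 : stein_error (m n) mu psi M L @[n --> \oo] --> (0 : R).
  exact: (cvg_comp _ _ m_infty (stein_error_cvg0 mpsi psi2_int M0 L0)).
have lo0 : gauss_mean (ramp a b) - stein_error (m n) mu psi M L @[n --> \oo] --> gauss_mean (ramp a b).
  by rewrite -[X in _ --> X]subr0; apply: cvgB => //; exact: cvg_cst.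
have hi0 : gauss_mean (ramp a b) + stein_error (m n) mu psi M L @[n --> \oo] --> gauss_mean (ramp a b).
  by rewrite -[X in _ --> X]addr0; apply: cvgD => //; exact: cvg_cst.
apply: squeeze_cvgr lo0 hi0; near=> n.
have mn : (0 < m n)%N by near: n; exact: (m_infty (nbhs_infty_gt 0)).
have := stein_bound (@X_indep n) (@X_law n) mpsi psi2_int psi_int psi_mean psi_var
  fd fM f'M f'L mn fE.
by rewrite ler_distl.
Unshelve. all: by end_near. Qed.

Let ramp_int n (a b : R) : a < b ->
  (P n).-integrable setT (EFin \o (fun w => ramp a b (S n w))).
Proof.
move=> ab; apply: (@le_integrable _ _ _ _ _ measurableT _ (fun=> 1%:E)).
- apply/measurable_EFinP; apply: measurableT_comp; last exact: measurable_normalized_sum.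
  exact: continuous_measurable_fun (ramp_continuous ab).
- move=> w _; rewrite /= lee_fin normr1; have /andP[h0 h1] := ramp_itv a b (S n w).
  by rewrite ger0_norm.
- exact: finite_measure_integrable_cst.
Qed.

Let indic_int n (x : R) : (P n).-integrable setT (EFin \o \1_[set w | S n w <= x]).
Proof. exact: integrable_indic. Qed.

Let prob_le n x : fine (P n [set w | S n w <= x]) = \int[P n]_w \1_[set w | S n w <= x] w.
Proof. by rewrite /Rintegral integral_indic// setIT. Qed.

Let prob_le_ramp n (a b : R) : a < b ->
  fine (P n [set w | S n w <= a]) <= \int[P n]_w ramp a b (S n w) <= fine (P n [set w | S n w <= b]).
Proof.
move=> ab; rewrite !prob_le; apply/andP; split; apply: le_Rintegral => //.
- exact: ramp_int.
- move=> w _; rewrite indicE; have [Sa|Sa] := leP (S n w) a.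
    by rewrite ramp_left//; case: (_ \in _).
  rewrite memNset /=; last by apply/negP; rewrite -ltNge.
  by have /andP[] := ramp_itv a b (S n w).
- exact: ramp_int.
- move=> w _; rewrite indicE; have [Sb|Sb] := leP (S n w) b.
    by rewrite mem_set//; have /andP[] := ramp_itv a b (S n w).
  by rewrite ramp_right// ltW.
Qed.

Let gauss_mean_ramp (a b : R) : a < b ->
  std_cdf a <= gauss_mean (ramp a b) <= std_cdf b.
Proof.
move=> ab; rewrite !std_cdfE (Rintegral_mkcond (@lebesgue_measure R) `]-oo, a]) (Rintegral_mkcond (@lebesgue_measure R) `]-oo, b]).
have int_r : (@lebesgue_measure R).-integrable setT (EFin \o (fun t => ramp a b t * std_pdf t)).
  apply: (integrable_std_pdfM (ramp_continuous ab) (B := 1)) => //.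
  by move=> t; have /andP[h0 h1] := ramp_itv a b t; rewrite ger0_norm.
have int_p c : (@lebesgue_measure R).-integrable setT (EFin \o (std_pdf \_ `]-oo, c])).
  rewrite -restrict_EFin; apply/(integrable_mkcond _ _).1 => //.
  exact: integrable_std_pdf.
apply/andP; split; apply: le_Rintegral => // t _; rewrite patchE.
  case: ifPn => [ta|_].
    have ta' : t <= a by move: ta; rewrite inE/= in_itv.
    by rewrite (ramp_left ab ta') mul1r.
  by rewrite mulr_ge0 ?(ltW (std_pdf_gt0 t))//; have /andP[] := ramp_itv a b t.
case: ifPn => [_|tb].
  by rewrite ler_piMl ?(ltW (std_pdf_gt0 t))//; have /andP[] := ramp_itv a b t.
rewrite ramp_right ?mul0r//.
by move: tb; rewrite notin_setE/= in_itv/= => /negP; rewrite -ltNge => /ltW.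
Qed.

(** The half-line is squeezed between two ramps; the Lipschitz bound on
[std_cdf] pays for their width. *)
Theorem clt (x : R) : P n [set w | S n w <= x] @[n --> \oo] --> (std_cdf x)%:E.
Proof.
suff H : fine (P n [set w | S n w <= x]) @[n --> \oo] --> std_cdf x.
  rewrite (_ : (fun n => P n _) = EFin \o (fun n => fine (P n [set w | S n w <= x]))).
    by apply: cvg_EFin => //; near=> n.
  by apply/funext => n /=; rewrite fineK// fin_num_measure.
apply/cvgrPdist_le => e e0.
have pk0 : 0 < normal_peak (1 : R) by rewrite normal_peak_gt0 ?oner_eq0.
pose dl := e / 2 / normal_peak 1.
have dl0 : 0 < dl by rewrite !divr_gt0.
have xd : x < x + dl by rewrite ltrDl.
have dx : x - dl < x by rewrite gtrBl.
have e20 : 0 < e / 2 by rewrite divr_gt0.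
have pd : normal_peak 1 * dl = e / 2 by rewrite /dl mulrC divfK ?gt_eqF.
have := cvgr_dist_le _ _ (ramp_cvg xd) _ e20; have := cvgr_dist_le _ _ (ramp_cvg dx) _ e20.
move=> near1 near2; near=> n.
have n1 : `|gauss_mean (ramp (x - dl) x) - \int[P n]_w ramp (x - dl) x (S n w)| <= e / 2 by near: n; exact: near1.
have n2 : `|gauss_mean (ramp x (x + dl)) - \int[P n]_w ramp x (x + dl) (S n w)| <= e / 2 by near: n; exact: near2.
have /andP[a1 a2] := prob_le_ramp n dx; have /andP[b1 b2] := prob_le_ramp n xd.
have /andP[c1 c2] := gauss_mean_ramp dx; have /andP[d1 d2] := gauss_mean_ramp xd.
have l1 := std_cdf_lipschitz (x + dl) x; have l2 := std_cdf_lipschitz x (x - dl).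
have d1E : `|x + dl - x| = dl by rewrite addrAC subrr add0r gtr0_norm.
have d2E : `|x - (x - dl)| = dl by rewrite opprB addrC subrK gtr0_norm.
move: l1 l2 n1 n2; rewrite d1E d2E pd.
rewrite !ler_norml => /andP[? ?] /andP[? ?] /andP[? ?] /andP[? ?].
by apply/andP; split; lra.
Unshelve. all: by end_near. Qed.

End clt.
End central_limit.

(** * Moments of exponential functionals *)

Section density.
Context {d} {T : measurableType d} {R : realType}.
Variables (mu nu : {measure set T -> \bar R}) (w : T -> R).
Hypotheses (mw : measurable_fun setT w) (w0 : forall x, 0 <= w x).
Hypothesis nuE : forall A, measurable A -> nu A = (\int[mu]_(x in A) (w x)%:E)%E.

Import HBNNSimple.

Let integral_density_nnsfun (f : {nnsfun T >-> R}) :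
  (\int[nu]_x (f x)%:E = \int[mu]_x (f x * w x)%:E)%E.
Proof.
under [LHS]eq_integral do rewrite fimfunE -fsumEFin//.
rewrite [LHS]ge0_integral_fsum//; last 2 first.
  - by move=> r; exact/measurable_EFinP/measurableT_comp.
  - by move=> n x _; rewrite EFinM nnfun_muleindic_ge0.
under [RHS]eq_integral.
  move=> x xD; rewrite fimfunE EFinM -fsumEFin// ge0_mule_fsuml; last first.
    by move=> r; rewrite EFinM nnfun_muleindic_ge0.
  over.
rewrite [RHS]ge0_integral_fsum//; last 2 first.
  - move=> r; apply: emeasurable_funM; last exact/measurable_EFinP.
    by apply/measurable_EFinP; exact: measurableT_comp.
  - by move=> n x _; apply: mule_ge0; [rewrite EFinM nnfun_muleindic_ge0|rewrite lee_fin].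
apply: eq_fsbigr => r _; rewrite integralZl_indic_nnsfun// integral_indic// setIT nuE//.
have [r0|r0] := ltP r 0.
  rewrite (_ : f @^-1` [set r] = set0) ?integral_set0 ?mule0; last first.
    by apply/seteqP; split => // x /= fxr; move: r0; rewrite -fxr ltNge fun_ge0.
  by rewrite integral0_eq// => x _; rewrite indic0 mulr0 mul0e.
rewrite -ge0_integralZl//; last 2 first.
  - exact/measurable_EFinP/measurable_funTS.
  - by move=> x _; rewrite lee_fin.
rewrite integral_mkcond/=; apply: eq_integral => x _.
rewrite patchE indicE; case: ifPn => _; first by rewrite mulr1.
by rewrite mulr0 mul0e.
Qed.

Lemma ge0_integral_density (f : T -> \bar R) :
  measurable_fun setT f -> (forall x, 0 <= f x)%E ->
  (\int[nu]_x f x = \int[mu]_x (f x * (w x)%:E))%E.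
Proof.
move=> mf f0; pose f_ := nnsfun_approx measurableT mf.
transitivity (lim (\int[nu]_x (f_ n x)%:E @[n --> \oo])%E).
  rewrite -monotone_convergence//=.
  - by apply: eq_integral => ? /[!inE] xD; apply/esym/cvg_lim => //=; exact: cvg_nnsfun_approx.
  - by move=> n; exact/measurable_EFinP/measurable_funTS.
  - by move=> n ? _; rewrite lee_fin.
  - by move=> ? _ ? ? mn; rewrite lee_fin; exact/lefP/nd_nnsfun_approx.
transitivity (lim (\int[mu]_x (f_ n x * w x)%:E @[n --> \oo])%E).
  by apply: congr_lim; apply/funext => n /=; exact: integral_density_nnsfun.
rewrite -monotone_convergence//=.
- apply: eq_integral => x /[!inE] xD; apply/cvg_lim => //=.
  under eq_fun do rewrite EFinM.
  by apply: cvgeZr => //; exact: cvg_nnsfun_approx.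
- by move=> n; exact/measurable_EFinP/measurable_funM.
- by move=> n x _; rewrite lee_fin mulr_ge0.
- by move=> x _ a b ab; rewrite lee_fin ler_wpM2r//; exact/lefP/nd_nnsfun_approx.
Qed.

End density.

Section exponential_moments.
Context {R : realType}.
Local Notation mu := (@exp_law R).
Local Notation lam := (@lebesgue_measure R).

Lemma measurable_expRM (p : R) : measurable_fun setT (fun x : R => expR (p * x)).
Proof. by apply: (measurableT_comp (@measurable_expR R)); exact: measurable_funM. Qed.

Lemma ge0_integral_exp_law (f : R -> R) : measurable_fun setT f -> (forall x, 0 <= f x) ->
  (\int[mu]_x (f x)%:E = \int[lam]_x (f x * exponential_pdf 1 x)%:E)%E.
Proof.
move=> mf f0.
pose exp1 := exponential_distribution_exponential_prob__canonical__probability_measure_Probability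
     (ltr01 : 0 < (1 : R)).
pose idR : measurableTypeR R -> R := idfun.
have mid : measurable_fun setT idR by move=> _ A mA; rewrite setTI preimage_id.
transitivity (\int[exp1]_x (f x)%:E)%E.
  have <- := @ge0_integral_pushforward _ _ _ _ R idR mid exp1 setT (EFin \o f) measurableT _ _.
  - by apply: eq_measure_integral => A mA _.
  - exact/measurable_EFinP.
  - by move=> x _; rewrite /= lee_fin.
rewrite (@ge0_integral_density _ _ _ lam exp1 (exponential_pdf 1))//.
- exact: measurable_exponential_pdf.
- by move=> x; apply: exponential_pdf_ge0.
- exact/measurable_EFinP.
Qed.

(** Exponential tilting reduces all the moments to the total masses of
exponential densities. *)
Lemma exponential_pdf_tilt (p x : R) : p < 1 ->
  expR (p * x) * exponential_pdf 1 x = (1 - p)^-1 * exponential_pdf (1 - p) x.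
Proof.
move=> p1; have [x0|x0] := ltP x 0; first by rewrite !lt0_exponential_pdf// !mulr0.
rewrite !exponential_pdfE// mul1r -expRD mulrA mulVf ?gt_eqF ?subr_gt0// mul1r.
by congr expR; ring.
Qed.

Lemma ge0_exp_law_moment (p : R) : p < 1 ->
  (\int[mu]_x (expR (p * x))%:E = ((1 - p)^-1)%:E)%E.
Proof.
move=> p1; rewrite (ge0_integral_exp_law (measurable_expRM p) (fun x => expR_ge0 _)).
under eq_integral do rewrite exponential_pdf_tilt// EFinM.
rewrite ge0_integralZl//; last 3 first.
- by apply/measurable_EFinP; exact: measurable_exponential_pdf.
- by move=> x _; rewrite lee_fin exponential_pdf_ge0// subr_ge0 ltW.
- by rewrite lee_fin invr_ge0 subr_ge0 ltW.
by rewrite integral_exponential_pdf ?subr_gt0// mule1.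
Qed.

Lemma exp_law_moment (p : R) : p < 1 ->
  mu.-integrable setT (EFin \o (fun x => expR (p * x))) /\
  \int[mu]_x expR (p * x) = (1 - p)^-1.
Proof.
move=> p1; have E := ge0_exp_law_moment p1; split; last by rewrite /Rintegral E.
apply/integrableP; split.
  by apply/measurable_EFinP; exact: measurable_expRM.
under eq_integral do rewrite /= ger0_norm ?expR_ge0//.
by rewrite E ltry.
Qed.


Let mexp_pdf (r : R) (D : set (measurableTypeR R)) : measurable_fun D (EFin \o exponential_pdf r).
Proof.
by apply/measurable_funTS/measurable_EFinP; exact: measurable_exponential_pdf.
Qed.

Lemma integral_exponential_pdf_itvNyc (r c : R) : 0 < r -> 0 <= c ->
  (\int[lam]_(x in `]-oo, c]) (exponential_pdf r x)%:E = (1 - expR (- r * c))%:E)%E.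
Proof.
move=> r0 c0.
have neg : (\int[lam]_(x in `]-oo, 0%R]) (exponential_pdf r x)%:E = 0)%E.
  rewrite -integral_itv_bndo_bndc; last exact: mexp_pdf.
  by apply: integral0_eq => x; rewrite /= in_itv/= => x0; rewrite lt0_exponential_pdf.
move: c0; rewrite le_eqVlt => /predU1P[<-|c0]; first by rewrite neg mulr0 expR0 subrr.
rewrite (@itv_bndbnd_setU _ _ -oo%O (BRight 0) (BRight c)) ?bnd_simp ?ltW//.
rewrite ge0_integral_setU//=; last 3 first.
- exact: mexp_pdf.
- by move=> x _; rewrite lee_fin exponential_pdf_ge0// ltW.
- apply/disj_set2P/seteqP; split => // x [] /=; rewrite !in_itv/= => x0 /andP[].
  by rewrite ltNge x0.
rewrite neg add0e integral_itv_obnd_cbnd; last exact: mexp_pdf.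
by have := exponential_prob_itv0c r c0; rewrite /exponential_prob => ->.
Qed.

Lemma exp_law_min_mean (p x : R) : 0 <= p < 1 -> 0 <= x ->
  \int[mu]_y Num.min (expR (p * x)) (expR (p * y)) =
  (1 - p)^-1 - ((1 - p)^-1 - 1) * expR (- (1 - p) * x).
Proof.
move=> /andP[p0 p1] x0.
have r0 : 0 < 1 - p by rewrite subr_gt0.
have mmin : measurable_fun setT (fun y => Num.min (expR (p * x)) (expR (p * y))).
  by apply: measurable_minr => //; exact: measurable_expRM.
have E y : Num.min (expR (p * x)) (expR (p * y)) =
    if y <= x then expR (p * y) else expR (p * x).
  case: ifPn => [yx|]; first by apply/min_idPr; rewrite ler_expR ler_wpM2l.
  by rewrite -ltNge => xy; apply/min_idPl; rewrite ler_expR ler_wpM2l// ltW.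
suff I : (\int[mu]_y (Num.min (expR (p * x)) (expR (p * y)))%:E =
    ((1 - p)^-1 * (1 - expR (- (1 - p) * x)) + expR (p * x) * expR (- x))%:E)%E.
  rewrite /Rintegral I /= -expRD (_ : p * x + - x = - (1 - p) * x); last by ring.
  by field; rewrite gt_eqF.
rewrite (ge0_integral_exp_law mmin); last by move=> y; rewrite le_min !expR_ge0.
rewrite -[in LHS](setUv `]-oo, x]%classic) ge0_integral_setU//=; last 4 first.
- exact: measurableC.
- rewrite setUv; apply/measurable_EFinP; apply: measurable_funM => //.
  exact: measurable_exponential_pdf.
- by move=> y _; rewrite lee_fin mulr_ge0 ?exponential_pdf_ge0// le_min !expR_ge0.
- exact/disj_setPCl.
rewrite EFinD; congr (_ + _)%E.
  rewrite EFinM -integral_exponential_pdf_itvNyc// -ge0_integralZl//; last 3 first.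
  - exact: mexp_pdf.
  - by move=> y _; rewrite lee_fin exponential_pdf_ge0// ltW.
  - by rewrite lee_fin invr_ge0 ltW.
  apply: eq_integral => y; rewrite inE/= in_itv/= => yx.
  by rewrite E yx exponential_pdf_tilt// EFinM.
rewrite setCitvl EFinM -exp_law_ccdf// /exp_law /exponential_prob -ge0_integralZl//; last 2 first.
- exact: mexp_pdf.
- by move=> y _; rewrite lee_fin exponential_pdf_ge0.
apply: eq_integral => y; rewrite inE/= in_itv/= andbT => xy.
by rewrite E leNgt xy EFinM.
Qed.

End exponential_moments.

Section iid_variance.
Context {d} {T : measurableType d} {R : realType} (P : probability T R) {m : nat}.
Variables (X : 'I_m -> {RV P >-> R}) (X_indep : mutually_independent X).
Variables (mu : probability R R).
Hypothesis X_law : forall i A, measurable A -> P (X i @^-1` A) = mu A.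

Lemma integrable_mul (f g : T -> R) : measurable_fun setT f -> measurable_fun setT g ->
  P.-integrable setT (EFin \o (fun w => f w ^+ 2)) ->
  P.-integrable setT (EFin \o (fun w => g w ^+ 2)) ->
  P.-integrable setT (EFin \o (fun w => f w * g w)).
Proof.
move=> mf mg f2 g2; apply: le_integrable (integrableD measurableT f2 g2) => //.
  exact/measurable_EFinP/measurable_funM.
move=> w _; rewrite /= lee_fin; apply: le_trans (ler_norm _).
have := sqr_ge0 (f w - g w); have := sqr_ge0 (f w + g w); have := sqr_ge0 (f w); have := sqr_ge0 (g w).
move=> ? ? ? ?; rewrite ler_norml; apply/andP; split; nra.
Qed.

Lemma iid_sum_variance (phi : R -> R) : measurable_fun setT phi ->
  mu.-integrable setT (EFin \o phi) ->
  mu.-integrable setT (EFin \o (fun x => phi x ^+ 2)) ->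
  \int[mu]_x phi x = 0 ->
  P.-integrable setT (EFin \o (fun w => (\sum_(i < m) phi (X i w)) ^+ 2)) /\
  \int[P]_w ((\sum_(i < m) phi (X i w)) ^+ 2) = m%:R * \int[mu]_x (phi x ^+ 2).
Proof.
move=> mphi I1 I2 mean0.
have mX i : measurable_fun setT (fun w => phi (X i w)) by exact: measurableT_comp.
have IX i : P.-integrable setT (EFin \o (fun w => phi (X i w) ^+ 2)).
  exact: (integrable_law (X_law i) I2).
have IXY i j : P.-integrable setT (EFin \o (fun w => phi (X i w) * phi (X j w))).
  by apply: integrable_mul.
have orth i j : j != i -> \int[P]_w (phi (X i w) * phi (X j w)) = 0.
  move=> ji; apply/eqP; rewrite -normr_le0.
  pose g (z : m.-tuple R * R) := phi z.2 * phi (tnth z.1 j).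
  have gE w : phi (X i w) * phi (X j w) = g (rest_tuple X 0%R i w, X i w).
    by rewrite /g /= tnth_mktuple (negbTE ji).
  under eq_Rintegral do rewrite gE.
  apply: (freezing_coordinate_norm_le X_indep (X_law i)).
  - apply: measurable_funM; first exact: measurableT_comp.
    apply: (measurableT_comp mphi); apply: (measurableT_comp (measurable_tnth j)) => //.
  - by apply: eq_integrable (IXY i j) => // w _; rewrite /= gE.
  - move=> t; apply: eq_integrable (integrableZl measurableT (phi (tnth t j)) I1) => //.
    by move=> x _; rewrite /= /g mulrC EFinM.
  - move=> t; rewrite /g /=; under eq_Rintegral do rewrite mulrC.
    by rewrite RintegralZl// mean0 mulr0 normr0.
have sqE w : (\sum_(i < m) phi (X i w)) ^+ 2 =
    \sum_(i < m) \sum_(j < m) phi (X i w) * phi (X j w).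
  by rewrite expr2 mulr_suml; apply: eq_bigr => i _; rewrite mulr_sumr.
have IS i : P.-integrable setT (EFin \o (fun w => \sum_(j < m) phi (X i w) * phi (X j w))).
  apply: eq_integrable (integrable_sum measurableT (index_enum _) (P := xpredT) (fun j _ => IXY i j)) => //.
  by move=> w _; rewrite /= sumEFin.
split.
  apply: eq_integrable (integrable_sum measurableT (index_enum _) (P := xpredT) (fun i _ => IS i)) => //.
  by move=> w _; rewrite /= sqE sumEFin.
under eq_Rintegral do rewrite sqE.
rewrite Rintegral_sum// (eq_bigr (fun=> \int[mu]_x (phi x ^+ 2))).
  by rewrite sumr_const card_ord mulr_natl.
move=> i _; rewrite Rintegral_sum// (bigD1 i)//= [X in _ + X]big1 ?addr0; last exact: orth.
exact: (Rintegral_law (X_law i) I2).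
Qed.

End iid_variance.

Section min_kernel.
Context {R : realType} (p : R) (p01 : 0 < p < 1 / 2).
Local Notation mu := (@exp_law R).

Let p0 : 0 < p. Proof. by case/andP: p01. Qed.
Let p1 : p < 1. Proof. by case/andP: p01 => _ h; apply: lt_trans h _; rewrite ltr_pdivrMr// mul1r ltr1n. Qed.

Definition min_projection (x : R) : R :=
  (1 - p)^-1 - ((1 - p)^-1 - 1) * expR (- (1 - p) * x).

Definition min_mean : R := 2 / (2 - p).

(** The completely degenerate part of the kernel [min (e^px) (e^py)] in its
    Hoeffding decomposition; [Num.max 0 y] only matters off the support. *)
Definition degenerate_min (x y : R) : R :=
  Num.min (expR (p * x)) (expR (p * y)) - min_projection x - min_projection y + min_mean.

Lemma measurable_min_projection : measurable_fun setT min_projection.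
Proof.
apply: measurable_funB => //; apply: measurable_funM => //; exact: measurable_expRM.
Qed.

Lemma min_projection_int : mu.-integrable setT (EFin \o min_projection) /\
  \int[mu]_x min_projection x = min_mean.
Proof.
have pN1 : - (1 - p) < 1 by have := p1; lra.
have [I E] := exp_law_moment pN1.
have Ic : mu.-integrable setT (EFin \o (fun=> (1 - p)^-1)).
  exact: finite_measure_integrable_cst.
split.
  exact: (integrableB measurableT Ic (integrableZl measurableT ((1 - p)^-1 - 1) I)).
rewrite RintegralB//; last exact: (integrableZl measurableT ((1 - p)^-1 - 1) I).
rewrite Rintegral_prob_cst RintegralZl// E /min_mean; have := p0; have := p1 => *.
by field; apply/andP; split; rewrite gt_eqF//; lra.
Qed.

Lemma degenerate_min_sym x y : degenerate_min x y = degenerate_min y x.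
Proof. by rewrite /degenerate_min minC; ring. Qed.

Let cst_int r : mu.-integrable setT (EFin \o (fun=> r : R)).
Proof. exact: finite_measure_integrable_cst. Qed.

Let min_int x : mu.-integrable setT (EFin \o (fun y => Num.min (expR (p * x)) (expR (p * y)))).
Proof.
apply: le_integrable (cst_int (expR (p * x))) => //.
  by apply/measurable_EFinP; apply: measurable_minr => //; exact: measurable_expRM.
move=> y _; rewrite /= lee_fin ger0_norm ?le_min ?expR_ge0//.
by rewrite ger0_norm ?expR_ge0// ge_min lexx.
Qed.

Lemma degenerate_min_mean x : 0 <= x ->
  mu.-integrable setT (EFin \o (degenerate_min x)) /\
  \int[mu]_y degenerate_min x y = 0.
Proof.
move=> x0; have [Ig Eg] := min_projection_int.
have I1 := integrableB measurableT (min_int x) (cst_int (min_projection x)).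
have I2 := integrableB measurableT I1 Ig.
split; first exact: (integrableD measurableT I2 (cst_int min_mean)).
pose f1 y := Num.min (expR (p * x)) (expR (p * y)) - min_projection x.
pose f2 y := f1 y - min_projection y.
rewrite /degenerate_min (@RintegralD _ _ _ mu setT f2 (fun=> min_mean))//.
rewrite /f2 (@RintegralB _ _ _ mu setT f1)//.
rewrite /f1 RintegralB// !Rintegral_prob_cst Eg exp_law_min_mean ?(ltW p0)//.
by rewrite /min_projection; ring.
Qed.

Definition degenerate_min_bound : R := 2 * (1 - p)^-1 + min_mean.

Lemma degenerate_min_le x y : 0 <= x -> 0 <= y ->
  degenerate_min x y ^+ 2 <= 2 * expR (2 * p * x) + 2 * degenerate_min_bound ^+ 2.
Proof.
move=> x0 y0.
have proj z : 0 <= z -> 0 <= min_projection z <= (1 - p)^-1.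
  move=> z0; have G1 : 1 <= (1 - p)^-1 by rewrite invf_ge1; have := p0; have := p1; lra.
  have e1 : expR (- (1 - p) * z) <= 1.
    by rewrite -[leRHS]expR0 ler_expR mulNr oppr_le0 mulr_ge0// subr_ge0; exact: ltW p1.
  have e0 := expR_ge0 (- (1 - p) * z).
  by rewrite /min_projection; apply/andP; split; nra.
have /andP[a0 a1] := proj _ x0; have /andP[b0 b1] := proj _ y0.
have m0 : 0 <= Num.min (expR (p * x)) (expR (p * y)) by rewrite le_min !expR_ge0.
have m1 : Num.min (expR (p * x)) (expR (p * y)) <= expR (p * x) by rewrite ge_min lexx.
have t0 : 0 <= min_mean by rewrite divr_ge0//; have := p1; lra.
have -> : 2 * p * x = p * x + p * x by ring.
rewrite expRD -expr2 /degenerate_min_bound /degenerate_min.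
move: (expR (p * x)) (Num.min _ _) m0 m1 (min_projection x) (min_projection y) a0 a1 b0 b1.
move=> e k k0 ke a b a0 a1 b0 b1.
set B := 2 * (1 - p)^-1 + min_mean.
have h1 : k - a - b + min_mean <= e + B by rewrite /B; lra.
have h2 : - (e + B) <= k - a - b + min_mean by rewrite /B; lra.
have : (k - a - b + min_mean) ^+ 2 <= (e + B) ^+ 2.
  by rewrite -ler_sqrt ?sqr_ge0// !sqrtr_sqr [leRHS]ger0_norm ?ler_norml ?h1 ?h2//; rewrite /B; lra.
move=> /le_trans; apply; have := sqr_ge0 (e - B); nra.
Qed.

End min_kernel.

(** * The degenerate part of the second moment *)

Section degenerate_ustat.
Context {d} {T : measurableType d} {R : realType} (P : probability T R) {m : nat}.
Variables (X : 'I_m -> {RV P >-> R}) (X_indep : mutually_independent X).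
Hypothesis X_law : forall i A, measurable A -> P (X i @^-1` A) = exp_law A.
Hypothesis X_ge0 : forall i w, 0 <= X i w.
Variables (p : R) (p01 : 0 < p < 1 / 2).
Local Notation mu := (@exp_law R).

Let p0 : 0 < p. Proof. by case/andP: p01. Qed.
Let p2 : 2 * p < 1. Proof. by case/andP: p01 => _; rewrite ltr_pdivlMr// mulrC. Qed.

Let D (q : 'I_m * 'I_m) (w : T) := degenerate_min p (X q.1 w) (X q.2 w).
Let offdiag := [seq q <- index_enum ('I_m * 'I_m)%type | q.1 != q.2].

Definition degenerate_min_var : R := 2 * (1 - 2 * p)^-1 + 2 * degenerate_min_bound p ^+ 2.
Local Notation C := degenerate_min_var.

Let mker : measurable_fun setT (fun z : R * R => degenerate_min p z.1 z.2).
Proof.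
have mp1 := measurableT_comp (measurable_min_projection p) (@measurable_fst _ _ R R).
have mp2 := measurableT_comp (measurable_min_projection p) (@measurable_snd _ _ R R).
have me1 := measurableT_comp (measurable_expRM p) (@measurable_fst _ _ R R).
have me2 := measurableT_comp (measurable_expRM p) (@measurable_snd _ _ R R).
have mm := measurable_minr me1 me2.
exact: (measurable_funD (measurable_funB (measurable_funB mm mp1) mp2) (measurable_cst _)).
Qed.

Let mD q : measurable_fun setT (D q).
Proof. exact: (measurableT_comp mker (measurable_fun_pair (measurable_funPT (X q.1)) (measurable_funPT (X q.2)))). Qed.

Let e2_int i : P.-integrable setT (EFin \o (fun w => 2 * expR (2 * p * X i w) + 2 * degenerate_min_bound p ^+ 2)).
Proof.
have [I _] := exp_law_moment p2.
have I1 := integrable_law (X_law i) I.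
have Ic : P.-integrable setT (EFin \o (fun=> 2 * degenerate_min_bound p ^+ 2)).
  exact: finite_measure_integrable_cst.
have := integrableD measurableT (integrableZl measurableT 2 I1) Ic.
by apply: eq_integrable => // w _.
Qed.

Let D2_le q w : D q w ^+ 2 <= 2 * expR (2 * p * X q.1 w) + 2 * degenerate_min_bound p ^+ 2.
Proof. exact: degenerate_min_le. Qed.

Let D2_int q : P.-integrable setT (EFin \o (fun w => D q w ^+ 2)).
Proof.
apply: le_integrable (e2_int q.1) => //.
  exact/measurable_EFinP/measurable_funX.
move=> w _; rewrite /= lee_fin ger0_norm ?sqr_ge0//.
exact: le_trans (D2_le q w) (ler_norm _).
Qed.

Let D2_mean q : \int[P]_w (D q w ^+ 2) <= C.
Proof.
have [I E] := exp_law_moment p2.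
have I1 := integrable_law (X_law q.1) I.
apply: le_trans (le_Rintegral measurableT (D2_int q) (e2_int q.1) (fun w _ => D2_le q w)) _.
have Ic : P.-integrable setT (EFin \o (fun=> 2 * degenerate_min_bound p ^+ 2)).
  exact: finite_measure_integrable_cst.
rewrite RintegralD//; last exact: (integrableZl measurableT 2 I1).
by rewrite RintegralZl// Rintegral_prob_cst (Rintegral_law (X_law q.1) I) E.
Qed.

Let DD_int q r : P.-integrable setT (EFin \o (fun w => D q w * D r w)).
Proof. exact: integrable_mul. Qed.

(* One index of [q] is missing from [r]: integrating it out first gives zero. *)
Let D_orth q (r : 'I_m * 'I_m) : q.1 != q.2 -> q.1 \notin [:: r.1; r.2] ->
  \int[P]_w (D q w * D r w) = 0.
Proof.
move=> q12; rewrite !inE negb_or => /andP[q1 q2].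
apply/eqP; rewrite -normr_le0; set i := q.1.
pose pos (t : m.-tuple R) (j : 'I_m) := Num.max 0 (tnth t j).
pose g (z : m.-tuple R * R) :=
  degenerate_min p (pos z.1 q.2) z.2 * degenerate_min p (pos z.1 r.1) (pos z.1 r.2).
have posE j w : i != j -> pos (rest_tuple X 0%R i w) j = X j w.
  move=> ij; rewrite /pos tnth_mktuple eq_sym (negbTE ij).
  exact/max_idPr.
have gE w : D q w * D r w = g (rest_tuple X 0%R i w, X i w).
  by rewrite /g /= !posE// /D degenerate_min_sym.
have mpos j : measurable_fun setT (fun z : m.-tuple R * R => pos z.1 j).
  have mf := @measurable_fst _ _ (m.-tuple R) R.
  have mt : measurable_fun setT (fun t : m.-tuple R => tnth t j) by exact: measurable_tnth.
  exact: (measurable_maxr (measurable_cst _) (measurableT_comp mt mf)).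
under eq_Rintegral do rewrite gE.
apply: (freezing_coordinate_norm_le X_indep (X_law i)).
- have ms := @measurable_snd _ _ (m.-tuple R) R.
  have k1 := measurableT_comp mker (measurable_fun_pair (mpos q.2) ms).
  have k2 := measurableT_comp mker (measurable_fun_pair (mpos r.1) (mpos r.2)).
  exact: (measurable_funM k1 k2).
- by apply: eq_integrable (DD_int q r) => // w _; rewrite /= gE.
- move=> t; have t0 : 0 <= pos t q.2 by rewrite le_max lexx.
  have [I _] := degenerate_min_mean p01 t0.
  apply: eq_integrable (integrableZl measurableT (degenerate_min p (pos t r.1) (pos t r.2)) I) => //.
  by move=> x _; rewrite /= /g mulrC EFinM.
- move=> t; have t0 : 0 <= pos t q.2 by rewrite le_max lexx.
  have [I E] := degenerate_min_mean p01 t0.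
  rewrite /g /=; under eq_Rintegral do rewrite mulrC.
  by rewrite RintegralZl// E mulr0 normr0.
Qed.

Let D_swap q w : D (q.2, q.1) w = D q w.
Proof. by rewrite /D degenerate_min_sym. Qed.

Let C0 : 0 <= C.
Proof.
by rewrite addr_ge0// mulr_ge0 ?sqr_ge0 ?invr_ge0// subr_ge0 ltW.
Qed.

Let DD_le q r : q.1 != q.2 -> r.1 != r.2 ->
  \int[P]_w (D q w * D r w) <=
  (if r == q then C else 0) + (if r == (q.2, q.1) then C else 0).
Proof.
move=> q12 r12.
have [->|rq] := eqVneq r q.
  rewrite -[leLHS]addr0; apply: lerD; last by case: ifP => _; rewrite ?C0.
  by under eq_Rintegral do rewrite -expr2; exact: D2_mean.
rewrite add0r; have [->|rq'] := eqVneq r (q.2, q.1).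
  under eq_Rintegral do rewrite D_swap -expr2; exact: D2_mean.
have [i1|i1] := boolP (q.1 \in [:: r.1; r.2]); last by rewrite D_orth.
have [i2|i2] := boolP (q.2 \in [:: r.1; r.2]).
  case: q r q12 r12 rq rq' i1 i2 => [a b] [a' b'] /= ab ab' n1 n2.
  rewrite !inE => /orP[/eqP aa|/eqP aa] /orP[/eqP bb|/eqP bb]; subst.
  - by rewrite eqxx in ab.
  - by rewrite eqxx in n1.
  - by rewrite eqxx in n2.
  - by rewrite eqxx in ab.
under eq_Rintegral do rewrite -D_swap.
by rewrite D_orth//= eq_sym.
Qed.

Definition degenerate_ustat (w : T) : R :=
  \sum_(q <- [seq q <- index_enum ('I_m * 'I_m)%type | q.1 != q.2])
    degenerate_min p (X q.1 w) (X q.2 w).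

(** Distinct pairs of indices are uncorrelated unless they are equal up to a
swap, so that only [2 m^2] of the [m^4] covariances survive. *)
Lemma degenerate_ustat_variance :
  P.-integrable setT (EFin \o (fun w => degenerate_ustat w ^+ 2)) /\
  \int[P]_w (degenerate_ustat w ^+ 2) <= m%:R ^+ 2 * (2 * C).
Proof.
have sqE w : degenerate_ustat w ^+ 2 = \sum_(q <- offdiag) \sum_(r <- offdiag) D q w * D r w.
  by rewrite expr2 mulr_suml; apply: eq_bigr => q _; rewrite mulr_sumr.
have IS q : P.-integrable setT (EFin \o (fun w => \sum_(r <- offdiag) D q w * D r w)).
  apply: eq_integrable (integrable_sum measurableT offdiag (P := xpredT) (fun r _ => DD_int q r)) => //.
  by move=> w _; rewrite /= sumEFin.
split.
  apply: eq_integrable (integrable_sum measurableT offdiag (P := xpredT) (fun q _ => IS q)) => //.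
  by move=> w _; rewrite /= sqE sumEFin.
under eq_Rintegral do rewrite sqE.
rewrite Rintegral_sum// (eq_bigr (fun q => \sum_(r <- offdiag) \int[P]_w (D q w * D r w))); last first.
  by move=> q _; rewrite Rintegral_sum.
apply: (@le_trans _ _ (\sum_(q <- offdiag) 2 * C)).
  rewrite /offdiag !big_filter; apply: ler_sum => q q12.
  rewrite big_filter.
  apply: (@le_trans _ _ (\sum_(r | r.1 != r.2)
     ((if r == q then C else 0) + (if r == (q.2, q.1) then C else 0)))).
    by apply: ler_sum => r r12; exact: DD_le.
  apply: (@le_trans _ _ (\sum_r
     ((if r == q then C else 0) + (if r == (q.2, q.1) then C else 0)))).
    rewrite [leRHS](bigID (fun r : 'I_m * 'I_m => r.1 != r.2))/= lerDl.
    by apply: sumr_ge0 => r _; rewrite addr_ge0//; case: ifP.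
  by rewrite big_split/= -!big_mkcond/= !big_pred1_eq mulr2n mulrDl mul1r.
rewrite big_const_seq count_predT iter_addr_0 -[leLHS]mulr_natl ler_wpM2r ?mulr_ge0//.
rewrite -natrX ler_nat size_filter (leq_trans (count_size _ _))//.
by rewrite -[X in (size X <= _)%N]enumT -cardE card_prod card_ord mulnn.
Qed.

End degenerate_ustat.

(** * Events of high probability and Slutsky's lemma *)

Section high_probability.
Context {R : realType} {d : nat -> measure_display}
  {T : forall n, measurableType (d n)} (P : forall n, probability (T n) R).

(** The sets [A n] need not be measurable, which allows events described by
quantifiers over the sample. *)
Definition whp (A : forall n, set (T n)) := forall e : R, 0 < e ->
  \forall n \near \oo, exists B,
    [/\ measurable B, B `<=` A n & (P n (~` B) <= e%:E)%E].

Lemma whpS (A B : forall n, set (T n)) :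
  (\forall n \near \oo, A n `<=` B n) -> whp A -> whp B.
Proof.
move=> AB hA e e0; near=> n.
have [C [mC CA PC]] : exists C, [/\ measurable C, C `<=` A n & (P n (~` C) <= e%:E)%E].
  by near: n; exact: hA.
exists C; split=> //; apply: subset_trans CA _.
by near: n.
Unshelve. all: by end_near. Qed.

Lemma whpI (A B : forall n, set (T n)) : whp A -> whp B -> whp (fun n => A n `&` B n).
Proof.
move=> hA hB e e0; have e2 : 0 < e / 2 by rewrite divr_gt0.
near=> n.
have [C [mC CA PC]] : exists C, [/\ measurable C, C `<=` A n & (P n (~` C) <= (e / 2)%:E)%E].
  by near: n; exact: hA.
have [D [mD DB PD]] : exists C, [/\ measurable C, C `<=` B n & (P n (~` C) <= (e / 2)%:E)%E].
  by near: n; exact: hB.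
exists (C `&` D); split; [exact: measurableI|exact: setISS|].
rewrite setCI; apply: le_trans (measureU2 _ (measurableC mC) (measurableC mD)) _.
by rewrite [in leRHS](splitr e) EFinD leeD.
Unshelve. all: by end_near. Qed.

Lemma whp_measurable (A : forall n, set (T n)) : (forall n, measurable (A n)) ->
  (forall e : R, 0 < e -> \forall n \near \oo, (P n (~` A n) <= e%:E)%E) -> whp A.
Proof.
move=> mA hA e e0; have := hA e e0; apply: filterS => n h; exists (A n).
by split.
Qed.

(** Chebyshev's inequality. *)
Lemma whp_second_moment (Y : forall n, T n -> R) (b : nat -> R) (e : R) : 0 < e ->
  (forall n, measurable_fun setT (Y n)) ->
  (\forall n \near \oo, (P n).-integrable setT (EFin \o (fun w => Y n w ^+ 2)) /\
             \int[P n]_w (Y n w ^+ 2) <= b n) ->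
  b n @[n --> \oo] --> (0 : R) -> whp (fun n => [set w | `|Y n w| <= e]).
Proof.
move=> e0 mY hY b0; apply: whp_measurable => [n|r r0].
  have := measurableT_comp (@normr_measurable R setT) (mY n).
  by move=> /(_ measurableT _ (measurable_itv `]-oo, e])); rewrite setTI.
have er : 0 < r * e ^+ 2 by rewrite mulr_gt0// exprn_gt0.
near=> n.
have [I h] : (P n).-integrable setT (EFin \o (fun w => Y n w ^+ 2)) /\
             \int[P n]_w (Y n w ^+ 2) <= b n by near: n.
have bn : b n < r * e ^+ 2.
  near: n; move/cvgrPdist_lt : b0 => /(_ _ er); apply: filterS => n.
  by rewrite sub0r normrN; apply: le_lt_trans (ler_norm _).
have mY2 : measurable_fun setT (fun w => (Y n w ^+ 2)%:E).
  exact/measurable_EFinP/measurable_funX.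
have e20 : 0 < e ^+ 2 by rewrite exprn_gt0.
have hh := le_integral_abse (P n) measurableT mY2 e20.
have E : (\int[P n]_x `|(Y n x ^+ 2)%:E| = (\int[P n]_w (Y n w ^+ 2))%:E)%E.
  rewrite /Rintegral fineK; last exact: integrable_fin_num I.
  by apply: eq_integral => w _; rewrite gee0_abs ?lee_fin ?sqr_ge0.
rewrite E in hh.
have hb : \int[P n]_w (Y n w ^+ 2) <= e ^+ 2 * r by apply: le_trans h _; rewrite mulrC ltW.
have {hh}hh : ((e ^+ 2)%:E * P n (~` [set w | `|Y n w| <= e]%R) <= (e ^+ 2)%:E * r%:E)%E.
  rewrite -EFinM; apply: le_trans (le_trans _ hh) _; last by rewrite lee_fin.
  apply: lee_wpmul2l; first by rewrite lee_fin ltW.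
  apply: le_measure.
  - rewrite inE; apply: measurableC.
    have := measurableT_comp (@normr_measurable R setT) (mY n).
    by move=> /(_ measurableT _ (measurable_itv `]-oo, e])); rewrite setTI.
  - rewrite inE; apply: emeasurable_fun_c_infty => //.
    exact: measurableT_comp mY2.
  - move=> w /= /negP; rewrite -ltNge => h'; split=> //.
    by rewrite lee_fin ger0_norm ?sqr_ge0// -(real_normK (num_real (Y n w))) ler_sqr ?nnegrE ?(ltW h') ?(ltW e0).
by rewrite lee_pmul2l in hh.
Unshelve. all: by end_near. Qed.

Lemma probability_le_up (n : nat) (A B C : set (T n)) (e : R) :
  measurable A -> measurable B -> measurable C -> A `&` C `<=` B ->
  (P n (~` C) <= e%:E)%E -> fine (P n A) <= fine (P n B) + e.
Proof.
move=> mA mB mC ACB Ce.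
rewrite -lee_fin EFinD !fineK ?fin_num_measure//.
apply: (@le_trans _ _ (P n (B `|` ~` C))).
  apply: le_measure; rewrite ?inE//; first by apply: measurableU => //; exact: measurableC.
  move=> w Aw; have [Cw|Cw] := pselect (C w); [left; exact: ACB|by right].
apply: le_trans (measureU2 _ mB (measurableC mC)) _.
exact: leeD.
Qed.

(** The error is relative to [1 + |S n|], so that no tightness has to be proved:
on the event of interest [S n] is near [x], hence bounded. *)
Theorem slutsky (S X : forall n, T n -> R) (G : R -> R) : continuous G ->
  (forall n, measurable_fun setT (S n)) -> (forall n, measurable_fun setT (X n)) ->
  (forall x, P n [set w | S n w <= x] @[n --> \oo] --> (G x)%:E) ->
  (forall e : R, 0 < e -> whp (fun n => [set w | `|X n w - S n w| <= e * (1 + `|S n w|)])) ->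
  forall x, P n [set w | X n w <= x] @[n --> \oo] --> (G x)%:E.
Proof.
move=> cG mS mX cvS close x.
have mle (Z : forall n, T n -> R) n y : measurable_fun setT (Z n) -> measurable [set w | Z n w <= y].
  by move=> /(_ measurableT _ (measurable_itv `]-oo, y])); rewrite setTI.
suff H : fine (P n [set w | X n w <= x]) @[n --> \oo] --> G x.
  rewrite (_ : (fun n => P n _) = EFin \o (fun n => fine (P n [set w | X n w <= x]))).
    by apply: cvg_EFin => //; near=> n.
  by apply/funext => n /=; rewrite fineK// fin_num_measure//; exact: mle.
have cvS' y : fine (P n [set w | S n w <= y]) @[n --> \oo] --> G y.
  exact: (fine_cvg (cvS y)).
apply/cvgrPdist_le => e e0.
have e3 : 0 < e / 3 by rewrite divr_gt0.
have [h /andP[h0 h1] hG] : exists2 h : R, 0 < h <= 1 & forall y, `|x - y| <= h -> `|G x - G y| <= e / 3.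
  have /cvgrPdist_le/(_ _ e3) := cG x.
  move=> /nbhs_ballP[r /= r0 hr]; exists (Num.min (r / 2) 1).
    by rewrite lt_min divr_gt0//= ltr01 ge_min lexx orbT.
  move=> y xy; apply: hr; rewrite /ball/=; apply: le_lt_trans xy _.
  by rewrite gt_min ltr_pdivrMr// ltr_pMr// ltr1n.
pose c := h / (2 + `|x|).
have x2 : 0 < 2 + `|x| by rewrite ltr_wpDr.
have c0 : 0 < c by rewrite divr_gt0.
have ch : c * (1 + `|x| + h) <= h.
  by rewrite /c mulrAC ler_pdivrMr// ler_wpM2l//; [exact: ltW|lra].
have c1 : c < 1 by rewrite /c ltr_pdivrMr// mul1r; have := normr_ge0 x; lra.
near=> n.
have [B [mB Bsub PB]] : exists B, [/\ measurable B,
    B `<=` [set w | `|X n w - S n w| <= c * (1 + `|S n w|)] & (P n (~` B) <= (e / 3)%:E)%E].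
  by near: n; exact: close.
have lo : `|G (x - h) - fine (P n [set w | S n w <= x - h])| <= e / 3.
  by near: n; move/cvgrPdist_le : (cvS' (x - h)); exact.
have up : `|G (x + h) - fine (P n [set w | S n w <= x + h])| <= e / 3.
  by near: n; move/cvgrPdist_le : (cvS' (x + h)); exact.
have Glo : `|G x - G (x - h)| <= e / 3 by apply: hG; rewrite opprB addrCA subrr addr0 gtr0_norm.
have Gup : `|G x - G (x + h)| <= e / 3.
  by apply: hG; rewrite opprD addrA subrr add0r normrN gtr0_norm.
have Pup : fine (P n [set w | X n w <= x]) <= fine (P n [set w | S n w <= x + h]) + e / 3.
  apply: (probability_le_up _ _ mB) => //; [exact: mle|exact: mle|].
  move=> w /= [Xx /Bsub /= Xs]; rewrite leNgt; apply/negP => Sx.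
  move: Xs; rewrite ler_norml => /andP[+ _].
  have : `|S n w| <= (S n w - x - h) + (`|x| + h).
    rewrite {1}(_ : S n w = (S n w - x - h) + (x + h)); last by ring.
    apply: le_trans (ler_normD _ _) _; rewrite ger0_norm; last by lra.
    by rewrite lerD2l; apply: le_trans (ler_normD _ _) _; rewrite (gtr0_norm h0).
  move=> sb hx; move: ch; set s := S n w - x - h in sb *.
  have s0 : 0 < s by rewrite /s; lra.
  have : c * (1 + `|S n w|) <= c * s + c * (1 + `|x| + h).
    by rewrite -mulrDr ler_wpM2l//; [exact: ltW|lra].
  have : c * s < s by rewrite gtr_pMl.
  have : S n w = s + x + h by rewrite /s; ring.
  lra.
have Plo : fine (P n [set w | S n w <= x - h]) <= fine (P n [set w | X n w <= x]) + e / 3.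
  apply: (probability_le_up _ _ mB) => //; [exact: mle|exact: mle|].
  move=> w /= [Sx /Bsub /=]; rewrite ler_norml => /andP[_ hx].
  have sb : `|S n w| <= (x - h - S n w) + (`|x| + h).
    rewrite {1}(_ : S n w = - (x - h - S n w) + (x - h)); last by ring.
    apply: le_trans (ler_normD _ _) _; rewrite normrN ger0_norm; last by lra.
    by rewrite lerD2l; apply: le_trans (ler_normB _ _) _; rewrite (gtr0_norm h0).
  move: hx; set s := x - h - S n w in sb *.
  have s0 : 0 <= s by rewrite /s; lra.
  have : c * (1 + `|S n w|) <= c * s + c * (1 + `|x| + h).
    by rewrite -mulrDr ler_wpM2l//; [exact: ltW|lra].
  have : c * s <= s by rewrite ler_piMl// ltW.
  have : S n w = x - h - s by rewrite /s; ring.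
  lra.
rewrite ler_norml; move: lo up Glo Gup; rewrite !ler_norml.
move=> /andP[? ?] /andP[? ?] /andP[? ?] /andP[? ?]; apply/andP; split; lra.
Unshelve. all: by end_near. Qed.

End high_probability.

(** * The moment statistics of an exponential sample *)

Section exponential_combinations.
Context {R : realType}.
Local Notation mu := (@exp_law R).

Definition exp_sum (l : seq (R * R)) (x : R) : R := \sum_(q <- l) q.1 * expR (q.2 * x).

Lemma measurable_exp_sum l : measurable_fun setT (exp_sum l).
Proof.
apply: (@measurable_sum _ _ _ _ _ _ (fun (q : R * R) x => q.1 * expR (q.2 * x))) => q.
apply: measurable_funM => //; exact: measurable_expRM.
Qed.

Lemma exp_sum_mean (l : seq (R * R)) : all (fun q => q.2 < 1) l ->
  mu.-integrable setT (EFin \o exp_sum l) /\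
  \int[mu]_x exp_sum l x = \sum_(q <- l) q.1 / (1 - q.2).
Proof.
elim: l => [_|q l ih /= /andP[q1 /ih[I E]]].
  have E0 : exp_sum [::] = fun=> 0 by apply/funext => x; rewrite /exp_sum big_nil.
  rewrite E0 big_nil Rintegral_prob_cst; split => //.
  exact: finite_measure_integrable_cst.
have Eq : exp_sum (q :: l) = fun x => q.1 * expR (q.2 * x) + exp_sum l x.
  by apply/funext => x; rewrite /exp_sum big_cons.
have [Iq E1] := exp_law_moment q1.
have Iq' := integrableZl measurableT q.1 Iq.
rewrite Eq big_cons; split.
  by apply: eq_integrable (integrableD measurableT Iq' I).
by rewrite RintegralD// RintegralZl// E1 E.
Qed.

Lemma exp_sum_sqr (l : seq (R * R)) x : exp_sum l x ^+ 2 =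
  exp_sum [seq (a.1 * b.1, a.2 + b.2) | a <- l, b <- l] x.
Proof.
rewrite /exp_sum big_allpairs_dep expr2 mulr_suml; apply: eq_bigr => a _.
rewrite mulr_sumr; apply: eq_bigr => b _ /=.
by rewrite mulrDl expRD; ring.
Qed.

Lemma exp_sum_variance (l : seq (R * R)) : all (fun q => q.2 < 1 / 2) l ->
  mu.-integrable setT (EFin \o (fun x => exp_sum l x ^+ 2)) /\
  \int[mu]_x (exp_sum l x ^+ 2) =
    \sum_(a <- l) \sum_(b <- l) a.1 * b.1 / (1 - (a.2 + b.2)).
Proof.
move=> l2; pose l' := [seq (a.1 * b.1, a.2 + b.2) | a <- l, b <- l].
have l1 : all (fun q : R * R => q.2 < 1) l'.
  apply/allP => _ /allpairsP[[a b] /= [al bl ->]] /=.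
  by move/allP : l2 => l2; have := l2 _ al; have := l2 _ bl => /= ? ?; lra.
have [I E] := exp_sum_mean l1.
have E2 : (fun x => exp_sum l x ^+ 2) = exp_sum l'.
  by apply/funext => x; rewrite exp_sum_sqr.
by rewrite E2; split => //; rewrite E big_allpairs_dep.
Qed.

End exponential_combinations.

Section pwm_functionals.
Context {R : realType} (p : R) (p01 : 0 < p < 1 / 2).
Local Notation mu := (@exp_law R).

Let p0 : 0 < p. Proof. by case/andP: p01. Qed.
Let p2 : 2 * p < 1. Proof. by case/andP: p01 => _; rewrite ltr_pdivlMr// mulrC. Qed.

(** [a e^(px) + b e^(-(1-p)x) + c]: the first-order terms of all the statistics
    below are sums of such functions of the exponential variables. *)
Definition exp_comb (a b c : R) : R -> R := exp_sum [:: (a, p); (b, - (1 - p)); (c, 0)].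

Lemma exp_combE a b c x :
  exp_comb a b c x = a * expR (p * x) + b * expR (- (1 - p) * x) + c.
Proof. by rewrite /exp_comb /exp_sum !big_cons big_nil /= mul0r expR0 mulr1 addr0 addrA. Qed.

Lemma exp_comb_mean a b c :
  mu.-integrable setT (EFin \o exp_comb a b c) /\
  \int[mu]_x exp_comb a b c x = a / (1 - p) + b / (2 - p) + c.
Proof.
have [] := @exp_sum_mean R [:: (a, p); (b, - (1 - p)); (c, 0)].
  by apply/and4P; split => //=; have := p0; have := p2; lra.
rewrite /exp_comb => I ->; split=> //; rewrite !big_cons big_nil /= subr0 divr1 addr0 addrA.
by congr (_ + _ / _ + _); ring.
Qed.

Lemma exp_comb_sqr_int a b c :
  mu.-integrable setT (EFin \o (fun x => exp_comb a b c x ^+ 2)).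
Proof.
have [|//] := @exp_sum_variance R [:: (a, p); (b, - (1 - p)); (c, 0)].
by apply/and4P; split => //=; have := p0; have := p2; lra.
Qed.

Definition score_coef : R := 2 * (2 - p) * p / (1 - p).
Definition pwm_score : R -> R := exp_comb (1 - p) score_coef (- ((1 + p) / (1 - p))).
Definition score_variance : R :=
  p ^+ 2 * (1 - p + 2 * p ^+ 2) / ((1 - p) * (1 - 2 * p) * (3 - 2 * p)).

Lemma pwm_score_mean : \int[mu]_x pwm_score x = 0.
Proof.
have [_ ->] := exp_comb_mean (1 - p) score_coef (- ((1 + p) / (1 - p))).
rewrite /score_coef; have := p0; have := p2 => *.
by field; apply/andP; split; rewrite gt_eqF//; lra.
Qed.

Lemma pwm_score_variance : \int[mu]_x (pwm_score x ^+ 2) = score_variance.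
Proof.
have [|_] := @exp_sum_variance R [:: (1 - p, p); (score_coef, - (1 - p)); (- ((1 + p) / (1 - p)), 0)].
  by apply/and4P; split => //=; have := p0; have := p2; lra.
rewrite /pwm_score /exp_comb => ->; rewrite !big_cons !big_nil /= /score_coef /score_variance.
have := p0; have := p2 => *.
field.
by repeat (apply/andP; split); rewrite gt_eqF//; lra.
Qed.

Context {m : nat}.
Implicit Type t : m.-tuple R.

(** The limits of the two probability weighted moments relative to the smallest
weight. The weight [i / m] of the [i]-th largest term counts the terms above it,
which turns the second moment into a sum of minima over all the pairs: a
symmetric function of [t]. *)
Definition excess1 t : R := m%:R^-1 * \sum_i (expR (p * tnth t i) - 1).
Definition excess2 t : R := (2 * m%:R ^+ 2)^-1 *
  (\sum_i \sum_j (Num.min (expR (p * tnth t i)) (expR (p * tnth t j)) - 1) +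
   \sum_i (expR (p * tnth t i) - 1)).

Definition hajek_error t : R :=
  m%:R^-1 ^+ 2 * \sum_i exp_comb 1 0 (- (1 - p)^-1) (tnth t i)
  + 2^-1 * m%:R^-1 ^+ 2 * \sum_(q <- [seq q <- index_enum ('I_m * 'I_m)%type | q.1 != q.2])
      degenerate_min p (tnth t q.1) (tnth t q.2)
  + m%:R^-1 ^+ 2 * \sum_i exp_comb 0 (p / (1 - p)) (- (p / ((1 - p) * (2 - p)))) (tnth t i)
  + m%:R^-1 * ((1 - p)^-1 - (2 - p)^-1 - 2^-1).

(** Hoeffding's decomposition of the kernel [min (e^px) (e^py)]. *)
Lemma sum_min_hoeffding t :
  \sum_i \sum_j Num.min (expR (p * tnth t i)) (expR (p * tnth t j)) =
  \sum_(q <- [seq q <- index_enum ('I_m * 'I_m)%type | q.1 != q.2])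
      degenerate_min p (tnth t q.1) (tnth t q.2)
  + \sum_i expR (p * tnth t i) + 2 * (m%:R - 1) * \sum_i min_projection p (tnth t i)
  - m%:R * (m%:R - 1) * min_mean p.
Proof.
pose g i := min_projection p (tnth t i).
have card_sum (c : R) : \sum_(i < m) c = m%:R * c.
  by rewrite sumr_const card_ord mulr_natl.
have -> : \sum_i \sum_j Num.min (expR (p * tnth t i)) (expR (p * tnth t j)) =
  \sum_i \sum_j degenerate_min p (tnth t i) (tnth t j) + 2 * m%:R * \sum_i g i - m%:R ^+ 2 * min_mean p.
  rewrite (eq_bigr (fun i => \sum_j degenerate_min p (tnth t i) (tnth t j) +
     (m%:R * g i + \sum_j g j - m%:R * min_mean p))).
    rewrite big_split/= sumrB big_split /= -mulr_sumr !card_sum; ring.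
  move=> i _; rewrite -2!card_sum -big_split/= -sumrB -big_split/=.
  by apply: eq_bigr => j _; rewrite /degenerate_min /g; ring.
have -> : \sum_i \sum_j degenerate_min p (tnth t i) (tnth t j) =
  \sum_(q <- [seq q <- index_enum ('I_m * 'I_m)%type | q.1 != q.2])
      degenerate_min p (tnth t q.1) (tnth t q.2)
  + \sum_i (expR (p * tnth t i) - 2 * g i + min_mean p).
  rewrite pair_big/= (bigID (fun q : 'I_m * 'I_m => q.1 != q.2))/= big_filter; congr (_ + _).
  rewrite (reindex_onto (fun i : 'I_m => (i, i)) (fun q => q.1)) /=; last first.
    by move=> [i j] /=; rewrite negbK => /eqP ->.
  apply: eq_big => [i|i _]; first by rewrite eqxx.
  by rewrite /degenerate_min minxx /g; ring.
have -> : \sum_i (expR (p * tnth t i) - 2 * g i + min_mean p) =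
  \sum_i expR (p * tnth t i) - 2 * \sum_i g i + m%:R * min_mean p.
  by rewrite big_split/= sumrB -mulr_sumr card_sum.
by rewrite /g; ring.
Qed.

Lemma excess2E t : (0 < m)%N -> excess2 t =
  m%:R^-1 * \sum_i (min_projection p (tnth t i) - min_mean p)
  + (min_mean p - 1) / 2 + hajek_error t.
Proof.
move=> m0; have mR : (m%:R : R) != 0 by rewrite pnatr_eq0 -lt0n.
have card_sum (c : R) : \sum_(i < m) c = m%:R * c.
  by rewrite sumr_const card_ord mulr_natl.
have n1 : 1 - p != 0 by rewrite gt_eqF//; have := p2; have := p0; lra.
have n2 : 2 - p != 0 by rewrite gt_eqF//; have := p2; have := p0; lra.
rewrite /excess2 /hajek_error.
have -> : \sum_i \sum_j (Num.min (expR (p * tnth t i)) (expR (p * tnth t j)) - 1) =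
  \sum_i \sum_j Num.min (expR (p * tnth t i)) (expR (p * tnth t j)) - m%:R ^+ 2.
  under eq_bigr do rewrite sumrB card_sum mulr1.
  by rewrite sumrB card_sum expr2.
rewrite sum_min_hoeffding.
have -> : \sum_i exp_comb 1 0 (- (1 - p)^-1) (tnth t i) =
  \sum_i expR (p * tnth t i) - m%:R * (1 - p)^-1.
  rewrite -card_sum -sumrB; apply: eq_bigr => i _; rewrite exp_combE; ring.
have -> : \sum_i exp_comb 0 (p / (1 - p)) (- (p / ((1 - p) * (2 - p)))) (tnth t i) =
  m%:R * min_mean p - \sum_i min_projection p (tnth t i).
  rewrite -card_sum -sumrB; apply: eq_bigr => i _.
  by rewrite exp_combE /min_projection /min_mean; field; rewrite n1 n2.
rewrite !sumrB !card_sum mulr1 /min_mean; field.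
by rewrite n1 n2 mR.
Qed.

(** [pwm_num / pwm_den] is the estimation error: the estimator minus [p] has this
numerator. *)
Definition pwm_num t : R := (1 - p) * excess1 t - 2 * (2 - p) * excess2 t.
Definition pwm_den t : R := excess1 t - 2 * excess2 t.

Lemma pwm_numE t : (0 < m)%N -> pwm_num t =
  m%:R^-1 * \sum_i pwm_score (tnth t i) - 2 * (2 - p) * hajek_error t.
Proof.
move=> m0; rewrite /pwm_num excess2E// /excess1.
have mR : (m%:R : R) != 0 by rewrite pnatr_eq0 -lt0n.
have n1 : 1 - p != 0 by rewrite gt_eqF//; have := p2; have := p0; lra.
have n2 : 2 - p != 0 by rewrite gt_eqF//; have := p2; have := p0; lra.
have -> : \sum_i pwm_score (tnth t i) = (1 - p) * \sum_i (expR (p * tnth t i) - 1)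
   - 2 * (2 - p) * \sum_i (min_projection p (tnth t i) - min_mean p) - m%:R * p.
  have -> : m%:R * p = \sum_(i < m) p by rewrite sumr_const card_ord mulr_natl.
  rewrite !mulr_sumr -!sumrB; apply: eq_bigr => i _.
  rewrite /pwm_score exp_combE /min_projection /min_mean /score_coef; field; by rewrite n1 n2.
rewrite /min_mean; field; by rewrite n2 mR.
Qed.

Definition den_limit : R := p / ((1 - p) * (2 - p)).

Lemma pwm_denE t : (0 < m)%N -> pwm_den t = den_limit +
  m%:R^-1 * \sum_i exp_comb 1 (2 * p / (1 - p)) (- ((1 - p)^-1 + 2 * p / ((1 - p) * (2 - p)))) (tnth t i)
  - 2 * hajek_error t.
Proof.
move=> m0; rewrite /pwm_den excess2E// /excess1.
have mR : (m%:R : R) != 0 by rewrite pnatr_eq0 -lt0n.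
have n1 : 1 - p != 0 by rewrite gt_eqF//; have := p2; have := p0; lra.
have n2 : 2 - p != 0 by rewrite gt_eqF//; have := p2; have := p0; lra.
set c := - (_ + _).
have -> : \sum_i exp_comb 1 (2 * p / (1 - p)) c (tnth t i) = \sum_i (expR (p * tnth t i) - 1)
   - 2 * \sum_i (min_projection p (tnth t i) - min_mean p) - m%:R * (p / (1 - p)).
  have -> : m%:R * (p / (1 - p)) = \sum_(i < m) (p / (1 - p)) by rewrite sumr_const card_ord mulr_natl.
  rewrite !mulr_sumr -!sumrB; apply: eq_bigr => i _.
  rewrite exp_combE /min_projection /min_mean /c; field; by rewrite n1 n2.
rewrite /min_mean /den_limit; field; by rewrite n1 n2 mR.
Qed.

Lemma excess1E t : (0 < m)%N -> excess1 t = p / (1 - p) +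
  m%:R^-1 * \sum_i exp_comb 1 0 (- (1 - p)^-1) (tnth t i).
Proof.
move=> m0; rewrite /excess1.
have mR : (m%:R : R) != 0 by rewrite pnatr_eq0 -lt0n.
have n1 : 1 - p != 0 by rewrite gt_eqF//; have := p2; have := p0; lra.
have -> : \sum_i exp_comb 1 0 (- (1 - p)^-1) (tnth t i) = \sum_i (expR (p * tnth t i) - 1) - m%:R * (p / (1 - p)).
  have -> : m%:R * (p / (1 - p)) = \sum_(i < m) (p / (1 - p)) by rewrite sumr_const card_ord mulr_natl.
  by rewrite -!sumrB; apply: eq_bigr => i _; rewrite exp_combE; field.
by field; rewrite n1 mR.
Qed.

End pwm_functionals.

Section measure_helpers.
Context {R : realType}.

Lemma measurable_inv : measurable_fun setT (GRing.inv : R -> R).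
Proof.
have -> : setT = [set x : R | x != 0] `|` [set 0 : R].
  apply/esym; rewrite -subTset => x _ /=.
  by have [->|h] := eqVneq x 0; [right|left].
have op : open [set x : R | x != 0].
  rewrite (_ : mkset _ = ~` [set (0 : R)]); first exact/closed_openC/closed_eq.
  by apply/seteqP; split => x /= /eqP.
apply/measurable_funU => //; first exact: open_measurable.
split; last exact: measurable_fun_set1.
apply: open_continuous_measurable_fun => // x; rewrite inE /=; exact: inv_continuous.
Qed.

Context {d} {T : measurableType d} (P : probability T R) {n : nat}.

Lemma measurable_le (f : T -> R) c : measurable_fun setT f -> measurable [set w | f w <= c].
Proof. by move=> /(_ measurableT _ (measurable_itv `]-oo, c])); rewrite setTI. Qed.

Lemma measurable_gt (f : T -> R) c : measurable_fun setT f -> measurable [set w | c < f w].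
Proof.
move=> mf; rewrite (_ : mkset _ = ~` [set w | f w <= c]).
  by apply: measurableC; exact: measurable_le.
by apply/seteqP; split => w /=; rewrite ltNge => /negP.
Qed.

Lemma measurable_forall (A : 'I_n -> set T) : (forall i, measurable (A i)) ->
  measurable [set w | forall i, A i w].
Proof.
move=> mA; rewrite (_ : mkset _ = \bigcap_(i in [set: 'I_n]) A i).
  exact: fin_bigcap_measurable.
by apply/seteqP; split => [t St i _|t St i]; exact: St.
Qed.

Lemma union_bound (A : 'I_n -> set T) (c : R) : (forall i, measurable (A i)) ->
  (forall i, (P (A i) <= c%:E)%E) -> (P [set w | exists i, A i w] <= (n%:R * c)%:E)%E.
Proof.
move=> mA hA.
rewrite (_ : mkset _ = \big[setU/set0]_(i <- index_enum 'I_n) A i); last first.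
  rewrite -bigcup_seq; apply/seteqP; split => w /=.
    by move=> [i Ai]; exists i => //=; rewrite mem_index_enum.
  by move=> [i _ Ai]; exists i.
have -> : n%:R * c = (size (index_enum 'I_n))%:R * c.
  by rewrite -[index_enum _]enumT size_enum_ord.
elim: (index_enum _) => [|i s ih]; first by rewrite big_nil measure0 mul0r.
rewrite big_cons; apply: le_trans (measureU2 _ _ _) _ => //.
  by apply: bigsetU_measurable.
by rewrite /= -natr1 mulrDl mul1r EFinD addeC; exact: leeD.
Qed.

End measure_helpers.

Section pwm_limit.
Context {R : realType} (p : R) (p01 : 0 < p < 1 / 2).
Local Notation mu := (@exp_law R).
Context {d : nat -> measure_display} {T : forall n, measurableType (d n)}.
Variables (P : forall n, probability (T n) R) (m : nat -> nat).
Variables (X : forall n, 'I_(m n) -> {RV (P n) >-> R}).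
Arguments X : clear implicits.
Hypothesis X_indep : forall n, mutually_independent (X n).
Hypothesis X_law : forall n i A, measurable A -> P n (X n i @^-1` A) = mu A.
Hypothesis X_ge0 : forall n i w, 0 <= X n i w.
Hypothesis m_infty : m n @[n --> \oo] --> \oo.

Let p0 : 0 < p. Proof. by case/andP: p01. Qed.
Let p2 : 2 * p < 1. Proof. by case/andP: p01 => _; rewrite ltr_pdivlMr// mulrC. Qed.

Definition sample n w : (m n).-tuple R := [tuple X n i w | i < m n].
Arguments sample : clear implicits.

Let m_pos : \forall n \near \oo, (0 < m n)%N.
Proof. by move/cvgnyPgt : m_infty => /(_ 0%N). Qed.

Let minv_cvg0 : (m n)%:R^-1 @[n --> \oo] --> (0 : R).
Proof.
have mi : (m n)%:R @[n --> \oo] --> (+oo : set_system R).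
  by apply: (cvg_comp _ _ m_infty); exact: cvgr_idn.
exact: (cvg_comp _ _ mi cvg_inv_pinfty).
Qed.

Lemma whp_iid_sum (a b c : R) (r : nat -> R) (e : R) : 0 < e ->
  a / (1 - p) + b / (2 - p) + c = 0 ->
  r n ^+ 2 * (m n)%:R @[n --> \oo] --> (0 : R) ->
  whp P (fun n => [set w | `|r n * \sum_i exp_comb p a b c (tnth (sample n w) i)| <= e]).
Proof.
move=> e0 mean0 r0; have [I E] := exp_comb_mean p01 a b c.
have I2 := exp_comb_sqr_int p01 a b c.
have mphi := measurable_exp_sum [:: (a, p); (b, - (1 - p)); (c, 0)].
pose V := \int[mu]_x (exp_comb p a b c x ^+ 2).
apply: (@whp_second_moment _ _ _ P _ (fun n => r n ^+ 2 * (m n)%:R * V)) => //.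
- move=> n; apply: measurable_funM => //.
  apply: (@measurable_sum _ _ _ _ _ _ (fun i w => exp_comb p a b c (tnth (sample n w) i))) => i.
  under eq_fun do rewrite tnth_mktuple.
  exact: (measurableT_comp mphi (measurable_funPT (X n i))).
- near=> n.
  have [I' E'] := iid_sum_variance (@X_indep n) (@X_law n) mphi I I2 (etrans E mean0).
  have eqf : (fun w => (r n * \sum_i exp_comb p a b c (tnth (sample n w) i)) ^+ 2) =
    (fun w => r n ^+ 2 * (\sum_i exp_comb p a b c (X n i w)) ^+ 2).
    by apply/funext => w; rewrite exprMn; under eq_bigr do rewrite tnth_mktuple.
  split.
    rewrite (_ : _ \o _ = EFin \o (fun w => r n ^+ 2 * (\sum_i exp_comb p a b c (X n i w)) ^+ 2)).
      apply: eq_integrable (integrableZl measurableT (r n ^+ 2) I') => //.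
    by rewrite -eqf.
  by rewrite eqf RintegralZl// E' mulrA.
- by rewrite -(mul0r V); apply: cvgM => //; exact: cvg_cst.
Unshelve. all: by end_near. Qed.

Lemma whp_degenerate (r : nat -> R) (e : R) : 0 < e ->
  r n * (m n)%:R @[n --> \oo] --> (0 : R) ->
  whp P (fun n => [set w | `|r n * \sum_(q <- [seq q <- index_enum ('I_(m n) * 'I_(m n))%type | q.1 != q.2])
      degenerate_min p (tnth (sample n w) q.1) (tnth (sample n w) q.2)| <= e]).
Proof.
move=> e0 r0.
have eqf n : (fun w => r n * \sum_(q <- [seq q <- index_enum ('I_(m n) * 'I_(m n))%type | q.1 != q.2])
      degenerate_min p (tnth (sample n w) q.1) (tnth (sample n w) q.2)) =
      (fun w => r n * degenerate_ustat (X n) p w).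
  by apply/funext => w; congr (_ * _); apply: eq_bigr => q _; rewrite !tnth_mktuple.
have mU n : measurable_fun setT (fun w => r n * degenerate_ustat (X n) p w).
  apply: measurable_funM => //.
  apply: (@measurable_sum _ _ _ _ _ _ (fun q w => degenerate_min p (X n q.1 w) (X n q.2 w))) => q.
  have m1 i := measurableT_comp (measurable_min_projection p) (measurable_funPT (X n i)).
  have me i := measurableT_comp (measurable_expRM p) (measurable_funPT (X n i)).
  have mm := measurable_minr (me q.1) (me q.2).
  exact: (measurable_funD (measurable_funB (measurable_funB mm (m1 q.1)) (m1 q.2)) (measurable_cst _)).
apply: (@whpS _ _ _ _ (fun n => [set w | `|r n * degenerate_ustat (X n) p w| <= e])).
  by near=> n => w /=; rewrite -(congr1 (fun f => f w) (eqf n)).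
apply: (@whp_second_moment _ _ _ P _ (fun n => (r n * (m n)%:R) ^+ 2 * (2 * degenerate_min_var p))) => //.
- near=> n.
  have [I h] := degenerate_ustat_variance (@X_indep n) (@X_law n) (@X_ge0 n) p01.
  have eqs : (fun w => (r n * degenerate_ustat (X n) p w) ^+ 2) =
             (fun w => r n ^+ 2 * degenerate_ustat (X n) p w ^+ 2).
    by apply/funext => w; rewrite exprMn.
  rewrite eqs; split.
    exact: eq_integrable (integrableZl measurableT (r n ^+ 2) I).
  rewrite RintegralZl// [(r n * _) ^+ 2]exprMn -(mulrA (r n ^+ 2)).
  by apply: ler_wpM2l => //; exact: sqr_ge0.
- rewrite -(mul0r (2 * degenerate_min_var p)) -(mul0r (0:R)); apply: cvgM; last exact: cvg_cst.
  by under eq_fun do rewrite expr2; exact: cvgM.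
Unshelve. all: by end_near. Qed.

Let sqrt_inv_cvg0 : (Num.sqrt (m n)%:R)^-1 @[n --> \oo] --> (0 : R).
Proof. exact: (cvg_comp _ _ m_infty cvg_invsqrt_natr). Qed.

Let sqrt_sqr n : (Num.sqrt (m n)%:R : R) ^+ 2 = (m n)%:R.
Proof. by rewrite sqr_sqrtr. Qed.

Lemma whp_average (a b c e : R) : 0 < e -> a / (1 - p) + b / (2 - p) + c = 0 ->
  whp P (fun n => [set w | `|(m n)%:R^-1 * \sum_i exp_comb p a b c (tnth (sample n w) i)| <= e]).
Proof.
move=> e0 mean0; apply: whp_iid_sum => //.
apply: cvg_trans minv_cvg0; apply: near_eq_cvg; near=> n.
have m0 : (m n)%:R != 0 :> R by rewrite pnatr_eq0 -lt0n; near: n; exact: m_pos.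
by field.
Unshelve. all: by end_near. Qed.

Lemma whp_hajek_error (e : R) : 0 < e ->
  whp P (fun n => [set w | Num.sqrt (m n)%:R * `|hajek_error p (sample n w)| <= e]).
Proof.
move=> e0; have e4 : 0 < e / 4 by rewrite divr_gt0.
pose r n : R := Num.sqrt (m n)%:R * (m n)%:R^-1 ^+ 2.
have n1 : 1 - p != 0 by rewrite gt_eqF//; have := p2; have := p0; lra.
have n2 : 2 - p != 0 by rewrite gt_eqF//; have := p2; have := p0; lra.
have rE : \forall n \near \oo, r n ^+ 2 * (m n)%:R = (m n)%:R^-1 * (m n)%:R^-1.
  near=> n; have m0 : (m n)%:R != 0 :> R by rewrite pnatr_eq0 -lt0n; near: n; exact: m_pos.
  by rewrite /r exprMn sqrt_sqr; field.
have r2 : r n ^+ 2 * (m n)%:R @[n --> \oo] --> (0 : R).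
  apply: (cvg_trans (near_eq_cvg _)); last first.
    by rewrite -(mul0r (0 : R)); exact: (cvgM minv_cvg0 minv_cvg0).
  by apply: filterS rE => n ->.
have r1 : 2^-1 * r n * (m n)%:R @[n --> \oo] --> (0 : R).
  apply: (cvg_trans (near_eq_cvg _)); last first.
    by rewrite -(mulr0 (2^-1 : R)); exact: (cvgM (cvg_cst (2^-1 : R)) sqrt_inv_cvg0).
  near=> n; have m0 : (0 < m n)%N by near: n; exact: m_pos.
  have s0 : Num.sqrt (m n)%:R != 0 :> R by rewrite sqrtr_eq0 -ltNge ltr0n.
  by move: (sqrt_sqr n) s0; rewrite /r /=; set s := Num.sqrt _ => <- s0; field.
set c := (1 - p)^-1 - (2 - p)^-1 - 2^-1.
have rc : Num.sqrt (m n)%:R * (m n)%:R^-1 * c @[n --> \oo] --> (0 : R).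
  apply: (cvg_trans (near_eq_cvg _)); last first.
    by rewrite -(mul0r c); exact: (cvgM sqrt_inv_cvg0 (cvg_cst c)).
  near=> n; have m0 : (0 < m n)%N by near: n; exact: m_pos.
  have s0 : Num.sqrt (m n)%:R != 0 :> R by rewrite sqrtr_eq0 -ltNge ltr0n.
  by move: (sqrt_sqr n) s0; rewrite /=; set s := Num.sqrt _ => <- s0; field.
have mean1 : 1 / (1 - p) + 0 / (2 - p) + - (1 - p)^-1 = 0 by field; rewrite n1 n2.
have mean2 : 0 / (1 - p) + (p / (1 - p)) / (2 - p) + - (p / ((1 - p) * (2 - p))) = 0.
  by field; rewrite n1 n2.
have W := whpI (whpI (whp_iid_sum e4 mean1 r2) (whp_iid_sum e4 mean2 r2)) (whp_degenerate e4 r1).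
apply: whpS W; near=> n => w /= [[h1 h2] h3].
have h4 : `|Num.sqrt (m n)%:R * (m n)%:R^-1 * c| <= e / 4.
  near: n; move/cvgrPdist_le : rc => /(_ _ e4); apply: filterS => n.
  by rewrite sub0r normrN.
rewrite -(ger0_norm (sqrtr_ge0 (m n)%:R)) -normrM.
rewrite /hajek_error -/c.
set s1 := \sum_i _ in h1 *; set s2 := \sum_i _ in h2 *; set s3 := \sum_(q <- _) _ in h3 *.
rewrite (_ : _ * (_ + _) = r n * s1 + 2^-1 * r n * s3 + r n * s2 + Num.sqrt (m n)%:R * (m n)%:R^-1 * c); last by rewrite /r; ring.
apply: le_trans (ler_normD _ _) _.
have := ler_normD (r n * s1 + 2^-1 * r n * s3) (r n * s2).
have := ler_normD (r n * s1) (2^-1 * r n * s3).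
lra.
Unshelve. all: by end_near. Qed.

Let den0 : 0 < den_limit p.
Proof. by rewrite divr_gt0// mulr_gt0//; have := p2; have := p0; lra. Qed.

Lemma whp_pwm_den (e : R) : 0 < e ->
  whp P (fun n => [set w | `|pwm_den p (sample n w) - den_limit p| <= e]).
Proof.
move=> e0; have e4 : 0 < e / 4 by rewrite divr_gt0.
have n1 : 1 - p != 0 by rewrite gt_eqF//; have := p2; have := p0; lra.
have n2 : 2 - p != 0 by rewrite gt_eqF//; have := p2; have := p0; lra.
have mean1 : 1 / (1 - p) + (2 * p / (1 - p)) / (2 - p) + - ((1 - p)^-1 + 2 * p / ((1 - p) * (2 - p))) = 0.
  by field; rewrite n1 n2.
apply: whpS (whpI (whp_average e4 mean1) (whp_hajek_error e4)); near=> n => w /= [h1 h2].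
have m0 : (0 < m n)%N by near: n; exact: m_pos.
rewrite (pwm_denE p01 _ m0).
have s1 : 1 <= Num.sqrt (m n)%:R :> R by rewrite -[leLHS]sqrtr1 ler_wsqrtr// ler1n.
have : `|hajek_error p (sample n w)| <= e / 4.
  by apply: le_trans h2; rewrite ler_peMl.
move: h1; set a := _ * _; set b := hajek_error _ _; rewrite !ler_norml.
move=> /andP[? ?] /andP[? ?]; apply/andP; split; lra.
Unshelve. all: by end_near. Qed.

Lemma whp_excess1 : whp P (fun n => [set w | excess1 p (sample n w) <= p / (1 - p) + 1]).
Proof.
have n1 : 1 - p != 0 by rewrite gt_eqF//; have := p2; have := p0; lra.
have mean1 : 1 / (1 - p) + 0 / (2 - p) + - (1 - p)^-1 = 0 by rewrite mul0r; field.
apply: whpS (whp_average ltr01 mean1); near=> n => w /= h1.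
have m0 : (0 < m n)%N by near: n; exact: m_pos.
rewrite (excess1E p01 _ m0) lerD2l; exact: le_trans (ler_norm _) h1.
Unshelve. all: by end_near. Qed.

Lemma whp_max_le : whp P (fun n => [set w | forall i, tnth (sample n w) i <= 2 * ln (m n)%:R]).
Proof.
have mle n (i : 'I_(m n)) : measurable [set w | X n i w <= 2 * ln (m n)%:R].
  exact/measurable_le/measurable_funPT.
apply: (@whpS _ _ _ _ (fun n => [set w | forall i, X n i w <= 2 * ln (m n)%:R])).
  by near=> n => w /= h i; rewrite tnth_mktuple.
apply: whp_measurable => [n|e e0]; first exact: (measurable_forall (@mle n)).
near=> n; have m0 : (0 < m n)%N by near: n; exact: m_pos.
have m0R : (0 : R) < (m n)%:R by rewrite ltr0n.
have l0 : (0 : R) <= 2 * ln (m n)%:R by rewrite mulr_ge0// ln_ge0// ler1n.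
rewrite (_ : ~` _ = [set w | exists i, ~ X n i w <= 2 * ln (m n)%:R]); last first.
  by apply/seteqP; split => w /=; rewrite -existsNE.
have B i : (P n (~` [set w | X n i w <= 2 * ln (m n)%:R]%R) <= ((m n)%:R^-1 ^+ 2)%:E)%E.
  rewrite (_ : ~` _ = X n i @^-1` `]2 * ln (m n)%:R, +oo[); last first.
    by apply/seteqP; split => w /=; rewrite in_itv/= andbT ltNge => /negP.
  by rewrite X_law// exp_law_ccdf// lee_fin mulr_natl mulr2n opprD expRD expRN lnK ?posrE.
apply: le_trans (union_bound (fun i => measurableC (mle n i)) B) _.
rewrite lee_fin expr2 mulrA divff ?gt_eqF// mul1r.
near: n; move/cvgrPdist_le : minv_cvg0 => /(_ _ e0); apply: filterS => n.
by rewrite sub0r normrN; apply: le_trans (ler_norm _).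
Unshelve. all: by end_near. Qed.

Lemma measurable_excess1 k : measurable_fun setT (@excess1 R p k).
Proof.
apply: measurable_funM => //.
apply: (@measurable_sum _ _ _ _ _ _ (fun i (t : k.-tuple R) => expR (p * tnth t i) - 1)) => i.
apply: measurable_funB => //.
exact: (measurableT_comp (measurable_expRM p) (@measurable_tnth _ _ k i)).
Qed.

Lemma measurable_excess2 k : measurable_fun setT (@excess2 R p k).
Proof.
have me i := measurableT_comp (measurable_expRM p) (@measurable_tnth _ (measurableTypeR R) k i).
apply: measurable_funM => //; apply: measurable_funD.
  apply: (@measurable_sum _ _ _ _ _ _ (fun i (t : k.-tuple R) => \sum_j (Num.min (expR (p * tnth t i)) (expR (p * tnth t j)) - 1))) => i.
  apply: (@measurable_sum _ _ _ _ _ _ (fun j (t : k.-tuple R) => (Num.min (expR (p * tnth t i)) (expR (p * tnth t j)) - 1))) => j.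
  exact: (measurable_funB (measurable_minr (me i) (me j)) (measurable_cst _)).
apply: (@measurable_sum _ _ _ _ _ _ (fun i (t : k.-tuple R) => expR (p * tnth t i) - 1)) => i.
exact: (measurable_funB (me i) (measurable_cst _)).
Qed.

Definition pwm_stat k (t : k.-tuple R) : R := Num.sqrt k%:R * (pwm_num p t / pwm_den p t).

Lemma measurable_pwm_stat k : measurable_fun setT (@pwm_stat k).
Proof.
have m1 := @measurable_excess1 k; have m2 := @measurable_excess2 k.
apply: measurable_funM => //; apply: measurable_funM.
  by apply: measurable_funB; apply: measurable_funM.
apply: (measurableT_comp measurable_inv).
by apply: measurable_funB => //; apply: measurable_funM.
Qed.

Lemma measurable_sample n : measurable_fun setT (sample n).
Proof.
apply/measurable_fun_tnthP => i; rewrite /comp /=.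
by under eq_fun do rewrite tnth_mktuple; exact: measurable_funPT.
Qed.

Let sd : R := Num.sqrt (score_variance p).

Let sv0 : 0 < score_variance p.
Proof.
rewrite /score_variance divr_gt0//; have := p0; have := p2 => *; first by rewrite mulr_gt0 ?exprn_gt0//; nra.
by rewrite !mulr_gt0//; lra.
Qed.

Theorem pwm_stat_clt (x : R) :
  P n [set w | pwm_stat (sample n w) <= x] @[n --> \oo] --> (std_cdf (den_limit p / sd * x))%:E.
Proof.
have sd0 : 0 < sd by rewrite sqrtr_gt0.
have D0 := den0.
pose psi := fun x => sd^-1 * pwm_score p x.
have mscore : measurable_fun setT (pwm_score p) by exact: measurable_exp_sum.
have mpsi : measurable_fun setT psi by apply: measurable_funM.
have [I _] := exp_comb_mean p01 (1 - p) (score_coef p) (- ((1 + p) / (1 - p))).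
have I2 := exp_comb_sqr_int p01 (1 - p) (score_coef p) (- ((1 + p) / (1 - p))).
have sqE : (fun x => psi x ^+ 2) = (fun x => sd ^- 2 * pwm_score p x ^+ 2).
  by apply/funext => y; rewrite /psi exprMn exprVn.
have psi2 : mu.-integrable setT (EFin \o (fun x => psi x ^+ 2)).
  by rewrite sqE; exact: eq_integrable (integrableZl measurableT (sd ^- 2) I2).
have psi1 : mu.-integrable setT (EFin \o psi).
  exact: eq_integrable (integrableZl measurableT (sd ^-1) I).
have mean0 : \int[mu]_x psi x = 0 by rewrite RintegralZl// pwm_score_mean// mulr0.
have var1 : \int[mu]_x (psi x ^+ 2) = 1.
  by rewrite sqE RintegralZl// pwm_score_variance// sqr_sqrtr ?(ltW sv0)// mulVf// gt_eqF.
pose N n w := normalized_sum (X n) psi w.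
pose S n w := sd / den_limit p * N n w.
have mN n : measurable_fun setT (N n) by exact: measurable_normalized_sum.
apply: (@slutsky _ _ _ P S (fun n w => pwm_stat (sample n w)) (fun y => std_cdf (den_limit p / sd * y))) => {x}.
- apply: (@lipschitz_continuous _ _ (normal_peak 1 * `|den_limit p / sd|)) => y z.
  apply: le_trans (std_cdf_lipschitz _ _) _.
  by rewrite -mulrBr normrM mulrA.
- by move=> n; apply: measurable_funM.
- move=> n; have mf := @measurable_pwm_stat (m n); have mg := @measurable_sample n.
  by have := measurableT_comp mf mg.
- move=> x; have := @clt _ _ _ P m X X_indep _ _ mpsi X_law psi2 psi1 mean0 var1 m_infty (den_limit p / sd * x).
  rewrite (_ : (fun n => P n [set w | S n w <= x]) = (fun n => P n [set w | normalized_sum (X n) psi w <= den_limit p / sd * x])) //.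
  have SE n w : (S n w <= x) = (N n w <= den_limit p / sd * x).
    by rewrite /S -[sd / _]invf_div ler_pdivrMl// divr_gt0.
  by apply/funext => n; congr (P n _); apply/seteqP; split => w /=; rewrite SE.
move=> e e0.
set c := den_limit p in D0 *.
pose e1 := Num.min (c / 2) (e * c / 8).
have e10 : 0 < e1 by rewrite lt_min (divr_gt0 D0)//= divr_gt0// mulr_gt0.
have e1c : e1 <= c / 2 by rewrite ge_min lexx.
have e1e : e1 <= e * c / 8 by rewrite ge_min lexx orbT.
apply: whpS (whpI (whp_pwm_den e10) (whp_hajek_error e10)); near=> n => w /= [h1 h2].
have m0 : (0 < m n)%N by near: n; exact: m_pos.
have s0 : 0 < Num.sqrt (m n)%:R :> R by rewrite sqrtr_gt0 ltr0n.
rewrite /pwm_stat (pwm_numE p01 _ m0).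
have NE : (m n)%:R^-1 * \sum_i pwm_score p (tnth (sample n w) i) = (Num.sqrt (m n)%:R)^-1 * (c * S n w).
  rewrite /S /N /normalized_sum -mulr_sumr.
  under eq_bigr do rewrite tnth_mktuple.
  move: (sqrt_sqr n) s0; set s := Num.sqrt _ => <- s0.
  by rewrite -/c; field; rewrite !gt_eqF.
rewrite NE; move: h1 h2; rewrite -/c; set D := pwm_den _ _; set h := hajek_error _ _ => h1 h2.
have Dc : c / 2 <= D by move: h1; rewrite ler_norml => /andP[+ _]; lra.
have Dp : 0 < D by apply: lt_le_trans Dc; rewrite divr_gt0.
set s := Num.sqrt _ in s0 h2 *; move: (S n w) => y.
rewrite (_ : _ - y = (- (D - c) * y - 2 * (2 - p) * (s * h)) / D); last first.
  by field; rewrite !gt_eqF.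
rewrite normrM normfV (gtr0_norm Dp) ler_pdivrMr//.
apply: le_trans (ler_normB _ _) _.
have A1 : `|- (D - c) * y| <= e1 * `|y| by rewrite normrM normrN ler_wpM2r.
have A2 : `|2 * (2 - p) * (s * h)| <= 4 * e1.
  have sh : `|s * h| <= e1 by rewrite normrM (gtr0_norm s0).
  rewrite normrM; apply: ler_pM => //.
  by rewrite ger0_norm; have := p0; have := p2; lra.
have A3 : e * (1 + `|y|) * (c / 2) <= e * (1 + `|y|) * D.
  by rewrite ler_wpM2l// mulr_ge0 ?(ltW e0)// addr_ge0.
apply: le_trans _ A3; apply: le_trans (lerD A1 A2) _.
have A4 : e1 * `|y| <= e * c / 8 * `|y| by rewrite ler_wpM2r.
have ec : 0 < e * c by rewrite mulr_gt0.
have A5 : 0 <= e * c * `|y| := mulr_ge0 (ltW ec) (normr_ge0 y).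
lra.
Unshelve. all: by end_near. Qed.

End pwm_limit.

(** * Second-order regular variation *)

Section lebesgue_overlap.
Context {R : realType}.
Local Notation mu := (@lebesgue_measure R).

Definition shift_by (x : R) (y : measurableTypeR R) : measurableTypeR R := y - x.

Lemma measurable_shift_by x : measurable_fun setT (shift_by x).
Proof. by apply: measurable_funB. Qed.

HB.instance Definition _ x :=
  isMeasurableFun.Build _ _ _ _ (shift_by x) (measurable_shift_by x).

Lemma lebesgue_measure_shift (x : R) (A : set (measurableTypeR R)) :
  measurable A -> mu (shift_by x @^-1` A) = mu A.
Proof.
move=> mA; apply/esym; apply: (@lebesgue_measure_unique _ (pushforward mu (shift_by x))) => //= _ [[a b]] _ <-.
rewrite /pushforward (_ : _ @^-1` _ = `]a + x, b + x]%classic); last first.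
  by apply/seteqP; split => y /=; rewrite /shift_by !in_itv/= ltrBrDr lerBlDr.
rewrite !lebesgue_measure_itv/= !lte_fin ltrD2r.
by case: ifP => // _; rewrite -!EFinB; congr EFin; ring.
Qed.

(** Continuity from below along the increasing sets where [G n] holds from some
rank on. *)
Lemma eventually_large (G : nat -> set (measurableTypeR R)) :
  (forall n, measurable (G n)) ->
  (forall y, 0 <= y <= 3 -> \forall n \near \oo, G n y) ->
  \forall n \near \oo, (2%:E < mu (G n))%E.
Proof.
move=> mG Gy; pose B N := \bigcap_(n in [set n | (N <= n)%N]) G n.
have mB N : measurable (B N) by apply: bigcap_measurable => //; exists N => /=.
have ndB : nondecreasing_seq B.
  move=> a b ab; apply/subsetPset => y By n /= bn; apply: By => /=; exact: leq_trans bn.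
have := nondecreasing_cvg_mu (mu := mu) mB (bigcupT_measurable _ mB) ndB.
have le3 : (2%:E < mu (\bigcup_n B n))%E.
  apply: (@lt_le_trans _ _ (mu `[0, 3]%classic)).
    by rewrite lebesgue_measure_itv/= lte_fin ltr0n/= -EFinB subr0 lte_fin ltr_nat.
  apply: le_measure; rewrite ?inE//; first exact: bigcupT_measurable.
move=> /(_ _ (open_ereal_gt' le3))[N _ hN].
exists N => // n /= Nn; apply: lt_le_trans (hN N _) _ => //=.
by apply: le_measure; rewrite ?inE// => y; apply.
Qed.

(** A set of measure more than 2 in [0, 3] meets any other such set shifted by at
most 1, since both lie in [0, 4]. *)
Lemma overlap (A B : set (measurableTypeR R)) (x : R) : measurable A -> measurable B ->
  A `<=` `[0, 3]%classic -> B `<=` `[0, 3]%classic -> 0 <= x <= 1 ->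
  (2%:E < mu A)%E -> (2%:E < mu B)%E -> exists y, A y /\ B (y - x).
Proof.
move=> mA mB A3 B3 /andP[x0 x1] A2 B2; apply/not_existsP => h.
pose B' := shift_by x @^-1` B.
have mB' : measurable B'.
  by rewrite -[B']setTI; exact: measurable_shift_by.
have dis : A `&` B' = set0.
  by apply/seteqP; split => // y [Ay By]; apply: (h y).
have : (mu (A `|` B') <= mu `[0%R, 4%R]%classic)%E.
  apply: le_measure; rewrite ?inE//; first exact: measurableU.
  move=> y [/A3|/B3]; rewrite /shift_by /= !in_itv/= => /andP[? ?]; apply/andP; split; lra.
have EB : mu B' = mu B := lebesgue_measure_shift x mB.
have EU : (mu (A `|` B') = mu A + mu B')%E by apply: measureU.
rewrite EU EB lebesgue_measure_itv/= lte_fin ltr0n/=.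
rewrite -EFinB subr0; apply/negP; rewrite -ltNge.
have -> : (4%:E = 2%:E + 2%:E :> \bar R)%E by rewrite -EFinD; congr EFin; lra.
by apply: lteD.
Qed.

End lebesgue_overlap.

Section regular_variation.
Context {R : realType} (f g h : R -> R) (r H : R).
Hypotheses (mf : measurable_fun setT f) (mg : measurable_fun setT g).
Hypothesis g_neq0 : \forall s \near +oo, g s != 0.
Hypothesis f_lim : forall y, 0 <= y -> (f (s + y) - f s) / g s @[s --> +oo] --> h y.
Hypothesis g_lim : forall y, 0 <= y -> g (s + y) / g s @[s --> +oo] --> expR (r * y).
Hypothesis h_le : forall y, 0 <= y <= 3 -> `|h y| <= H.
Hypothesis r_le0 : r <= 0.

Let K : R := H + 1 + 2 * expR (- (3 * r)).

Let comparable (C s y : R) := [/\ `|f (s + y) - f s| <= C * `|g s|,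
  `|g (s + y)| <= C * `|g s| & `|g s| <= C * `|g (s + y)|].

Let H0 : 0 <= H.
Proof. by apply: le_trans (normr_ge0 (h 0)) (h_le _); rewrite lexx ler0n. Qed.

Let K1 : 1 <= K.
Proof. by have := H0; have := expR_gt0 (- (3 * r)); rewrite /K; lra. Qed.

Let comparable_near y : 0 <= y <= 3 -> \forall s \near +oo, comparable K s y.
Proof.
move=> y03; have /andP[y0 y3] := y03.
pose e := expR (r * y).
have e0 : 0 < e := expR_gt0 _.
have e2 : 0 < e / 2 by rewrite divr_gt0.
near=> s.
have gs : 0 < `|g s| by rewrite normr_gt0; near: s.
have e1 : e <= 1 by rewrite -[leRHS]expR0 ler_expR mulr_le0_ge0.
have F : `|h y - (f (s + y) - f s) / g s| <= 1.
  by near: s; move/cvgrPdist_le : (f_lim y0); apply.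
have G : `|e - g (s + y) / g s| <= e / 2.
  by near: s; move/cvgrPdist_le : (g_lim y0); apply.
have He : expR (- (3 * r)) * e >= 1.
  rewrite -[leRHS]expRD -[leLHS]expR0 ler_expR.
  have a1 : 0 <= - r by rewrite oppr_ge0.
  have a2 : 0 <= 3 - y by rewrite subr_ge0.
  by have := mulr_ge0 a1 a2; lra.
have Ep := expR_gt0 (- (3 * r)).
have hy := h_le y03.
split.
- rewrite -ler_pdivrMr// -normf_div; move: F hy; rewrite /K !ler_norml.
  by move=> /andP[? ?] /andP[? ?]; apply/andP; split; lra.
- rewrite -ler_pdivrMr// -normf_div; move: G; rewrite /K !ler_norml => /andP[? ?].
  by have := H0; move=> ?; apply/andP; split; nra.
- have ge2 : e / 2 <= `|g (s + y)| / `|g s|.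
    rewrite -normf_div; apply: le_trans (ler_norm _).
    by move: G; rewrite ler_norml => /andP[? ?]; lra.
  rewrite -ler_pdivrMl ?(lt_le_trans ltr01 K1)//.
  move: ge2; rewrite ler_pdivlMr// => ge2; apply: le_trans _ ge2.
  rewrite ler_wpM2r ?(ltW gs)//.
  suff : 1 <= K * (e / 2) by rewrite mulrC -ler_pdivrMr ?(lt_le_trans ltr01 K1)// mul1r.
  rewrite /K; have H1 := H0; have : 0 <= (H + 1) * (e / 2) by rewrite mulr_ge0 ?(ltW e2)//; lra.
  lra.
Unshelve. all: by end_near. Qed.

Let good (s : R) : set (measurableTypeR R) := [set y | 0 <= y <= 3 /\ comparable K s y].

Let measurable_good s : measurable (good s).
Proof.
have msh : measurable_fun setT (fun y : R => s + y) by exact: measurable_funD.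
have mfs := measurableT_comp mf msh.
have mgs := measurableT_comp mg msh.
have mn := @normr_measurable R setT.
have n1 := measurableT_comp mn (measurable_funB mfs (measurable_cst (f s))).
have n2 := measurableT_comp mn mgs.
have n3 := measurable_funM (measurable_cst (- K)) n2.
rewrite (_ : good s = `[0, 3]%classic `&`
  ([set y | `|f (s + y) - f s| <= K * `|g s|] `&`
  ([set y | `|g (s + y)| <= K * `|g s|] `&` [set y | - K * `|g (s + y)| <= - `|g s|]))).
  apply: measurableI => //; apply: measurableI; first exact: measurable_le n1.
  by apply: measurableI; [exact: measurable_le n2|exact: measurable_le n3].
apply/seteqP; split => y /=; rewrite in_itv/=.
  by move=> [-> [-> -> ?]]; split=> //; split=> //; split=> //; rewrite mulNr lerN2.
by move=> [? [? [? ]]]; rewrite mulNr lerN2.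
Qed.

(** A violation along [s_n], [x_n] would be contradicted at a point [y] such
    that [y] is good for [s_n] and [y - x_n] is good for [s_n + x_n]; it exists
    because both sets of good points are nearly all of [0, 3]. *)
Lemma locally_uniform_bound : exists2 C : R, 1 <= C &
  \forall s \near +oo, forall x, 0 <= x <= 1 ->
  [/\ `|f (s + x) - f s| <= C * `|g s|, `|g (s + x)| <= C * `|g s| & `|g s| <= C * `|g (s + x)|].
Proof.
pose C := K + K ^+ 3; have K0 : 0 <= K := le_trans ler01 K1.
exists C; first by rewrite /C; have := K1; have := exprn_ge0 3 K0; lra.
apply: contrapT => nC.
have bad n : exists sx : R * R, [/\ n%:R <= sx.1, 0 <= sx.2 <= 1 & ~ comparable C sx.1 sx.2].
  apply: contrapT => hn; apply: nC.
  have := nbhs_pinfty_ge (num_real (n%:R : R)); apply: filterS => s ns x x01.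
  by apply: contrapT => nc; apply: hn; exists (s, x).
have [sx hsx] := choice bad.
pose s n := (sx n).1; pose x n := (sx n).2.
have s_oo : s n @[n --> \oo] --> (+oo : set_system R).
  apply/cvgryPge => M; near=> n; apply: (@le_trans _ _ n%:R); last by have [] := hsx n.
  by near: n; exact: nbhs_infty_ger.
have sx_oo : s n + x n @[n --> \oo] --> (+oo : set_system R).
  apply/cvgryPge => M; near=> n; apply: (@le_trans _ _ (s n)).
    by near: n; move/cvgryPge : s_oo; apply.
  by have [_ /andP[x0 _] _] := hsx n; rewrite lerDl.
have P1 y : 0 <= y <= 3 -> \forall n \near \oo, good (s n) y.
  move=> y3; have [N _ hN] : \forall n \near \oo, comparable K (s n) y := s_oo _ (comparable_near y3).
  by exists N => // n Nn; split => //; exact: hN.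
have P2 y : 0 <= y <= 3 -> \forall n \near \oo, good (s n + x n) y.
  move=> y3; have [N _ hN] : \forall n \near \oo, comparable K (s n + x n) y := sx_oo _ (comparable_near y3).
  by exists N => // n Nn; split => //; exact: hN.
have L1 := eventually_large (fun n => measurable_good (s n)) P1.
have L2 := eventually_large (fun n => measurable_good (s n + x n)) P2.
have [n [l1 l2]] : exists n, (2%:E < lebesgue_measure (good (s n)))%E /\
    (2%:E < lebesgue_measure (good (s n + x n)))%E.
  by have [N _ hN] := filterI L1 L2; exists N; exact: (hN N (leqnn N)).
have [_ x01 nc] := hsx n; rewrite -/(s n) -/(x n) in x01 nc.
have sub3 t : good t `<=` `[0, 3]%classic by move=> y [y3 _]; rewrite /= in_itv.
have [y [[_ [a1 a2 a3]] [_ []]]] := overlap (@measurable_good _) (@measurable_good _) (@sub3 _) (@sub3 _) x01 l1 l2.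
rewrite (_ : s n + x n + (y - x n) = s n + y); last by ring.
move=> b1 b2 b3; apply: nc.
have k0 := normr_ge0 (g (s n)); have k1 := normr_ge0 (g (s n + x n)).
have c1 : `|g (s n + x n)| <= K ^+ 2 * `|g (s n)|.
  apply: le_trans b3 _; rewrite expr2 -mulrA; exact: ler_wpM2l.
have c2 : `|g (s n)| <= K ^+ 2 * `|g (s n + x n)|.
  apply: le_trans a3 _; rewrite expr2 -mulrA; exact: ler_wpM2l.
have KC : K ^+ 2 <= C.
  have := K1; rewrite /C exprS; have := sqr_ge0 K; move=> ? ?; nra.
split.
- rewrite (_ : _ - _ = (f (s n + y) - f (s n)) - (f (s n + y) - f (s n + x n))); last by ring.
  apply: le_trans (ler_normB _ _) _; apply: le_trans (lerD a1 b1) _.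
  rewrite (_ : C * _ = K * `|g (s n)| + K * (K ^+ 2 * `|g (s n)|)); last by rewrite /C; ring.
  by apply: lerD => //; exact: ler_wpM2l.
- by apply: le_trans c1 _; exact: ler_wpM2r.
- by apply: le_trans c2 _; exact: ler_wpM2r.
Unshelve. all: by end_near. Qed.

(** Unit steps multiply [g] by nearly [e^r <= 1], hence by at most [e^(1/4)] far
out, and the increments of [f] add up to a geometric sum. *)
Theorem potter_bound : exists C : R, \forall s0 \near +oo, forall s y,
  `|s - s0| <= 1 -> - 1 <= y -> `|f (s + y) - f s| <= C * `|g s0| * expR (y / 4).
Proof.
have [C C1 hC] := locally_uniform_bound.
have C0 : 0 <= C := le_trans ler01 C1.
have [s1 [_ hs1]] := hC.
have step : \forall s \near +oo, `|g (s + 1)| <= expR 4^-1 * `|g s|.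
  have e4 : 0 < expR (4^-1 : R) - 1 by rewrite subr_gt0 expR_gt1 invr_gt0.
  near=> s; have gs : 0 < `|g s| by rewrite normr_gt0; near: s.
  have G : `|expR (r * 1) - g (s + 1) / g s| <= expR 4^-1 - 1.
    by near: s; move/cvgrPdist_le : (g_lim ler01); apply.
  rewrite -ler_pdivrMr// -normf_div; have e1 : expR (r * 1) <= 1.
    by rewrite -[leRHS]expR0 ler_expR mulr1.
  have e0 := expR_gt0 (r * 1).
  by move: G; rewrite !ler_norml => /andP[? ?]; apply/andP; split; lra.
have [s2 [_ hs2]] := step.
pose S := Num.max s1 s2 + 1.
have geo s (N : nat) : S <= s -> `|g (s + N%:R)| <= expR (N%:R / 4) * `|g s|.
  move=> Ss; elim: N => [|N ih]; first by rewrite addr0 mul0r expR0 mul1r.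
  rewrite -natr1 addrA; apply: le_trans (hs2 _ _) _.
    have : s2 < S by rewrite /S ltr_pwDr// le_max lexx orbT.
    by have := ler0n R N; lra.
  rewrite mulrDl div1r expRD [X in _ <= X * _]mulrC -mulrA ler_wpM2l// expR_ge0//.
have e14 : 5 / 4 <= expR (4^-1 : R).
  by apply: le_trans (expR_ge1Dx _); lra.
have s1S : s1 < S by rewrite /S ltr_pwDr// le_max lexx.
have fgeo s (N : nat) : S <= s -> `|f (s + N%:R) - f s| <= 4 * C * expR (N%:R / 4) * `|g s|.
  move=> Ss; elim: N => [|N ih].
    by rewrite addr0 subrr normr0 !mulr_ge0// expR_ge0.
  rewrite -natr1 addrA (_ : _ - f s = (f (s + N%:R + 1) - f (s + N%:R)) + (f (s + N%:R) - f s)); last by ring.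
  apply: le_trans (ler_normD _ _) _.
  have sN : s1 < s + N%:R by have := ler0n R N; lra.
  have [|b1 _ _] := hs1 _ sN 1; first by rewrite ler01 lexx.
  apply: le_trans (lerD (le_trans b1 (ler_wpM2l C0 (geo _ N Ss))) ih) _.
  rewrite [(_ + 1) / 4]mulrDl div1r expRD.
  have e0 := expR_ge0 (N%:R / 4 : R); have g0 := normr_ge0 (g s).
  have : 0 <= C * (expR (N%:R / 4) * `|g s|) by rewrite !mulr_ge0.
  set X := C * _ => X0.
  rewrite (_ : 4 * C * expR (N%:R / 4) * `|g s| = 4 * X); last by rewrite /X; ring.
  rewrite (_ : 4 * C * _ * `|g s| = 4 * X * expR 4^-1); last by rewrite /X; ring.
  nra.
have gcomp s t : S <= s -> S <= t -> `|s - t| <= 1 -> `|g s| <= C * `|g t|.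
  move=> Ss St; have [st|ts] := leP t s.
    rewrite ger0_norm ?subr_ge0// => st1.
    have [|_ + _] := hs1 t (lt_le_trans s1S St) (s - t).
      by rewrite subr_ge0 st.
    by rewrite addrC subrK.
  rewrite ltr0_norm ?subr_lt0// opprB => st1.
  have [|_ _ +] := hs1 s (lt_le_trans s1S Ss) (t - s).
    by rewrite subr_ge0 ltW.
  by rewrite addrC subrK.
have fpos s y : S <= s -> 0 <= y -> `|f (s + y) - f s| <= 5 * C * expR (y / 4) * `|g s|.
  move=> Ss y0; have /andP[] := truncn_itv y0; set N := Num.truncn y => Ny yN.
  rewrite (_ : y = N%:R + (y - N%:R)); last by ring.
  set x := y - N%:R.
  have x01 : 0 <= x <= 1.
    by rewrite /x subr_ge0 Ny /= lerBlDl; move: yN; rewrite -natr1 => /ltW; rewrite addrC.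
  have sN : s1 < s + N%:R by have := ler0n R N; lra.
  have [b1 _ _] := hs1 _ sN x x01.
  rewrite addrA (_ : _ - f s = (f (s + N%:R + x) - f (s + N%:R)) + (f (s + N%:R) - f s)); last by ring.
  apply: le_trans (ler_normD _ _) _.
  apply: le_trans (lerD (le_trans b1 (ler_wpM2l C0 (geo _ N Ss))) (fgeo _ N Ss)) _.
  rewrite (_ : _ + _ = 5 * C * expR (N%:R / 4) * `|g s|); last by ring.
  rewrite ler_wpM2r// ler_wpM2l ?mulr_ge0// ler_expR ler_pM2r//.
  by rewrite lerDl; case/andP: x01.
exists (5 * C ^+ 3 * expR (1 / 2)); near=> s0 => s y ss0 y1.
have S2 : S + 2 <= s0 by near: s0; apply: nbhs_pinfty_ge; exact: num_real.
have Ss : S + 1 <= s by move: ss0; rewrite ler_norml => /andP[? ?]; lra.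
have gs : `|g s| <= C * `|g s0| by apply: gcomp => //; lra.
have g00 := normr_ge0 (g s0).
have [y0|y0] := leP 0 y.
  apply: le_trans (fpos s y _ y0) _; first by lra.
  rewrite (_ : 5 * C * expR (y / 4) * `|g s| = (5 * C * expR (y / 4)) * `|g s|)//.
  apply: le_trans (ler_wpM2l _ gs) _; first by rewrite !mulr_ge0// expR_ge0.
  rewrite (_ : _ * (C * _) = (5 * (C ^+ 2) * 1) * `|g s0| * expR (y / 4)); last by ring.
  rewrite ler_wpM2r ?expR_ge0// ler_wpM2r//.
  rewrite ler_pM ?mulr_ge0 ?sqr_ge0//.
    by rewrite ler_pM2l// [leRHS]exprS ler_peMl// sqr_ge0.
  by rewrite -[leLHS]expR0 ler_expR.
have -> : f (s + y) - f s = - (f (s + y - y) - f (s + y)).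
  by rewrite addrK opprB.
rewrite normrN; apply: le_trans (fpos (s + y) (- y) _ _) _; [lra|lra|].
have gsy : `|g (s + y)| <= C * `|g s|.
  apply: gcomp; [lra|lra|]; rewrite addrC addKr ltr0_norm//; lra.
apply: (@le_trans _ _ (5 * C * expR (4^-1) * (C * (C * `|g s0|)))).
  apply: ler_pM => //.
  - by rewrite !mulr_ge0// expR_ge0.
  - by rewrite ler_wpM2l ?mulr_ge0// ler_expR; lra.
  - by apply: le_trans gsy _; rewrite ler_wpM2l.
rewrite [leLHS](_ : _ = (5 * C ^+ 3 * `|g s0|) * expR 4^-1); last by ring.
rewrite [leRHS](_ : _ = (5 * C ^+ 3 * `|g s0|) * (expR (1 / 2) * expR (y / 4))); last by ring.
rewrite -expRD ler_wpM2l ?mulr_ge0 ?exprn_ge0// ler_expR; lra.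
Unshelve. all: by end_near. Qed.

End regular_variation.

(** * The tail quantile function *)

Section tail_quantile.
Context {R : realType} (F : cumulativeBounded (0 : R) (1 : R)).
Hypothesis F_continuous : continuous F.
Hypothesis F_support : forall x : R, x <= 0 -> F x = 0.
Local Notation U := (tail_quantile F).

Lemma cdf_homo (x y : R) : x <= y -> F x <= F y.
Proof. exact: cumulative_is_nondecreasing. Qed.

Lemma cdf_ge0 (x : R) : 0 <= F x.
Proof.
have [x0|x0] := leP x 0; first by rewrite F_support.
by have := cdf_homo (ltW x0); rewrite (F_support (lexx 0)).
Qed.

Let superlevel (t : R) : set R := [set x | 1 - t^-1 <= F x].

Let level_gt0 (t : R) : 1 < t -> 0 < 1 - t^-1 < 1.
Proof.
move=> t1; rewrite subr_gt0 invf_lt1 ?(lt_trans ltr01 t1)// t1/= gtrBl invr_gt0.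
exact: lt_trans ltr01 t1.
Qed.

Let superlevel_gt0 (t x : R) : 1 < t -> superlevel t x -> 0 < x.
Proof.
move=> /level_gt0/andP[h _] hx; rewrite ltNge; apply/negP => x0.
by move: hx; rewrite /superlevel /= F_support// leNgt h.
Qed.

Let superlevel_lb (t : R) : 1 < t -> has_lbound (superlevel t).
Proof. by move=> t1; exists 0 => x /(superlevel_gt0 t1)/ltW. Qed.

Let superlevel_neq0 (t : R) : 1 < t -> superlevel t !=set0.
Proof.
move=> /level_gt0/andP[h0 h1].
have /cvgrPdist_lt/(_ t^-1) := cumulativey F.
rewrite -subr_gt0 opprB addrCA subrr addr0 in h1.
move=> /(_ h1)[M [_ hM]]; exists (M + 1); rewrite /superlevel /=.
have := hM (M + 1); rewrite ltrDl => /(_ ltr01) /ltr_normlW.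
by lra.
Qed.

Lemma quantile_le (t x : R) : 1 < t -> 1 - t^-1 <= F x -> U t <= x.
Proof. by move=> t1 h; apply: ge_inf => //; exact: superlevel_lb. Qed.

Lemma cdf_quantile (t : R) : 1 < t -> 1 - t^-1 <= F (U t).
Proof.
move=> t1; rewrite leNgt; apply/negP => h.
have e0 : 0 < 1 - t^-1 - F (U t) by rewrite subr_gt0.
have /cvgrPdist_lt/(_ _ e0) := @F_continuous (U t).
move=> /nbhs_ballP[r /= r0 hr].
have hi : has_inf (superlevel t) by split; [exact: superlevel_neq0|exact: superlevel_lb].
have [x xS xr] := inf_adherent r0 hi.
have Ux : U t <= x by apply: quantile_le.
have := hr x; rewrite /ball/= => /(_ _).
have -> : `|U t - x| < r.
  by rewrite distrC ger0_norm ?subr_ge0// ltrBlDl; exact: xr.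
move=> /(_ isT); rewrite distrC => /ltr_normlW.
by move: xS; rewrite /superlevel/=; lra.
Qed.

Lemma quantile_gt0 (t : R) : 1 < t -> 0 < U t.
Proof. by move=> t1; apply: (superlevel_gt0 t1); exact: cdf_quantile. Qed.

Lemma quantile_homo (t t' : R) : 1 < t -> t <= t' -> U t <= U t'.
Proof.
move=> t1 tt'; have t'1 := lt_le_trans t1 tt'.
have t0 := lt_trans ltr01 t1; have t'0 := lt_trans ltr01 t'1.
apply: quantile_le => //; apply: le_trans (cdf_quantile t'1).
by rewrite lerD2l lerN2 lef_pV2.
Qed.

(** Standard exponential when [w] has law [F], as [F w] is then uniform. *)
Definition exp_coord (w : R) : R := - ln (1 - F w).

Lemma quantile_exp_coord_le (w : R) : F w < 1 -> 0 < exp_coord w ->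
  U (expR (exp_coord w)) <= w.
Proof.
move=> w1 E0; apply: quantile_le; first by rewrite expR_gt1.
by rewrite -expRN opprK lnK ?posrE ?subr_gt0// opprB addrCA subrr addr0.
Qed.

(** Only with a shift by [e]: where [F] is flat, [w] may lie strictly above the
quantile of its own level. *)
Lemma le_quantile_exp_coord (w e : R) : F w < 1 -> 0 < e -> 0 <= exp_coord w ->
  w <= U (expR (exp_coord w + e)).
Proof.
move=> w1 e0 E0; rewrite leNgt; apply/negP => /ltW/cdf_homo.
have t1 : 1 < expR (exp_coord w + e) by rewrite expR_gt1 ltr_wpDl.
apply/negP; rewrite -ltNge; apply: lt_le_trans (cdf_quantile t1).
rewrite -expRN opprD expRD opprK lnK ?posrE ?subr_gt0//.
rewrite ltrBrDr addrC -ltrBrDr gtr_pMr ?subr_gt0//.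
by rewrite -expR0 ltr_expR oppr_lt0.
Qed.

End tail_quantile.

Section second_order.
Context {R : realType} (U : R -> R).
Hypothesis U_gt0 : forall t, 1 < t -> 0 < U t.
Hypothesis U_homo : forall t t', 1 < t -> t <= t' -> U t <= U t'.
Variable gamma : R.
Hypothesis U_rv : regularly_varying U gamma.

Let L (s : R) := ln (U (expR s)).

Lemma cvg_expR_pinfty : expR s @[s --> +oo] --> (+oo : set_system R).
Proof.
apply/cvgryPge => A; have := nbhs_pinfty_ge (num_real A); apply: filterS => s As.
by apply: le_trans As _; apply: le_trans (expR_ge1Dx s); rewrite lerDr.
Qed.

Lemma cvg0_norm_le (u v : R -> R) : (\forall s \near +oo, `|u s| <= v s) ->
  v s @[s --> +oo] --> (0 : R) -> u s @[s --> +oo] --> (0 : R).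
Proof.
move=> uv v0; apply: (@squeeze_cvgr _ _ _ _ (fun s => - v s) v) => //.
  by apply: filterS uv => s; rewrite ler_norml.
by rewrite -(oppr0 R); exact: cvgN.
Qed.

Let cvgMy (u v : R -> R) (l l' : R) : u s @[s --> +oo] --> l -> v s @[s --> +oo] --> l' ->
  u s * v s @[s --> +oo] --> l * l'.
Proof. by move=> ? ?; exact: cvgM. Qed.

Let cvgBy (u v : R -> R) (l l' : R) : u s @[s --> +oo] --> l -> v s @[s --> +oo] --> l' ->
  u s - v s @[s --> +oo] --> l - l'.
Proof. by move=> ? ?; exact: cvgB. Qed.

Let cvg_csty (c : R) : c @[_ --> (+oo : set_system R)] --> c.
Proof. exact: cvg_cst. Qed.

Let U_pos s : 0 < s -> 0 < U (expR s).
Proof. by move=> s0; apply: U_gt0; rewrite expR_gt1. Qed.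

Let L_homo s t : 0 < s -> s <= t -> L s <= L t.
Proof.
move=> s0 st; rewrite ler_ln ?posrE ?U_pos ?(lt_le_trans s0)//.
by apply: U_homo; rewrite ?expR_gt1 ?ler_expR.
Qed.

Let rv_exp y : U (expR (s + y)) / U (expR s) @[s --> +oo] --> expR (gamma * y).
Proof.
have := cvg_comp _ _ cvg_expR_pinfty (U_rv (expR_gt0 y)).
rewrite -expRM mulrC; apply: cvg_trans; apply: near_eq_cvg; near=> s.
by rewrite /= expRD.
Unshelve. all: by end_near. Qed.

Let L_ratio s y : 0 < s -> 0 < s + y -> L (s + y) - L s = ln (U (expR (s + y)) / U (expR s)).
Proof. by move=> s0 sy0; rewrite /L -ln_div ?posrE ?U_pos. Qed.

(** In exponential coordinates, regular variation says that [ln U] has slope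
[gamma] at infinity. *)
Lemma log_increment : L (s + 1) - L s @[s --> +oo] --> gamma.
Proof.
have := cvg_comp _ _ (@rv_exp 1) (continuous_ln (expR_gt0 (gamma * 1))).
rewrite expRK mulr1; apply: cvg_trans; apply: near_eq_cvg.
have := nbhs_pinfty_gt (num_real (0 : R)); apply: filterS => s s0.
by rewrite /= L_ratio// addr_gt0.
Qed.

Lemma log_growth (e : R) : 0 < e -> e < gamma ->
  \forall s \near +oo, (gamma - e) * s <= L s <= (gamma + e) * s.
Proof.
move=> e0 eg; have e2 : 0 < e / 2 by rewrite divr_gt0.
have /cvgrPdist_le/(_ _ e2)[M [_ hM]] := log_increment.
pose S := Num.max M 0 + 1.
have SM : M < S by rewrite /S ltr_pwDr// le_max lexx.
have S0 : 0 < S by rewrite /S ltr_wpDl// le_max lexx orbT.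
have steps (N : nat) : N%:R * (gamma - e / 2) <= L (S + N%:R) - L S <= N%:R * (gamma + e / 2).
  elim: N => [|N /andP[ih1 ih2]]; first by rewrite addr0 subrr !mul0r lexx.
  have N0 : 0 <= N%:R :> R := ler0n _ _.
  have MN : M < S + N%:R by lra.
  rewrite -natr1 addrA.
  by have := hM _ MN; rewrite ler_norml => /andP[? ?]; apply/andP; split; lra.
pose B := `|L S| + (S + 2) * (gamma + e).
near=> s.
have sB : 2 / e * B + S <= s by near: s; apply: nbhs_pinfty_ge; exact: num_real.
have LS := ler_norm (L S); have LS' := ler_norm (- L S); rewrite normrN in LS'.
have B0 : 0 <= B by rewrite addr_ge0// mulr_ge0//; lra.
have sS : S <= s by apply: le_trans sB; rewrite lerDr mulr_ge0// divr_ge0// ltW.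
have sB2 : B <= e / 2 * s.
  rewrite -ler_pdivrMl// invf_div; apply: le_trans sB; lra.
have sS0 : 0 <= s - S by rewrite subr_ge0.
have /andP[] := truncn_itv sS0; set N := Num.truncn _; rewrite -natr1 => N1 N2.
have /andP[h1 _] := steps N; have /andP[_ h2] := steps N.+1.
rewrite -natr1 in h2.
have N0 : 0 <= N%:R :> R := ler0n _ _.
have l1 : L (S + N%:R) <= L s by apply: L_homo; lra.
have l2 : L s <= L (S + (N%:R + 1)) by apply: L_homo; lra.
have ge2 : 0 < gamma - e / 2 by lra.
have p1 : (s - S - 1) * (gamma - e / 2) <= N%:R * (gamma - e / 2).
  by rewrite ler_wpM2r ?(ltW ge2)//; lra.
have p2 : (N%:R + 1) * (gamma + e / 2) <= (s - S + 1) * (gamma + e / 2).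
  by rewrite ler_wpM2r//; lra.
have Sg : 0 <= S * gamma by rewrite mulr_ge0 ?(ltW S0)//; lra.
have Se : 0 <= S * e by rewrite mulr_ge0 ?(ltW S0)// ltW.
move: sB2; rewrite /B => sB2.
apply/andP; split; lra.
Unshelve. all: by end_near. Qed.

Variables (a : R -> R) (rho : R).
Hypotheses (rho_le0 : rho <= 0) (a_sign : constant_sign a).
Hypothesis U_so : second_order_condition U a gamma rho.

Definition so_limit (y : R) : R := if rho == 0 then y else (expR (rho * y) - 1) / rho.

Let h1_gt0 : 0 < so_limit 1.
Proof.
rewrite /so_limit; case: eqP => // /eqP r0; rewrite mulr1.
have rn : rho < 0 by rewrite lt_neqAle r0.
by rewrite nmulr_lgt0 ?invr_lt0// subr_lt0 expR_lt1.
Qed.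

Lemma so_limit_bound y : 0 <= y <= 3 -> `|so_limit y| <= 3.
Proof.
move=> /andP[y0 y3]; rewrite /so_limit; case: eqP => [_|/eqP r0]; first by rewrite ger0_norm.
have rn : rho < 0 by rewrite lt_neqAle r0.
have e1 : expR (rho * y) <= 1 by rewrite -[leRHS]expR0 ler_expR mulr_le0_ge0// ltW.
have e2 := expR_ge1Dx (rho * y).
rewrite ger0_norm; last by rewrite nmulr_lge0 ?invr_lt0// subr_le0.
rewrite ler_ndivrMr//; apply: le_trans (_ : rho * y <= _); last lra.
by rewrite mulrC ler_wnM2l// ltW.
Qed.

Lemma so_limitB y : so_limit (y + 1) - so_limit y = expR (rho * y) * so_limit 1.
Proof.
rewrite /so_limit; case: eqP => [->|/eqP r0]; first by rewrite mul0r expR0; ring.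
by rewrite mulrDr mulr1 expRD; field.
Qed.

Let a_neq0 : \forall t \near +oo, a t != 0.
Proof. by case: a_sign; apply: filterS => t h; [rewrite gt_eqF|rewrite lt_eqF]. Qed.

Let near_exp (Q : R -> Prop) : (\forall t \near +oo, Q t) -> \forall s \near +oo, Q (expR s).
Proof. by move=> h; exact: (cvg_expR_pinfty h). Qed.

Let so_exp y :
  (U (expR (s + y)) / U (expR s) - expR (gamma * y)) / a (expR s) @[s --> +oo]
   --> expR (gamma * y) * so_limit y.
Proof.
have := cvg_comp _ _ cvg_expR_pinfty (U_so (expR_gt0 y)).
have -> : second_order_limit gamma rho (expR y) = expR (gamma * y) * so_limit y.
  by rewrite /second_order_limit /so_limit expRK -!expRM mulrC (mulrC y gamma) (mulrC y rho) mulrC.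
apply: cvg_trans; apply: near_eq_cvg; near=> s.
by rewrite /= expRD -expRM (mulrC y).
Unshelve. all: by end_near. Qed.

Let z y s := U (expR (s + y)) / U (expR s) / expR (gamma * y) - 1.

Let z_a y : z y s / a (expR s) @[s --> +oo] --> so_limit y.
Proof.
have e0 := expR_gt0 (gamma * y).
have := cvgMy (@cvg_csty ((expR (gamma * y))^-1)) (@so_exp y).
rewrite mulrA mulVf ?gt_eqF// mul1r; apply: cvg_trans; apply: near_eq_cvg; near=> s.
by rewrite [LHS]mulrA; congr (_ / _); rewrite /z mulrBr mulVf ?gt_eqF// mulrC.
Unshelve. all: by end_near. Qed.

Let z_0 y : z y s @[s --> +oo] --> (0 : R).
Proof.
have e0 := expR_gt0 (gamma * y).
have := cvgBy (cvgMy (@rv_exp y) (@cvg_csty ((expR (gamma * y))^-1))) (@cvg_csty 1).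
by rewrite mulfV ?gt_eqF// subrr.
Qed.

Let log_so y : (L (s + y) - L s - gamma * y) / a (expR s) @[s --> +oo] --> so_limit y.
Proof.
have e0 := expR_gt0 (gamma * y).
pose rem s := (ln (1 + z y s) - z y s) / a (expR s).
have rem0 : rem s @[s --> +oo] --> (0 : R).
  apply: (@cvg0_norm_le _ (fun s => 2 * `|z y s / a (expR s)| * `|z y s|)).
    near=> s.
    have z2 : `|z y s| <= 1 / 2.
      near: s; have /cvgrPdist_le := @z_0 y => /(_ (1 / 2)); rewrite divr_gt0// => /(_ isT).
      by apply: filterS => s; rewrite sub0r normrN.
    rewrite /rem normrM [`|z y s / _|]normrM.
    rewrite (_ : 2 * (`|z y s| * `|(a (expR s))^-1|) * `|z y s| =
      (2 * `|z y s| * `|z y s|) * `|(a (expR s))^-1|); last by ring.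
    rewrite ler_wpM2r//.
    move: z2; set x := z y s; rewrite ler_norml => /andP[x1 x2].
    have p0 : 0 < 1 + x by lra.
    have up : ln (1 + x) <= x by apply: le_ln1Dx; lra.
    have lo : x - 2 * x ^+ 2 <= ln (1 + x).
      have q : - ln (1 + x) <= (1 + x)^-1 - 1.
        rewrite -lnV ?posrE// -{1}(subrKC 1 (1 + x)^-1); apply: le_ln1Dx.
        by rewrite ltrBrDl subrr invr_gt0.
      have : (1 + x)^-1 - 1 <= - x + 2 * x ^+ 2.
        rewrite lerBlDr -[leLHS]mul1r ler_pdivrMr//; have := sqr_ge0 x; nra.
      lra.
    rewrite -[2 * _ * _]mulrA -normrM -expr2 [X in _ <= 2 * X]ger0_norm ?sqr_ge0// ler_norml.
    have := sqr_ge0 x; move=> ?; apply/andP; split; lra.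
  have za : `|z y s / a (expR s)| @[s --> +oo] --> `|so_limit y| by exact: cvg_norm (@z_a y).
  have z0 : `|z y s| @[s --> +oo] --> `|0 : R| by exact: cvg_norm (@z_0 y).
  have := cvgMy (cvgMy (@cvg_csty 2) za) z0.
  by rewrite normr0 mulr0.
have := cvgBy (@z_a y) (cvgBy (@cvg_csty 0) rem0); rewrite !subr0; apply: cvg_trans; apply: near_eq_cvg; near=> s.
have s0 : 0 < s by near: s; apply: nbhs_pinfty_gt; exact: num_real.
have sy0 : 0 < s + y.
  have : - y < s by near: s; apply: nbhs_pinfty_gt; exact: num_real.
  lra.
rewrite /rem sub0r opprK -mulrDl; congr (_ / _); rewrite addrC subrK L_ratio//.
rewrite /z addrC subrK [LHS]ln_div ?posrE ?divr_gt0 ?U_pos ?expR_gt0//.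
by rewrite expRK.
Unshelve. all: by end_near. Qed.

(** The second order condition, in exponential coordinates, is the hypothesis of
[potter_bound] for [f s = ln U (e^s) - gamma s]. The auxiliary function [a] need
not be measurable; it is replaced by the equivalent increments of [f]. *)
Theorem log_quantile_increment : exists C : R, \forall s0 \near +oo, forall s y,
  `|s - s0| <= 1 -> - 1 <= y ->
  `|ln (U (expR (s + y))) - ln (U (expR s)) - gamma * y| <= C * `|a (expR s0)| * expR (y / 4).
Proof.
pose f s := L (Num.max s 1) - gamma * s.
pose g s := (f (s + 1) - f s) / so_limit 1.
have mf : measurable_fun setT f.
  apply: measurable_funB; last exact: measurable_funM.
  apply: nondecreasing_measurable => // s t st.
  apply: L_homo; first by rewrite lt_max ltr01 orbT.
  by rewrite ge_max !le_max st lexx orbT.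
have mg : measurable_fun setT g.
  apply: measurable_funM => //; apply: measurable_funB => //.
  by apply: (measurableT_comp mf); exact: measurable_funD.
have fE y : 0 <= y -> \forall s \near +oo, f (s + y) - f s = L (s + y) - L s - gamma * y.
  move=> y0; have := nbhs_pinfty_ge (num_real (1 : R)); apply: filterS => s s1.
  rewrite /f (max_idPl s1) (max_idPl _); last by lra.
  by ring.
have f_a y : 0 <= y -> (f (s + y) - f s) / a (expR s) @[s --> +oo] --> so_limit y.
  move=> y0; have := @log_so y; apply: cvg_trans; apply: near_eq_cvg.
  by apply: filterS (fE y y0) => s ->.
have h1 : so_limit 1 != 0 by rewrite gt_eqF.
have g_a : g s / a (expR s) @[s --> +oo] --> (1 : R).
  have := cvgMy (f_a 1 ler01) (@cvg_csty ((so_limit 1)^-1)); rewrite mulfV//.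
  by apply: cvg_trans; apply: near_eq_cvg; near=> s; rewrite /g /= mulrAC.
have g_a_near : \forall s \near +oo, `|1 - g s / a (expR s)| <= 1 / 2.
  by have /cvgrPdist_le := g_a; apply.
have a_near : \forall s \near +oo, a (expR s) != 0 by exact: near_exp a_neq0.
have g0 : \forall s \near +oo, g s != 0.
  apply: filterS g_a_near => s; apply: contraTneq => ->.
  by rewrite mul0r subr0 normr1 -ltNge; lra.
have f_lim y : 0 <= y -> (f (s + y) - f s) / g s @[s --> +oo] --> so_limit y.
  move=> y0.
  have g_aV : (g s / a (expR s))^-1 @[s --> +oo] --> (1 : R).
    by rewrite -[in X in _ --> X]invr1; apply: cvgV => //; exact: oner_neq0.
  have := cvgMy (f_a y y0) g_aV.
  rewrite mulr1; apply: cvg_trans; apply: near_eq_cvg; near=> s.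
  have as0 : a (expR s) != 0 by near: s.
  have gs0 : g s != 0 by near: s.
  by rewrite /=; field; rewrite as0 gs0.
have g_lim y : 0 <= y -> g (s + y) / g s @[s --> +oo] --> expR (rho * y).
  move=> y0; have y1 : 0 <= y + 1 by lra.
  have := cvgMy (cvgBy (f_lim _ y1) (f_lim _ y0)) (@cvg_csty ((so_limit 1)^-1)).
  rewrite so_limitB mulfK//; apply: cvg_trans; apply: near_eq_cvg; near=> s.
  have gs0 : g s != 0 by near: s.
  by rewrite /= {3}/g addrA; field; rewrite gs0 h1.
have [C hC] := potter_bound mf mg g0 f_lim g_lim so_limit_bound rho_le0.
exists (`|C| * 2); near=> s0 => s y ss0 y1.
have s3 : 3 <= s0 by near: s0; apply: nbhs_pinfty_ge; exact: num_real.
have s2 : 2 <= s by move: ss0; rewrite ler_norml => /andP[? ?]; lra.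
have gs : `|g s0| <= 2 * `|a (expR s0)|.
  have as0 : a (expR s0) != 0 by near: s0.
  have : `|g s0 / a (expR s0)| <= 2.
    have : `|1 - g s0 / a (expR s0)| <= 1 / 2 by near: s0.
    by rewrite !ler_norml => /andP[? ?]; apply/andP; split; lra.
  by rewrite normf_div ler_pdivrMr ?normr_gt0.
have -> : ln (U (expR (s + y))) - ln (U (expR s)) - gamma * y = f (s + y) - f s.
  rewrite /f /L (max_idPl _); last by lra.
  rewrite (max_idPl _); last by lra.
  by ring.
apply: le_trans (_ : C * `|g s0| * expR (y / 4) <= _).
  by move: ss0 y1; move: s y {s2}; near: s0.
rewrite ler_wpM2r ?expR_ge0//; apply: (@le_trans _ _ (`|C| * `|g s0|)).
  by rewrite ler_wpM2r// ler_norm.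
by rewrite -mulrA ler_wpM2l.
Unshelve. all: by end_near. Qed.

End second_order.

(** * Concentration of the degrees *)

Section conditional_mgf.
Context {R : realType} {d} {T : measurableType d} (P : probability T R) {n : nat}.
Variables (A : 'I_n -> T -> nat) (B : set T) (kappa : 'I_n -> T -> nat -> R).
Variables (g : nat -> R) (M : 'I_n -> T -> R).
Hypotheses (mA : forall j b, measurable [set w | A j w = b]) (mB : measurable B).
Hypothesis mkappa : forall j b, measurable_fun setT (fun w => kappa j w b).
Hypothesis mM : forall j, measurable_fun setT (M j).
Hypotheses (kappa_ge0 : forall j w b, 0 <= kappa j w b) (g_ge0 : forall b, 0 <= g b).
Hypothesis M_ge0 : forall j w, 0 <= M j w.
Hypothesis kappa_mean : forall j w, B w ->
  (\sum_(0 <= b <oo) (g b * kappa j w b)%:E <= (M j w)%:E)%E.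
Hypothesis kappa_law : forall a : 'I_n -> nat,
  P ([set w | forall j, A j w = a j] `&` B) = (\int[P]_(w in B) (\prod_j kappa j w (a j))%:E)%E.

Lemma nneseries_single (v : nat -> R) (x : nat) :
  (\sum_(0 <= b <oo) ((x == b)%:R * v b)%:E = (v x)%:E :> \bar R)%E.
Proof.
apply: (lim_near_cst (@ereal_hausdorff R)); exists x.+1 => // N /= xN.
rewrite big_mkord (bigD1 (Ordinal xN))//= eqxx mul1r big1 ?adde0// => b bx.
by rewrite (_ : x == b = false) ?mul0r//; apply: contra_neqF bx => /eqP xb; exact: val_inj.
Qed.

Let value k (a : 'I_n -> nat) (w : T) (j : 'I_n) : R :=
  if (j < k)%N then g (A j w) else (A j w == a j)%:R.
Let bound k (a : 'I_n -> nat) (w : T) (j : 'I_n) : R :=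
  if (j < k)%N then M j w else kappa j w (a j).
Let replace (a : 'I_n -> nat) (j0 : 'I_n) (b : nat) (j : 'I_n) := if j == j0 then b else a j.

Let mnat j (h : nat -> R) : measurable_fun setT (fun w => h (A j w)).
Proof.
move=> _ Y mY; rewrite setTI (_ : _ @^-1` _ = \bigcup_(b in h @^-1` Y) [set w | A j w = b]).
  exact: bigcup_measurable.
by apply/seteqP; split => [w Yw|w [b Yb Ab]]; [exists (A j w)|rewrite /preimage /= (Ab : A j w = b)].
Qed.

Let mvalue k a j : measurable_fun setT (fun w => value k a w j).
Proof.
case E : (j < k)%N; under eq_fun do rewrite /value E; first exact: mnat.
exact: (mnat j (fun b => (b == a j)%:R)).
Qed.

Let mbound k a j : measurable_fun setT (fun w => bound k a w j).
Proof. by case E : (j < k)%N; under eq_fun do rewrite /bound E; [exact: mM|exact: mkappa]. Qed.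

Let value_ge0 k a w j : 0 <= value k a w j.
Proof. by rewrite /value; case: ifP. Qed.

Let bound_ge0 k a w j : 0 <= bound k a w j.
Proof. by rewrite /bound; case: ifP. Qed.

Let mprod (u : T -> 'I_n -> R) : (forall j, measurable_fun setT (fun w => u w j)) ->
  measurable_fun B (EFin \o (fun w => \prod_j u w j)).
Proof.
move=> mu; apply/measurable_EFinP; apply: (measurable_funS measurableT) => //.
exact: (@measurable_prod _ _ _ _ _ _ (fun j w => u w j)).
Qed.

(** The coordinates are replaced one at a time by their conditional means. *)
Let mgf_step k (a : 'I_n -> nat) :
  (\int[P]_(w in B) (\prod_j value k a w j)%:E <= \int[P]_(w in B) (\prod_j bound k a w j)%:E)%E.
Proof.
elim: k a => [|k ih] a.
  rewrite -kappa_law le_eqVlt; apply/orP; left; apply/eqP.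
  have mS : measurable [set w | forall j, A j w = a j] by exact: (measurable_forall (fun j => mA j (a j))).
  rewrite -(integral_indic P mB mS); apply: eq_integral => w _; congr EFin.
  rewrite indicE; have [Aa|/existsNP[j /eqP Aj]] := pselect (forall j, A j w = a j).
    by rewrite mem_set// big1// => j _; rewrite /value /= Aa eqxx.
  rewrite memNset; last by move=> h; move: Aj; rewrite h eqxx.
  by rewrite (bigD1 j)//= /value /= (negbTE Aj) mul0r.
have [kn|nk] := ltnP k n; last first.
  have E (j : 'I_n) : (j < k.+1)%N = (j < k)%N.
    by rewrite !(leq_trans (ltn_ord j))// ltnW.
  have Ev w : \prod_j value k.+1 a w j = \prod_j value k a w j.
    by apply: eq_bigr => j _; rewrite /value E.
  have Eb w : \prod_j bound k.+1 a w j = \prod_j bound k a w j.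
    by apply: eq_bigr => j _; rewrite /bound E.
  under eq_integral do rewrite Ev.
  by under [X in (_ <= X)%E]eq_integral do rewrite Eb; exact: ih.
pose j0 := Ordinal kn.
have lt_j0 (j : 'I_n) : j != j0 -> (j < k.+1)%N = (j < k)%N.
  move=> jj0; rewrite ltnS leq_eqVlt; case: eqP => // jk.
  by case/eqP: jj0; exact: val_inj.
have valueE w : (\prod_j value k.+1 a w j)%:E =
    (\sum_(0 <= b <oo) ((g b)%:E * (\prod_j value k (replace a j0 b) w j)%:E))%E.
  pose rest := \prod_(j | j != j0) value k a w j.
  transitivity (\sum_(0 <= b <oo) ((A j0 w == b)%:R * (g b * rest))%:E)%E.
    rewrite nneseries_single (bigD1 j0)//= {1}/value /= ltnSn; congr (_ * _)%:E.
    by apply: eq_bigr => j /lt_j0 jk; rewrite /value jk.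
  apply: eq_eseriesr => b _; rewrite -EFinM; congr EFin.
  rewrite (bigD1 j0)//= {1}/value /= ltnn /replace eqxx mulrCA; congr (_ * (_ * _)).
  by apply: eq_bigr => j jj0; rewrite /value (negbTE jj0).
pose R0 w := \prod_(j | j != j0) bound k a w j.
have R0_ge0 w : 0 <= R0 w by apply: prodr_ge0 => j _.
have boundE w b : \prod_j bound k (replace a j0 b) w j = kappa j0 w b * R0 w.
  rewrite (bigD1 j0)//= /bound /= ltnn /replace eqxx; congr (_ * _).
  by apply: eq_bigr => j jj0; rewrite /bound (negbTE jj0).
under eq_integral do rewrite valueE.
rewrite integral_nneseries//; last 2 first.
- move=> b; apply: emeasurable_funM => //; exact: mprod.
- by move=> b w _; rewrite mule_ge0// lee_fin// prodr_ge0.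
apply: (@le_trans _ _ (\sum_(0 <= b <oo) \int[P]_(w in B) (((g b)%:E * (\prod_j bound k (replace a j0 b) w j)%:E)))%E).
  apply: lee_nneseries => [b _ _|b _].
    by apply: integral_ge0 => w _; rewrite mule_ge0// lee_fin// prodr_ge0.
  rewrite !ge0_integralZl_EFin//; [|by move=> w _; rewrite lee_fin prodr_ge0|exact: mprod|
    by move=> w _; rewrite lee_fin prodr_ge0|exact: mprod].
  by apply: lee_pmul => //; [rewrite lee_fin|apply: integral_ge0 => w _; rewrite lee_fin prodr_ge0].
rewrite -integral_nneseries//; last 2 first.
- move=> b; apply: emeasurable_funM => //; exact: mprod.
- by move=> b w _; rewrite mule_ge0// lee_fin// prodr_ge0.
apply: ge0_le_integral => //.
- by move=> w _; apply: nneseries_ge0 => b _ _; rewrite mule_ge0// lee_fin// prodr_ge0.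
- apply: (eq_measurable_fun (fun w => (\sum_(0 <= b <oo | b \in xpredT) ((g b)%:E * (\prod_j bound k (replace a j0 b) w j)%:E))%E)).
    by move=> w _; apply: eq_eseriesl => b.
  apply: ge0_emeasurable_sum => [b w _ _|b _].
    by rewrite mule_ge0// lee_fin// prodr_ge0.
  by apply: emeasurable_funM => //; exact: mprod.
- exact: mprod.
move=> w Bw.
have -> : (\sum_(0 <= b <oo) ((g b)%:E * (\prod_j bound k (replace a j0 b) w j)%:E) =
  \sum_(0 <= b <oo) ((R0 w)%:E * (g b * kappa j0 w b)%:E))%E.
  by apply: eq_eseriesr => b _; rewrite -!EFinM boundE; congr EFin; ring.
rewrite nneseriesZl; last by move=> b _; rewrite lee_fin mulr_ge0.
rewrite (bigD1 j0)//= {1}/bound /= ltnSn mulrC EFinM.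
rewrite (eq_bigr (fun j => bound k a w j)); last by move=> j /lt_j0 jk; rewrite /bound jk.
by apply: lee_wpmul2l; [rewrite lee_fin|exact: kappa_mean].
Qed.

(** Conditional independence is only used on the singletons of [nat], where it
is the product formula [kappa_law]. *)
Lemma conditional_mgf :
  (\int[P]_(w in B) (\prod_j g (A j w))%:E <= \int[P]_(w in B) (\prod_j M j w)%:E)%E.
Proof.
pose z (_ : 'I_n) := 0%N.
have Ev w : \prod_j g (A j w) = \prod_j value n z w j.
  by apply: eq_bigr => j _; rewrite /value ltn_ord.
have Eb w : \prod_j M j w = \prod_j bound n z w j.
  by apply: eq_bigr => j _; rewrite /bound ltn_ord.
under eq_integral do rewrite Ev.
by under [X in (_ <= X)%E]eq_integral do rewrite Eb; exact: mgf_step.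
Qed.

End conditional_mgf.

Section degree_deviation.
Context {R : realType} {d} {T : measurableType d} (P : probability T R) {n : nat}.
Variables (W : 'I_n -> {RV P >-> R}) (A : 'I_n -> 'I_n -> {RV P >-> nat}).
Variable law : R -> set nat -> \bar R.
Hypothesis law_setT : forall r, law r setT = 1%E.
Hypothesis law_ge0 : forall r S, (0 <= law r S)%E.
Hypothesis law_fin : forall r S, law r S \is a fin_num.
Hypothesis law_mgf : forall r s, 0 < r <= 1 ->
  (\sum_(0 <= b <oo) (expR (s * b%:R) * fine (law r [set b]))%:E <= (expR (r * (expR s - 1)))%:E)%E.
Hypothesis model : ordered_graph_model W A law.

Local Notation G := (g_sigma_preimage (ordered_weight W)).
Local Notation TG := (g_sigma_algebraType G).

Let row_pair (i j : 'I_n) : 'I_n * 'I_n := if (i <= j)%N then (i, j) else (j, i).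
Let other (i : 'I_n) (p : 'I_n * 'I_n) := if p.1 == i then p.2 else p.1.
Let in_row (i : 'I_n) (p : 'I_n * 'I_n) := (p.1 == i) || (p.2 == i).

Let row_pair_le i j : ((row_pair i j).1 <= (row_pair i j).2)%N.
Proof. by rewrite /row_pair; have [ij|/ltnW ji] := leqP i j. Qed.

Let other_row_pair i j : other i (row_pair i j) = j.
Proof.
rewrite /row_pair /other; case: leqP => /= [_|ji]; first by rewrite eqxx.
by case: eqP => // E; rewrite E ltnn in ji.
Qed.

Let row_pair_other i (p : 'I_n * 'I_n) : (p.1 <= p.2)%N -> in_row i p -> row_pair i (other i p) = p.
Proof.
case: p => a b /= ab; rewrite /in_row /other /row_pair /= => /orP[/eqP ai|/eqP bi]; subst i.
  by rewrite eqxx ab.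
case: eqP => [->|/eqP ne]; first by rewrite leqnn.
by rewrite leqNgt ltn_neqAle ab -val_eqE /= in ne *; rewrite ne.
Qed.

Let in_row_pair i j : in_row i (row_pair i j).
Proof. by rewrite /in_row /row_pair; have [ij|ji] := leqP i j; rewrite /= eqxx ?orbT. Qed.

Let A_row i j w : A (row_pair i j).1 (row_pair i j).2 w = A i j w.
Proof. by have [sA _ _] := model; rewrite /row_pair; have [ij|ji] := leqP i j. Qed.

Lemma edge_parameter_sym i j w : edge_parameter W i j w = edge_parameter W j i w.
Proof. by rewrite /edge_parameter (mulrC (ordered_weight W i w)). Qed.

Let ep_row i j w : edge_parameter W (row_pair i j).1 (row_pair i j).2 w = edge_parameter W i j w.
Proof. by rewrite /row_pair; have [ij|ji] := leqP i j; rewrite //= edge_parameter_sym. Qed.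

Lemma measurable_ordered_weight (j : 'I_n) : measurable_fun [set: TG] (ordered_weight W j : TG -> R).
Proof.
move=> _ S mS; rewrite setTI; apply: sub_gen_smallest.
rewrite /g_sigma_preimage; apply: sub_gen_smallest.
rewrite -bigcup_seq; exists j; first by rewrite /= mem_index_enum.
by exists S => //; rewrite setTI.
Qed.

Let sum_weights w : \sum_l W l w = \sum_(j < n) ordered_weight W j w.
Proof. by rewrite -(order_stat_sum id (fun l => W l w)). Qed.

Lemma measurable_edge_parameter (i j : 'I_n) :
  measurable_fun [set: TG] (edge_parameter W i j : TG -> R).
Proof.
rewrite /edge_parameter; apply: measurable_funM.
  by apply: measurable_funM; exact: measurable_ordered_weight.
under eq_fun do rewrite sum_weights.
apply: (measurableT_comp (@measurable_inv R)).
by apply: (@measurable_sum _ _ _ _ _ _ (fun j (w : TG) => ordered_weight W j w)) => l; exact: measurable_ordered_weight.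
Qed.

Lemma generated_measurable (B : set T) : <<s G >> B -> measurable B.
Proof.
apply: smallest_sub; first exact: sigma_algebra_measurable.
apply: smallest_sub; first exact: sigma_algebra_measurable.
rewrite -bigcup_seq => S [j _ [Y mY <-]]; rewrite setTI.
have mW : measurable_fun setT (ordered_weight W j).
  by apply: measurable_order_stat => l; exact: measurable_funPT.
by have := mW measurableT Y mY; rewrite setTI.
Qed.

Let generated_fun (f : T -> \bar R) : measurable_fun [set: TG] (f : TG -> \bar R) -> measurable_fun setT f.
Proof. by move=> mf _ Y mY; apply: generated_measurable; exact: (mf measurableT Y mY). Qed.

Let kappa i j w b := fine (law (edge_parameter W i j w) [set b]).

Let mkappa i j b : measurable_fun setT (fun w => kappa i j w b).
Proof.
have [_ claw _] := model.
have [m _] := claw _ _ (row_pair_le i j) [set b] I.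
have := generated_fun m; under eq_fun do rewrite ep_row; move=> mf.
by apply: (measurableT_comp _ mf); exact: fine_measurable; exact: measurableT.
Qed.

Let kappa_law i (B : set T) (a : 'I_n -> nat) : <<s G >> B ->
  P ([set w | forall j, A i j w = a j] `&` B) = (\int[P]_(w in B) (\prod_j kappa i j w (a j))%:E)%E.
Proof.
move=> GB; have [_ claw cind] := model.
pose S p := if in_row i p then [set a (other i p)] else setT.
pose f p w := law (edge_parameter W p.1 p.2 w) (S p).
have [_ /(_ B GB)] := cind S f (fun _ _ => I) (fun p pD => claw _ _ pD (S p) I).
have -> : [set w | forall p : 'I_n * 'I_n, (p.1 <= p.2)%N -> S p (A p.1 p.2 w)] = [set w | forall j, A i j w = a j].
  apply/seteqP; split => w /= h.
    by move=> j; have := h _ (row_pair_le i j); rewrite A_row /S in_row_pair other_row_pair.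
  move=> p pD; rewrite /S; case: ifPn => // ip; rewrite /= -(h (other i p)).
  by rewrite -[RHS]A_row row_pair_other.
move=> <-; apply: eq_integral => w _.
rewrite (bigID (in_row i))/= [X in (_ * X)%E]big1 ?mule1; last first.
  by move=> p /andP[_ ip]; rewrite /f /S (negbTE ip) law_setT.
rewrite (reindex_onto (row_pair i) (other i)) /=; last first.
  by move=> p /andP[pD ip]; rewrite row_pair_other.
rewrite (big_morph EFin EFinM erefl); apply: eq_big => [j|j _].
  by rewrite row_pair_le in_row_pair other_row_pair eqxx.
by rewrite /f /S in_row_pair other_row_pair ep_row /kappa fineK.
Qed.

Definition typical_weights (w : T) : Prop :=
  (forall j : 'I_n, 0 < ordered_weight W j w) /\
  (forall i j : 'I_n, edge_parameter W i j w <= 1).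

Let mtypical : <<s G >> [set w | typical_weights w].
Proof.
have -> : [set w | typical_weights w] =
  [set w | forall j : 'I_n, 0 < ordered_weight W j w] `&`
  [set w | forall i, [set w | forall j, edge_parameter W i j w <= 1] w] by [].
apply: (@measurableI _ TG).
  apply: (@measurable_forall _ TG) => j; apply: (@measurable_gt _ _ TG).
  exact: measurable_ordered_weight.
apply: (@measurable_forall _ TG) => i; apply: (@measurable_forall _ TG) => j.
by apply: (@measurable_le _ _ TG); exact: measurable_edge_parameter.
Qed.

Let sum_edge i w : typical_weights w -> \sum_j edge_parameter W i j w = ordered_weight W i w.
Proof.
move=> [w0 _]; rewrite -mulr_suml -mulr_sumr sum_weights mulfK//.
rewrite gt_eqF// (bigD1 i)//= ltr_pwDl ?w0//.
by apply: sumr_ge0 => j _; exact: ltW.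
Qed.

Let deg i (w : T) : R := degree A w i.

Let expR_sum (u : 'I_n -> R) : expR (\sum_j u j) = \prod_j expR (u j).
Proof. exact: (big_morph _ (@expRD R) (@expR0 R)). Qed.

Let degE i w : deg i w = \sum_j (A i j w)%:R.
Proof. by rewrite /deg /degree natr_sum. Qed.

Lemma measurable_degree i : measurable_fun setT (fun w => degree A w i : R).
Proof.
rewrite (_ : (fun w => _) = fun w => \sum_j (A i j w)%:R); last by apply/funext => w; exact: degE.
apply: (@measurable_sum _ _ _ _ _ _ (fun j w => (A i j w)%:R : R)) => j.
by apply: (measurableT_comp (f := fun b : nat => b%:R : R)).
Qed.

(** Chernoff's bound on an event determined by the weights. *)
Let chernoff_block i (B : set T) (s y K : R) : <<s G >> B ->
  (forall w, B w -> typical_weights w /\ ordered_weight W i w * (expR s - 1) <= K) ->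
  (P ([set w | (y <= s * deg i w)%R] `&` B) <= (expR (K - y))%:E)%E.
Proof.
move=> GB hB; have mB := generated_measurable GB.
have mdeg := measurable_degree i.
have mexp : measurable_fun setT (fun w => expR (s * deg i w)).
  by apply: (measurableT_comp (@measurable_expR R)); exact: measurable_funM.
have mA j b : measurable [set w | A i j w = b].
  by have := measurable_funPT (A i j) measurableT [set b] I; rewrite setTI.
have mep j : measurable_fun setT (fun w => expR (edge_parameter W i j w * (expR s - 1))).
  apply: (measurableT_comp (@measurable_expR R)); apply: measurable_funM => //.
  by apply/measurable_EFinP; apply: generated_fun; apply/measurable_EFinP; exact: measurable_edge_parameter.
have main : (\int[P]_(w in B) (expR (s * deg i w))%:E <= (expR K)%:E)%E.
  have := @conditional_mgf R _ T P n (fun j => A i j) B (kappa i) (fun b => expR (s * b%:R))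
    (fun j w => expR (edge_parameter W i j w * (expR s - 1))) mA mB (mkappa i) mep.
  move=> /(_ _ _ _ _ (fun a => kappa_law i a GB)) H.
  apply: (@le_trans _ _ (\int[P]_(w in B) (expR K)%:E)%E); last first.
    rewrite integral_cst// -[leRHS]mule1; apply: lee_wpmul2l; first by rewrite lee_fin expR_ge0.
    exact: probability_le1.
  apply: le_trans (le_trans _ (H _ _ _ _)) _.
  - rewrite le_eqVlt; apply/orP; left; apply/eqP; apply: eq_integral => w _.
    by rewrite degE mulr_sumr expR_sum.
  - by move=> j w b; rewrite fine_ge0.
  - by move=> b; exact: expR_ge0.
  - by move=> j w; exact: expR_ge0.
  - move=> j w /hB[[w0 w1] _]; apply: law_mgf; rewrite w1 andbT.
    rewrite /edge_parameter divr_gt0 ?mulr_gt0// sum_weights (bigD1 i)//= ltr_pwDl ?w0//.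
    by apply: sumr_ge0 => l _; exact: ltW.
  apply: ge0_le_integral => //.
  - by move=> w _; rewrite lee_fin prodr_ge0// => j _; exact: expR_ge0.
  - apply/measurable_EFinP; apply: (measurable_funS measurableT) => //.
    exact: (@measurable_prod _ _ _ _ _ _ (fun j w => expR (edge_parameter W i j w * (expR s - 1)))).
  - move=> w /hB[tw wK]; rewrite lee_fin -expR_sum ler_expR.
    by rewrite -mulr_suml sum_edge.
have mE : measurable [set w | y <= s * deg i w].
  rewrite (_ : mkset _ = [set w | - (s * deg i w) <= - y]).
    by apply: measurable_le; apply: measurableT_comp => //; exact: measurable_funM.
  by apply/seteqP; split => w /=; rewrite lerN2.
have step : ((expR y)%:E * P ([set w | (y <= s * deg i w)%R] `&` B) <= (expR K)%:E)%E.
  apply: le_trans main.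
  rewrite -(integral_indic P mB mE) -ge0_integralZl_EFin ?expR_ge0//; last first.
    by apply/measurable_EFinP; apply: (measurable_funS measurableT) => //; exact: measurable_indic.
  apply: ge0_le_integral => //.
  - apply: emeasurable_funM => //.
    by apply/measurable_EFinP; apply: (measurable_funS measurableT) => //; exact: measurable_indic.
  - by apply/measurable_EFinP; apply: (measurable_funS measurableT).
  move=> w _; rewrite -EFinM lee_fin indicE; have [yd|yd] := pselect (y <= s * deg i w).
    by rewrite mem_set// mulr1 ler_expR.
  by rewrite memNset// mulr0 expR_ge0.
have e0 := expR_gt0 y.
rewrite expRD expRN mulrC EFinM -(lee_pmul2l (x := (expR y)%:E))//.
have -> : ((expR y)%:E * (((expR y)^-1)%:E * (expR K)%:E) = (expR K)%:E)%E.
  by rewrite -!EFinM mulrA divff ?gt_eqF// mul1r.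
exact: step.
Qed.

Let exp_up (s : R) : 0 <= s <= 1 / 2 -> expR s - 1 <= s + 2 * s ^+ 2.
Proof.
move=> /andP[s0 s1]; have p0 : 0 < 1 - s by lra.
have : expR s <= (1 - s)^-1.
  rewrite -[s in expR s]opprK expRN lef_pV2 ?posrE ?expR_gt0//.
  by apply: le_trans (expR_ge1Dx _); lra.
move=> h; have : (1 - s)^-1 <= 1 + s + 2 * s ^+ 2.
  by rewrite -[leLHS]mul1r ler_pdivrMr//; nra.
lra.
Qed.

Let exp_lo (s : R) : 0 <= s -> expR (- s) - 1 <= - s + s ^+ 2.
Proof.
move=> s0; have p0 : 0 < 1 + s by lra.
have : expR (- s) <= (1 + s)^-1 by rewrite expRN lef_pV2 ?posrE ?expR_gt0// expR_ge1Dx.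
move=> h; have : (1 + s)^-1 <= 1 - s + s ^+ 2.
  by rewrite -[leLHS]mul1r ler_pdivrMr//; nra.
lra.
Qed.

Let wblock i (l : nat) := [set w | typical_weights w] `&`
  ([set w | l%:R <= ordered_weight W i w] `&` [set w | ordered_weight W i w < l.+1%:R]).

Let gen_wblock i l : <<s G >> (wblock i l).
Proof.
have mw := @measurable_ordered_weight i.
apply: (@measurableI _ TG) => //; apply: (@measurableI _ TG).
  rewrite (_ : mkset _ = [set w | - ordered_weight W i w <= - l%:R]).
    by apply: (@measurable_le _ _ TG); exact: (measurableT_comp (@oppr_measurable R setT) mw).
  by apply/seteqP; split => w /=; rewrite lerN2.
rewrite (_ : mkset _ = [set w | - l.+1%:R < - ordered_weight W i w]).
  by apply: (@measurable_gt _ _ TG); exact: (measurableT_comp (@oppr_measurable R setT) mw).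
by apply/seteqP; split => w /=; rewrite ltrN2.
Qed.

(** Given the weights, [D_i] has a moment generating function below that of a
Poisson variable of mean [W_(i)], since the edge parameters of a row sum to
[W_(i)]. The weight is random, so Chernoff's bound is applied on each of the [N]
events where it lies in a unit interval [[l, l + 1)]. *)
Theorem degree_deviation (s x : R) (N : nat) : 0 < s <= 1 / 2 ->
  exists E : set T, [/\ measurable E,
    (P E <= (n%:R * (N%:R * (2 * expR (1 - s * x + 2 * N%:R * s ^+ 2))))%:E)%E &
    forall w i, typical_weights w -> ordered_weight W i w < N%:R ->
      ~ E w -> `|degree A w i - ordered_weight W i w| <= x].
Proof.
move=> /andP[s0 s1]; set c := expR _.
pose up (i : 'I_n) (l : 'I_N) := [set w | s * (x + l%:R) <= s * deg i w] `&` wblock i l.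
pose lo (i : 'I_n) (l : 'I_N) := [set w | - s * (l.+1%:R - x) <= - s * deg i w] `&` wblock i l.
have mdeg i (u y : R) : measurable [set w | y <= u * deg i w].
  rewrite (_ : mkset _ = [set w | - (u * deg i w) <= - y]).
    apply: measurable_le; apply: measurableT_comp => //; apply: measurable_funM => //.
    exact: measurable_degree.
  by apply/seteqP; split => w /=; rewrite lerN2.
have mblock i l : measurable (wblock i l) by apply: generated_measurable; exact: gen_wblock.
have mul i l : measurable (up i l `|` lo i l) by apply: measurableU; apply: measurableI.
have lN (l : 'I_N) : (l.+1%:R : R) <= N%:R by rewrite ler_nat.
have l0 (l : 'I_N) : (0 : R) <= l%:R by exact: ler0n.
have s2 := sqr_ge0 s.
have Pul i l : (P (up i l `|` lo i l) <= (2 * c)%:E)%E.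
  apply: le_trans (measureU2 _ _ _) _; [by apply: measurableI..|].
  rewrite mulr_natl mulr2n EFinD; apply: leeD.
    apply: le_trans (chernoff_block (K := l.+1%:R * (expR s - 1)) _ (gen_wblock i l) _) _.
      move=> w [tw [_ /= wl]]; split => //; rewrite ler_wpM2r ?(ltW wl)//.
      by rewrite subr_ge0 -[leLHS]expR0 ler_expR ltW.
    rewrite lee_fin ler_expR; have := @exp_up s; rewrite (ltW s0) s1 => /(_ isT) h.
    have := ler_wpM2l (ler0n R l.+1) h; have := ler_wpM2r s2 (lN l).
    by rewrite -natr1; have := l0 l; nra.
  apply: le_trans (chernoff_block (K := l%:R * (expR (- s) - 1)) _ (gen_wblock i l) _) _.
    move=> w [tw [/= lw _]]; split => //; rewrite ler_wnM2r//.
    by rewrite subr_le0 -[leRHS]expR0 ler_expR oppr_le0 ltW.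
  rewrite lee_fin ler_expR; have h := exp_lo (ltW s0).
  have := ler_wpM2l (ler0n R l) h; have := ler_wpM2r s2 (lN l).
  by rewrite -natr1; have := l0 l; nra.
have mex i : measurable [set w | exists l, (up i l `|` lo i l) w].
  rewrite (_ : mkset _ = ~` [set w | forall l, (~` (up i l `|` lo i l)) w]).
    by apply: measurableC; apply: measurable_forall => l; exact: measurableC.
  by apply/seteqP; split => w /= => [[l h] /(_ l)|/existsNP[l /contrapT h]] //; exists l.
exists [set w | exists i, [set w | exists l, (up i l `|` lo i l) w] w]; split.
- rewrite (_ : mkset _ = ~` [set w | forall i, (~` [set w | exists l, (up i l `|` lo i l) w]) w]).
    by apply: measurableC; apply: measurable_forall => l; exact: measurableC.
  by apply/seteqP; split => w /= => [[l h] /(_ l)|/existsNP[l /contrapT h]] //; exists l.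
- apply: (union_bound mex) => i; exact: (union_bound (mul i) (Pul i)).
move=> w i tw wN nE.
have wi0 : 0 <= ordered_weight W i w by apply: ltW; case: tw.
have /andP[] := truncn_itv wi0; set l := Num.truncn _ => lw wl.
have lN' : (l < N)%N by rewrite -(ltr_nat R); apply: le_lt_trans wN.
have wb : wblock i l w by [].
rewrite leNgt; apply/negP => xd; apply: nE; exists i, (Ordinal lN').
have [dw|dw] := leP (ordered_weight W i w) (degree A w i).
  left; split => //=; rewrite ler_pM2l//; move: xd; rewrite ger0_norm ?subr_ge0//.
  by rewrite /deg; lra.
right; split => //=; rewrite !mulNr lerN2 ler_pM2l//; move: xd; rewrite ltr0_norm ?subr_lt0//.
by rewrite /deg; lra.
Qed.

End degree_deviation.

Section edge_laws.
Context {R : realType}.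

Lemma poisson_mgf_le (r s : R) : 0 < r ->
  (\sum_(0 <= b <oo) (expR (s * b%:R) * fine (poisson_prob r 0 [set b]))%:E
    <= (expR (r * (expR s - 1)))%:E)%E.
Proof.
move=> r0; pose x := r * expR s; have x0 : 0 < x by rewrite mulr_gt0 ?expR_gt0.
have termE b : expR (s * b%:R) * fine (poisson_prob r 0 [set b]) = expR (- r) * exp_coeff x b.
  rewrite /poisson_prob r0 esum_set1 ?lee_fin ?poisson_pmf_ge0//= /poisson_pmf r0 /exp_coeff /=.
  by rewrite mulrC [s * _]mulrC expRM_natl exprMn; ring.
have c0 b : 0 <= exp_coeff x b by rewrite /exp_coeff /= divr_ge0// exprn_ge0// ltW.
apply: lime_le.
  by apply: is_cvg_nneseries => b _ _; rewrite lee_fin termE mulr_ge0 ?expR_ge0.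
near=> N; rewrite sumEFin lee_fin (eq_bigr (fun b => expR (- r) * exp_coeff x b)); last by move=> b _.
rewrite -mulr_sumr (_ : r * (expR s - 1) = - r + x); last by rewrite /x; ring.
rewrite expRD ler_wpM2l ?expR_ge0//.
apply: (@nondecreasing_cvgn_le _ (series (exp_coeff x))); last exact: is_cvg_series_exp_coeff.
apply/nondecreasing_seqP => m; rewrite /series /= big_nat_recr//= lerDl//.
Unshelve. all: by end_near. Qed.

Let bern (r : R) := pushforward (bernoulli_prob (Num.min r 1)) nat_of_bool.

(** [1 + r (e^s - 1) <= exp (r (e^s - 1))]. *)
Lemma bernoulli_mgf_le (r s : R) : 0 < r <= 1 ->
  (\sum_(0 <= b <oo) (expR (s * b%:R) * fine (bern r [set b]))%:E
    <= (expR (r * (expR s - 1)))%:E)%E.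
Proof.
move=> /andP[r0 r1]; have r01 : 0 <= r <= 1 by rewrite ltW.
have bE (b : nat) : bern r [set b] = (r * (b == 1)%:R + (1 - r) * (b == 0)%:R)%:E.
  have mt (u : bool) : (u \in nat_of_bool @^-1` [set b]) = (b == u :> nat).
    by apply/idP/eqP => [/set_mem/= <-//|->]; exact/mem_set.
  by rewrite /bern /pushforward (min_idPl r1) bernoulli_probE// !diracE /unstable.onem !mt.
have v0 b : 0 <= expR (s * b%:R) * fine (bern r [set b]).
  by rewrite bE /= mulr_ge0 ?expR_ge0// addr_ge0// mulr_ge0//; lra.
rewrite nneseries_recl//; last by move=> b _; rewrite lee_fin.
rewrite (@lim_near_cst _ (@ereal_hausdorff R) _ _ _ (expR s * r)%:E).
  rewrite bE /= mulr0 expR0 mul1r mulr0 add0r mulr1 -EFinD lee_fin.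
  by apply: le_trans (expR_ge1Dx _); lra.
near=> N; rewrite big_ltn; last by near: N; exists 2%N.
rewrite big_nat big1 ?adde0.
  by rewrite bE /= mulr1 mulr0 addr0 mulr1.
move=> b /andP[b2 _]; rewrite bE.
by case: b b2 => [|[|b]]//= _; rewrite !mulr0 addr0 mulr0.
Unshelve. all: by end_near. Qed.

End edge_laws.

Section random_graph_models.
Context {R : realType} {d} {T : measurableType d} (P : probability T R) {n : nat}.
Variables (W : 'I_n -> {RV P >-> R}) (A : 'I_n -> 'I_n -> {RV P >-> nat}).

Theorem degree_concentration (s x : R) (N : nat) : norros_reittu W A \/ chung_lu W A ->
  0 < s <= 1 / 2 ->
  exists E : set T, [/\ measurable E,
    (P E <= (n%:R * (N%:R * (2 * expR (1 - s * x + 2 * N%:R * s ^+ 2))))%:E)%E &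
    forall w i, typical_weights W w -> ordered_weight W i w < N%:R ->
      ~ E w -> `|degree A w i - ordered_weight W i w| <= x].
Proof.
move=> [nr|cl] s01.
- apply: (@degree_deviation R d T P n W A (fun r => poisson_prob r 0) _ _ _ _ nr s x N s01).
  + by move=> r; exact: (@probability_setT _ _ _ (poisson_prob r 0)).
  + by move=> r S; exact: (@measure_ge0 _ _ _ (poisson_prob r 0)).
  + by move=> r S; exact: (@fin_num_measure _ _ _ (poisson_prob r 0)).
  + by move=> r u /andP[r0 _]; exact: poisson_mgf_le.
- apply: (@degree_deviation R d T P n W A
    (fun r => pushforward (bernoulli_prob (Num.min r 1)) nat_of_bool) _ _ _ _ cl s x N s01).
  + by move=> r; exact: (@probability_setT _ _ _ (bernoulli_prob (Num.min r 1))).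
  + by move=> r S; exact: (@measure_ge0 _ _ _ (bernoulli_prob (Num.min r 1))).
  + by move=> r S; exact: (@fin_num_measure _ _ _ (bernoulli_prob (Num.min r 1))).
  + by move=> r u; exact: bernoulli_mgf_le.
Qed.

End random_graph_models.

(** * Exponential coordinates of the weights *)

Section probability_integral_transform.
Context {R : realType} (F : cumulativeBounded (0 : R) (1 : R)).
Hypothesis F_continuous : continuous F.
Hypothesis F_support : forall x : R, x <= 0 -> F x = 0.
Context {d} {T : measurableType d} (P : probability T R) (W : {RV P >-> R}).
Hypothesis W_law : forall x, cdf W x = (F x)%:E.
Local Notation E := (fun w => exp_coord F (W w)).

Lemma cdf_attains (y : R) : 0 <= y < 1 -> exists q, F q = y.
Proof.
move=> /andP[y0 y1]; have e0 : 0 < 1 - y by rewrite subr_gt0.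
have /cvgrPdist_lt/(_ _ e0)[M [_ hM]] := cumulativey F.
pose b := Num.max M 0 + 1.
have Mb : M < b by rewrite ltr_pwDr// le_max lexx.
have b0 : 0 <= b by rewrite addr_ge0// le_max lexx orbT.
have yb : y <= F b by have := ltr_normlW (hM b Mb); lra.
have [||c _ <-] := @IVT R F 0 b y b0; last by exists c.
  by apply: continuous_subspaceT.
by rewrite F_support// ge_min y0 le_max yb orbT.
Qed.

Lemma measurable_cdf : measurable_fun setT F.
Proof. by apply: nondecreasing_measurable => // x y; exact: cdf_homo. Qed.

Let mFW : measurable_fun setT (fun w => F (W w)).
Proof. exact: (measurableT_comp measurable_cdf (measurable_funPT W)). Qed.

Let P_le (q : R) : P [set w | W w <= q] = (F q)%:E.
Proof. by rewrite -W_law /cdf /distribution /pushforward; congr (P _); apply/seteqP; split => w /=; rewrite in_itv. Qed.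

(** The probability integral transform. *)
Lemma uniform_cdf (y : R) : 0 <= y < 1 -> P [set w | F (W w) <= y] = y%:E.
Proof.
move=> y01; have /andP[y0 y1] := y01; have [q qy] := cdf_attains y01.
have mW z : measurable [set w | W w <= z] by exact/measurable_le/measurable_funPT.
have mF z : measurable [set w | F (W w) <= z] by exact: measurable_le.
apply/eqP; rewrite eq_le; apply/andP; split; last first.
  rewrite -[in leLHS]qy -P_le; apply: le_measure; rewrite ?inE// => w /= /(cdf_homo F).
  by rewrite qy.
apply/lee_addgt0Pr => e e0; pose y' := Num.min (y + e) ((y + 1) / 2).
have yy' : y < y' by rewrite lt_min ltrDl e0 /=; lra.
have y'1 : y' < 1 by rewrite gt_min orbC; apply/orP; left; lra.
have [|q' q'y] := @cdf_attains y'; first by rewrite (le_trans y0 (ltW yy')).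
apply: (@le_trans _ _ (F q')%:E); last by rewrite q'y -EFinD lee_fin ge_min lexx.
rewrite -P_le; apply: le_measure; rewrite ?inE// => w /= Fw.
rewrite leNgt; apply/negP => /ltW/(cdf_homo F); rewrite q'y => h.
by have := lt_le_trans yy' (le_trans h Fw); rewrite ltxx.
Qed.

Lemma cdf_lt1_ae : P [set w | 1 <= F (W w)] = 0%E.
Proof.
have mF1 : measurable [set w | 1 <= F (W w)].
  rewrite (_ : mkset _ = [set w | - F (W w) <= - 1]).
    by apply: measurable_le; exact: (measurableT_comp (@oppr_measurable R setT) mFW).
  by apply/seteqP; split => w /=; rewrite lerN2.
apply/eqP; rewrite eq_le measure_ge0 andbT; apply/lee_addgt0Pr => e e0; rewrite add0e.
pose y := Num.max 0 (1 - e).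
have y1 : 0 <= y < 1 by rewrite le_max lexx gt_max ltr01 /= gtrBl.
have /andP[_ yl] := y1.
have mF z : measurable [set w | F (W w) <= z] by exact: measurable_le.
apply: (@le_trans _ _ (P (~` [set w | F (W w) <= y]))).
  apply: le_measure; rewrite ?inE//; first exact: measurableC.
  by move=> w /= h1 h2; have := lt_le_trans yl (le_trans h1 h2); rewrite ltxx.
rewrite probability_setC// uniform_cdf// -EFinB lee_fin.
have ye : 1 - e <= y by rewrite le_max lexx orbT.
lra.
Qed.

Lemma measurable_exp_coord : measurable_fun setT E.
Proof.
apply: (measurableT_comp (@oppr_measurable R setT)); apply: (measurableT_comp (@measurable_ln R)).
exact: measurable_funB.
Qed.

Lemma exp_coord_ge0 w : 0 <= E w.
Proof. by rewrite oppr_ge0 ln_le0// gerBl cdf_ge0. Qed.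

Lemma exp_coord_law (D : set R) : measurable D -> P (E @^-1` D) = exp_law D.
Proof.
have mE := measurable_exp_coord; move=> mD.
pose m1 := pushforward P (mfun_Sub (mem_set mE)).
suff : m1 D = exp_law D by [].
apply: (measure_unique (@RGenOInfty.G R) (fun k : nat => `](- k%:R), +oo[%classic) _ _ _ _ m1 (@exp_law R)) => //.
- exact: RGenOInfty.measurableE.
- move=> _ _ [c ->] [c' ->]; exists (Num.max c c').
  by apply/seteqP; split => x /=; rewrite !in_itv/= !andbT gt_max => /andP.
- by move=> k; exists (- k%:R).
- apply/seteqP; split => // x _; exists (Num.truncn (`|x|)).+1 => //=.
  rewrite in_itv/= andbT ltrNl; apply: le_lt_trans (truncnS_gt _).
  by apply: le_trans (ler_norm _) _; rewrite normrN.
- move=> _ [c ->]; rewrite /m1 /pushforward /=.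
  have [c0|c0] := leP 0 c; last first.
    have -> : exp_law `]c, +oo[ = 1%E :> \bar R.
      apply/eqP; rewrite eq_le probability_le1//= -(@exp_law_ge0 R); apply: le_measure; rewrite ?inE//.
      by move=> x /=; rewrite !in_itv/= !andbT; exact: lt_le_trans.
    rewrite -(probability_setT P); congr (P _); apply/seteqP; split => // w _.
    by rewrite /preimage /= in_itv/= andbT; apply: lt_le_trans c0 (exp_coord_ge0 w).
  rewrite exp_law_ccdf//.
  have y01 : 0 <= 1 - expR (- c) < 1.
    by rewrite subr_ge0 -[leRHS]expR0 ler_expR oppr_le0 c0 gtrBl expR_gt0.
  have mF z : measurable [set w | F (W w) <= z] by exact: measurable_le.
  have mF1 : measurable [set w | 1 <= F (W w)].
    rewrite (_ : mkset _ = [set w | - F (W w) <= - 1]).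
      by apply: measurable_le; exact: (measurableT_comp (@oppr_measurable R setT) mFW).
    by apply/seteqP; split => w /=; rewrite lerN2.
  have PC : P (~` [set w | F (W w) <= 1 - expR (- c)]) = (expR (- c))%:E.
    by rewrite probability_setC// uniform_cdf// -EFinB; congr EFin; ring.
  have mEc : measurable [set w | c < E w] by exact: measurable_gt.
  have iff w : F (W w) < 1 -> (c < E w) = (1 - expR (- c) < F (W w)).
    move=> w1; rewrite /exp_coord ltrNr -[X in _ < X]expRK ltr_ln ?posrE ?expR_gt0 ?subr_gt0//.
    by rewrite ltrBlDr ltrBlDl.
  have -> : pushforward P E `]c, +oo[%classic = P [set w | c < E w].
    by rewrite /pushforward; congr (P _); apply/seteqP; split => w; rewrite /preimage /= in_itv/= andbT.
  rewrite -PC.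
  apply/eqP; rewrite eq_le; apply/andP; split.
    apply: (@le_trans _ _ (P ((~` [set w | F (W w) <= 1 - expR (- c)]) `|` [set w | 1 <= F (W w)]))).
      apply: le_measure; rewrite ?inE//.
        by apply: measurableU => //; exact: measurableC.
      move=> w /= cE; have [w1|w1] := leP 1 (F (W w)); [by right|left].
      by move: cE; rewrite iff// ltNge => /negP.
    apply: le_trans (measureU2 P (measurableC (mF _)) mF1) _.
    by rewrite [X in (_ + X)%E](_ : _ = 0%E) ?adde0//; exact: cdf_lt1_ae.
  apply: (@le_trans _ _ (P ([set w | c < E w] `|` [set w | 1 <= F (W w)]))).
    apply: le_measure; rewrite ?inE//; first exact: measurableC.
      exact: measurableU.
    move=> w /= /negP; rewrite -ltNge => cE; have [w1|w1] := leP 1 (F (W w)); [by right|left].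
    by rewrite iff.
  apply: le_trans (measureU2 P mEc mF1) _.
  by rewrite [X in (_ + X)%E](_ : _ = 0%E) ?adde0//; exact: cdf_lt1_ae.
- move=> k; have mk : measurable (E @^-1` `](- k%:R), +oo[%classic).
    by rewrite -[X in measurable X]setTI; exact: (measurable_exp_coord measurableT (measurable_itv _)).
  by apply: le_lt_trans (probability_le1 P mk) _; exact: ltry.
Qed.

End probability_integral_transform.

Section exponential_counts.
Context {R : realType} {d : nat -> measure_display} {T : forall n, measurableType (d n)}.
Variables (P : forall n, probability (T n) R).
Variables (X : forall n, 'I_n -> {RV (P n) >-> R}).
Arguments X : clear implicits.
Hypothesis X_indep : forall n, mutually_independent (X n).
Hypothesis X_law : forall n i A, measurable A -> P n (X n i @^-1` A) = exp_law A.
Local Notation mu := (@exp_law R).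

Definition exceedances n (c : R) (w : T n) : nat := #|[set i | (c < X n i w)%R]%SET|.
Arguments exceedances : clear implicits.

(** The count has variance at most its mean [n e^(-c)]; Chebyshev. *)
Lemma whp_exceedances (c r : nat -> R) (e : R) : 0 < e -> (forall n, 0 <= c n) ->
  (\forall n \near \oo, 0 < r n) ->
  n%:R * expR (- c n) / r n ^+ 2 @[n --> \oo] --> (0 : R) ->
  whp P (fun n => [set w | `|(exceedances n (c n) w)%:R - n%:R * expR (- c n)| <= e * r n]).
Proof.
move=> e0 c0 r0 cv.
pose phi n (x : R) : R := \1_(`]c n, +oo[%classic) x - expR (- c n).
have mphi n : measurable_fun setT (phi n) by apply: measurable_funB => //; exact: measurable_indic.
have ind01 n x : \1_(`]c n, +oo[%classic) x = 0 :> R \/ \1_(`]c n, +oo[%classic) x = 1 :> R.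
  by rewrite indicE; case: (_ \in _); [right|left].
have p01 n : 0 <= expR (- c n) <= 1 by rewrite expR_ge0 -[leRHS]expR0 ler_expR oppr_le0 c0.
have ic (u : R) : mu.-integrable setT (EFin \o (fun=> u)) by exact: finite_measure_integrable_cst.
have i1 n : mu.-integrable setT (EFin \o \1_(`]c n, +oo[%classic)).
  apply: le_integrable (ic 1) => //.
    by apply/measurable_EFinP; exact: measurable_indic.
  move=> x _; rewrite /= lee_fin normr1.
  by case: (ind01 n x) => ->; rewrite ?normr0 ?normr1.
have i1E n : \int[mu]_x \1_(`]c n, +oo[%classic) x = expR (- c n) :> R.
  rewrite /Rintegral integral_indic// setIT [X in fine X](_ : _ = (expR (- c n))%:E)//.
  exact: exp_law_ccdf.
have iphi n : mu.-integrable setT (EFin \o phi n) by exact: (integrableB measurableT (i1 n) (ic _)).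
have mean0 n : \int[mu]_x phi n x = 0.
  by rewrite RintegralB// i1E Rintegral_prob_cst subrr.
have sq_le n x : phi n x ^+ 2 <= \1_(`]c n, +oo[%classic) x * (1 - 2 * expR (- c n)) + expR (- c n).
  by have /andP[? ?] := p01 n; rewrite /phi; case: (ind01 n x) => ->; nra.
have ib n : mu.-integrable setT (EFin \o (fun x => \1_(`]c n, +oo[%classic) x * (1 - 2 * expR (- c n)) + expR (- c n))).
  have := integrableD measurableT (integrableZl measurableT (1 - 2 * expR (- c n)) (i1 n)) (ic (expR (- c n))).
  by apply: eq_integrable => // x _ /=; rewrite [in RHS]mulrC.
have isq n : mu.-integrable setT (EFin \o (fun x => phi n x ^+ 2)).
  apply: le_integrable (ib n) => //.
    by apply/measurable_EFinP; exact: measurable_funX.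
  by move=> x _; rewrite /= lee_fin ger0_norm ?sqr_ge0// (le_trans (sq_le n x)) ?ler_norm.
have var_le n : \int[mu]_x (phi n x ^+ 2) <= 2 * expR (- c n).
  apply: le_trans (le_Rintegral measurableT (isq n) (ib n) (fun x _ => sq_le n x)) _.
  have -> : (fun x => \1_(`]c n, +oo[%classic) x * (1 - 2 * expR (- c n)) + expR (- c n)) =
    (fun x => (1 - 2 * expR (- c n)) * \1_(`]c n, +oo[%classic) x + expR (- c n)) :> (R -> R).
    by apply/funext => x; rewrite mulrC.
  rewrite RintegralD//; last exact: (integrableZl measurableT _ (i1 n)).
  rewrite RintegralZl// i1E Rintegral_prob_cst.
  by have /andP[? ?] := p01 n; nra.
pose Y n w := (r n)^-1 * \sum_(i < n) phi n (X n i w).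
have mY n : measurable_fun setT (Y n).
  apply: measurable_funM => //.
  apply: (@measurable_sum _ _ _ _ _ _ (fun i w => phi n (X n i w))) => i.
  exact: (measurableT_comp (mphi n) (measurable_funPT (X n i))).
apply: (@whpS _ _ _ _ (fun n => [set w | `|Y n w| <= e])).
  near=> n => w /=; have rn : 0 < r n by near: n.
  rewrite /Y; have -> : \sum_(i < n) phi n (X n i w) = (exceedances n (c n) w)%:R - n%:R * expR (- c n).
    rewrite sumrB sumr_const card_ord mulr_natl; congr (_ - _).
    transitivity (\sum_(i < n) (c n < X n i w)%R%:R : R).
      apply: eq_bigr => i _; rewrite indicE; congr (nat_of_bool _)%:R.
      by apply/idP/idP => [/set_mem|h]; [|apply/mem_set]; rewrite /= in_itv/= andbT.
    rewrite -natr_sum /exceedances -sum1dep_card [in RHS]big_mkcond/=; congr _%:R.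
  by rewrite normrM normfV (gtr0_norm rn) mulrC ler_pdivrMr.
apply: (@whp_second_moment _ _ _ P _ (fun n => 2 * (n%:R * expR (- c n) / r n ^+ 2))) => //.
  near=> n; have rn : 0 < r n by near: n.
  have [I V] := iid_sum_variance (@X_indep n) (@X_law n) (mphi n) (iphi n) (isq n) (mean0 n).
  have sqE : (fun w => Y n w ^+ 2) = (fun w => (r n) ^- 2 * (\sum_(i < n) phi n (X n i w)) ^+ 2).
    by apply/funext => w; rewrite /Y exprMn exprVn.
  rewrite sqE; split; first exact: eq_integrable (integrableZl measurableT ((r n) ^- 2) I).
  rewrite RintegralZl// V.
  rewrite (_ : 2 * (_ / _) = r n ^- 2 * (n%:R * (2 * expR (- c n)))); last by ring.
  by rewrite ler_wpM2l ?invr_ge0 ?sqr_ge0// ler_wpM2l.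
by rewrite -(mulr0 (2 : R)); apply: cvgM => //; exact: cvg_cst.
Unshelve. all: by end_near. Qed.

Lemma whp_max_exponential (e : R) : 0 < e ->
  whp P (fun n => [set w | forall i, X n i w <= (1 + e) * ln n%:R]).
Proof.
move=> e0.
have mle n (i : 'I_n) : measurable [set w | X n i w <= (1 + e) * ln n%:R].
  exact/measurable_le/measurable_funPT.
apply: whp_measurable => [n|u u0]; first exact: (measurable_forall (@mle n)).
near=> n; have n0 : (0 < n)%N by near: n; exists 1%N.
have n0R : (0 : R) < n%:R by rewrite ltr0n.
have ln0' : 0 <= ln n%:R :> R by rewrite ln_ge0// ler1n.
have l0 : 0 <= (1 + e) * ln n%:R by rewrite mulr_ge0//; lra.
rewrite (_ : ~` _ = [set w | exists i, (~` [set w | X n i w <= (1 + e) * ln n%:R]) w]); last first.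
  by apply/seteqP; split => w /=; rewrite -existsNE.
have B i : (P n (~` [set w | X n i w <= (1 + e) * ln n%:R]%R) <= (expR (- ((1 + e) * ln n%:R)))%:E)%E.
  rewrite (_ : ~` _ = X n i @^-1` `](1 + e) * ln n%:R, +oo[); last first.
    by apply/seteqP; split => w /=; rewrite in_itv/= andbT ltNge => /negP.
  by rewrite X_law// exp_law_ccdf.
apply: le_trans (union_bound (fun i => measurableC (mle n i)) B) _.
rewrite lee_fin mulrDl mul1r opprD expRD [expR (- ln _)]expRN lnK ?posrE//.
rewrite mulrA divff ?gt_eqF// mul1r -[leRHS]lnK ?posrE// ler_expR lerNl -ler_pdivrMl//.
rewrite -[leLHS]expRK ler_ln ?posrE ?expR_gt0//.
by near: n; exact: nbhs_infty_ger.
Unshelve. all: by end_near. Qed.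

End exponential_counts.

(** * Order statistics of exponential samples *)

Section exponential_order_statistics.
Context {R : realType} {d : nat -> measure_display} {T : forall n, measurableType (d n)}.
Variables (P : forall n, probability (T n) R).
Variables (X : forall n, 'I_n -> {RV (P n) >-> R}).
Arguments X : clear implicits.
Hypothesis X_indep : forall n, mutually_independent (X n).
Hypothesis X_law : forall n i A, measurable A -> P n (X n i @^-1` A) = exp_law A.

Lemma expR_half_bounds : 3 / 2 <= expR (1 / 2 : R) <= 2.
Proof.
have h := expR_ge1Dx (1 / 2 : R); have h' := expR_ge1Dx (- (1 / 2) : R).
have e0 := expR_gt0 (1 / 2 : R).
apply/andP; split; first by apply: le_trans h; lra.
have : expR (1 / 2 : R) * expR (- (1 / 2)) = 1 by rewrite -expRD subrr expR0.
nra.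
Qed.

Lemma natr_inv_cvg0 (k : nat -> nat) : k n @[n --> \oo] --> \oo ->
  (k n)%:R^-1 @[n --> \oo] --> (0 : R).
Proof.
move=> k_oo; have kR : (k n)%:R @[n --> \oo] --> (+oo : set_system R).
  by apply: (cvg_comp _ _ k_oo); exact: cvgr_idn.
exact: (cvg_comp _ _ kR cvg_inv_pinfty).
Qed.

Lemma whp_exceedances_one : whp P (fun n => [set w | n%:R / 8 <= (exceedances X 1 w)%:R :> R]).
Proof.
have n_oo : n @[n --> \oo] --> \oo by exact: cvg_id.
have cv : n%:R * expR (- 1) / n%:R ^+ 2 @[n --> \oo] --> (0 : R).
  have := cvgM (natr_inv_cvg0 n_oo) (cvg_cst (expR (- 1) : R)); rewrite mul0r => H.
  apply: (cvg_trans (near_eq_cvg _)); last exact: H.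
  near=> n; have n0 : n%:R != 0 :> R by rewrite pnatr_eq0 -lt0n; near: n; exists 1%N.
  by rewrite /=; field.
have e8 : (0 : R) < 1 / 8 by rewrite divr_gt0.
have r0 : \forall n \near \oo, (0 : R) < n%:R by exists 1%N => // n /= n0; rewrite ltr0n.
apply: whpS (whp_exceedances X_indep X_law e8 (c := fun=> 1) (fun=> ler01) r0 cv).
near=> n => w /=; rewrite ler_norml => /andP[h _].
have /andP[_ e2] := expR_half_bounds; have e1 := expR_gt0 (1 / 2 : R).
have e4 : 1 / 4 <= expR (- 1 : R).
  have E : expR (- 1 : R) * (expR (1 / 2) * expR (1 / 2)) = 1.
    rewrite -!expRD -[RHS]expR0; congr expR; lra.
  have x0 := expR_gt0 (- 1 : R).
  have aa : expR (1 / 2 : R) * expR (1 / 2) <= 4 by nra.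
  by have := ler_wpM2l (ltW x0) aa; lra.
by have := ler0n R n; nra.
Unshelve. all: by end_near. Qed.

(** At the levels [ln (n / k) - 1/2] and [ln (n / k) + 1/2] the expected numbers
of exceedances are [k] times [e^(1/2)] and [e^(-1/2)], on both sides of [k] by a
margin beating the fluctuations of order [sqrt k]. *)
Lemma whp_order_stat (k : nat -> nat) : (forall n, (0 < k n)%N) -> k n @[n --> \oo] --> \oo ->
  (k n)%:R / n%:R @[n --> \oo] --> (0 : R) ->
  whp P (fun n => [set w | `|order_stat (X n ^~ w) (k n) - ln (n%:R / (k n)%:R)| <= 1 / 2]).
Proof.
move=> k0 k_oo kn0; have kR n : (0 : R) < (k n)%:R by rewrite ltr0n.
have small : \forall n \near \oo, (0 < n)%N /\ (k n)%:R * 2 <= n%:R :> R.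
  have half : (0 : R) < 1 / 2 by rewrite divr_gt0.
  have /cvgrPdist_le/(_ _ half) kh := kn0.
  near=> n; have n0 : (0 < n)%N by near: n; exists 1%N.
  split => //; have : `|0 - (k n)%:R / n%:R| <= 1 / 2 :> R by near: n.
  rewrite sub0r normrN ger0_norm ?divr_ge0// ler_pdivrMr ?ltr0n//; lra.
pose c (u : R) n := Num.max 0 (ln (n%:R / (k n)%:R) + u : R).
have cE u : - (1 / 2) <= u -> \forall n \near \oo, c u n = ln (n%:R / (k n)%:R) + u.
  move=> u1; apply: filterS small => n [n0 kn]; apply/max_idPr.
  have l2 : 1 / 2 <= ln (2 : R).
    by rewrite -[leLHS]expRK ler_ln ?posrE ?expR_gt0//; case/andP: expR_half_bounds.
  have : ln (2 : R) <= ln (n%:R / (k n)%:R).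
    by rewrite ler_ln ?posrE ?divr_gt0 ?ltr0n// ler_pdivlMr// mulrC.
  lra.
have pE u : - (1 / 2) <= u -> \forall n \near \oo, n%:R * expR (- c u n) = (k n)%:R * expR (- u).
  move=> u1; near=> n; have n0 : (0 : R) < n%:R by rewrite ltr0n; near: n; apply: filterS small => n [].
  have -> : c u n = ln (n%:R / (k n)%:R) + u by near: n; exact: cE.
  rewrite opprD expRD expRN lnK ?posrE ?divr_gt0//; field.
  by rewrite !gt_eqF.
have cv u : - (1 / 2) <= u -> n%:R * expR (- c u n) / (k n)%:R ^+ 2 @[n --> \oo] --> (0 : R).
  move=> u1; have := cvgM (natr_inv_cvg0 k_oo) (cvg_cst (expR (- u) : R)); rewrite mul0r => H.
  apply: (cvg_trans (near_eq_cvg _)); last exact: H.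
  apply: filterS (pE u u1) => n ->; have := kR n => ?.
  by rewrite /=; field; rewrite gt_eqF.
have e4 : (0 : R) < 1 / 4 by rewrite divr_gt0.
have c0 u n : 0 <= c u n by rewrite le_max lexx.
have r0 : \forall n \near \oo, (0 : R) < (k n)%:R by exists 0%N.
have u1 : - (1 / 2) <= - (1 / 2) :> R by [].
have u2 : - (1 / 2) <= 1 / 2 :> R by lra.
have W1 := whp_exceedances X_indep X_law e4 (c0 (- (1 / 2))) r0 (cv _ u1).
have W2 := whp_exceedances X_indep X_law e4 (c0 (1 / 2)) r0 (cv _ u2).
apply: whpS (whpI W1 W2); near=> n => w /= [h1 h2].
have kn : (0 < k n <= n)%N.
  have [n0 kn2] : (0 < n)%N /\ (k n)%:R * 2 <= n%:R :> R by near: n.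
  by rewrite k0 /= -(ler_nat R); have := kR n; lra.
have p1 : n%:R * expR (- c (- (1 / 2)) n) = (k n)%:R * expR (- (- (1 / 2))) by near: n; exact: pE.
have p2 : n%:R * expR (- c (1 / 2) n) = (k n)%:R * expR (- (1 / 2)) by near: n; exact: pE.
have c1 : c (- (1 / 2)) n = ln (n%:R / (k n)%:R) - 1 / 2 by near: n; exact: cE.
have c2 : c (1 / 2) n = ln (n%:R / (k n)%:R) + 1 / 2 by near: n; exact: cE.
have /andP[e1 e2] := expR_half_bounds; have e0 := expR_gt0 (- (1 / 2) : R).
have em : expR (1 / 2 : R) * expR (- (1 / 2)) = 1 by rewrite -expRD subrr expR0.
have em2 : expR (- (1 / 2) : R) <= 2 / 3 by nra.
move: h1 h2; rewrite p1 p2 opprK !ler_norml => /andP[h1 _] /andP[_ h2].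
have lo : c (- (1 / 2)) n < order_stat (X n ^~ w) (k n).
  by rewrite (order_stat_gt _ _ kn) -(ler_nat R) -/(exceedances X (c (- (1 / 2)) n) w); have := kR n; nra.
have up : order_stat (X n ^~ w) (k n) <= c (1 / 2) n.
  rewrite leNgt (order_stat_gt _ _ kn) -ltnNge -(ltr_nat R) -/(exceedances X (c (1 / 2) n) w).
  by have := kR n; nra.
rewrite c1 in lo; rewrite c2 in up.
by apply/andP; split; lra.
Unshelve. all: by end_near. Qed.

End exponential_order_statistics.

Section pwm_algebra.
Context {R : realType}.

Lemma sum_max (m : nat) (c : nat -> R) :
  \sum_(i < m) \sum_(j < m) c (maxn i j) + \sum_(i < m) c i = 2 * \sum_(i < m) i.+1%:R * c i.
Proof.
elim: m => [|m ih]; first by rewrite !big_ord0 addr0 mulr0.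
rewrite big_ord_recr/= [in X in _ + X + _]big_ord_recr/= maxnn.
under eq_bigr do rewrite big_ord_recr/=.
rewrite big_split/=.
have E1 : \sum_(i < m) c (maxn i m) = m%:R * c m.
  rewrite (eq_bigr (fun=> c m)); first by rewrite sumr_const card_ord mulr_natl.
  by move=> i _; rewrite (maxn_idPr (ltnW (ltn_ord i))).
have E2 : \sum_(i < m) c (maxn m i) = m%:R * c m.
  rewrite (eq_bigr (fun=> c m)); first by rewrite sumr_const card_ord mulr_natl.
  by move=> i _; rewrite (maxn_idPl (ltnW (ltn_ord i))).
rewrite E1 E2 !big_ord_recr/= mulrDr -ih -natr1; ring.
Qed.

(** On decreasing tuples, the symmetric form of the second moment is the usual
    weighted sum of the order statistics. *)
Lemma excess2_sorted (p : R) (m : nat) (t : m.-tuple R) : 0 <= p ->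
  (forall i j : 'I_m, (i <= j)%N -> tnth t j <= tnth t i) ->
  excess2 p t = (m%:R ^+ 2)^-1 * \sum_(i < m) i.+1%:R * (expR (p * tnth t i) - 1).
Proof.
move=> p0 t_dec; pose c (i : nat) : R := expR (p * nth 0 t i) - 1.
have cE (i : 'I_m) : expR (p * tnth t i) - 1 = c i by rewrite /c (tnth_nth 0).
have minE (i j : 'I_m) : Num.min (expR (p * tnth t i)) (expR (p * tnth t j)) - 1 = c (maxn i j).
  have [ij|ji] := leqP i j.
    rewrite -cE; congr (_ - _); apply/min_idPr; rewrite ler_expR ler_wpM2l//; exact: t_dec.
  rewrite -cE; congr (_ - _); apply/min_idPl; rewrite ler_expR ler_wpM2l//; exact/t_dec/ltnW.
rewrite /excess2; under eq_bigr do under eq_bigr do rewrite minE.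
under [X in _ * (_ + X)]eq_bigr do rewrite cE.
rewrite sum_max; under [in RHS]eq_bigr do rewrite cE.
by rewrite invfM mulrACA mulVf ?mul1r.
Qed.

Lemma excess_perm (p : R) (m : nat) (t t' : m.-tuple R) : perm_eq t t' ->
  excess1 p t = excess1 p t' /\ excess2 p t = excess2 p t'.
Proof.
move=> tt'.
have S (f : R -> R) : \sum_(i < m) f (tnth t i) = \sum_(i < m) f (tnth t' i).
  by rewrite -!(big_tuple _ _ _ xpredT f); exact: perm_big.
rewrite /excess1 /excess2 (S (fun x => expR (p * x) - 1)); split=> //; congr (_ * (_ + _)).
rewrite (S (fun x => \sum_j (Num.min (expR (p * x)) (expR (p * tnth t j)) - 1))).
by apply: eq_bigr => i _; rewrite (S (fun x => Num.min (expR (p * tnth t' i)) (expR (p * x)) - 1)).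
Qed.

(** The error is relative because the quotient itself is only bounded in
probability once multiplied by [sqrt k]. *)
Lemma ratio_perturbation (p c J1 J2 I1 I2 e : R) : 0 < p < 1 / 2 -> 0 < c ->
  c / 2 <= J1 - 2 * J2 -> `|I1 - J1| <= e -> `|I2 - J2| <= e -> 3 * e <= c / 4 ->
  `|((I1 - 4 * I2) / (I1 - 2 * I2) - p) -
     ((1 - p) * J1 - 2 * (2 - p) * J2) / (J1 - 2 * J2)| <=
  4 * e / c * (5 + 3 * `|((1 - p) * J1 - 2 * (2 - p) * J2) / (J1 - 2 * J2)|).
Proof.
move=> /andP[p0 p1] c0 hJ d1 d2 ec.
set D := J1 - 2 * J2 in hJ *; set N := (1 - p) * J1 - _.
set y := N / D.
have D0 : 0 < D by apply: lt_le_trans hJ; rewrite divr_gt0.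
pose D' := I1 - 2 * I2; pose N' := (1 - p) * I1 - 2 * (2 - p) * I2.
move: d1; rewrite ler_norml => /andP[d1 d1'].
move: d2; rewrite ler_norml => /andP[d2 d2'].
have DD : D' - D = (I1 - J1) - 2 * (I2 - J2) by rewrite /D' /D; ring.
have e0 : 0 <= e by lra.
have D'c : c / 4 <= D' by lra.
have D'0 : 0 < D' by apply: lt_le_trans D'c; rewrite divr_gt0.
have yN : N = y * D by rewrite /y mulfVK// gt_eqF.
have -> : (I1 - 4 * I2) / (I1 - 2 * I2) - p - y = ((N' - N) - y * (D' - D)) / D'.
  rewrite yN /D' /N'; field; by rewrite gt_eqF.
rewrite normrM normfV (gtr0_norm D'0) ler_pdivrMr//.
have A1 : `|N' - N| <= 5 * e.
  rewrite (_ : N' - N = (1 - p) * (I1 - J1) - 2 * (2 - p) * (I2 - J2)); last by rewrite /N' /N; ring.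
  rewrite ler_norml; apply/andP; split; nra.
have A2 : `|y * (D' - D)| <= `|y| * (3 * e).
  rewrite normrM ler_wpM2l// ler_norml DD; apply/andP; split; lra.
apply: le_trans (ler_normB _ _) _; apply: le_trans (lerD A1 A2) _.
have y0 := normr_ge0 y.
have -> : 5 * e + `|y| * (3 * e) = 4 * e / c * (5 + 3 * `|y|) * (c / 4) by field; rewrite gt_eqF.
by rewrite ler_wpM2l// mulr_ge0 ?divr_ge0 ?mulr_ge0//; lra.
Qed.

End pwm_algebra.

(** * Comparison with an exponential sample *)

Section weight_ratio.
Context {R : realType} (F : cumulativeBounded (0 : R) (1 : R)).
Hypothesis F_continuous : continuous F.
Hypothesis F_support : forall x : R, x <= 0 -> F x = 0.
Local Notation U := (tail_quantile F).
Variables (gamma s0 K : R) (gamma0 : 0 < gamma) (K0 : 0 <= K).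
Hypothesis increment : forall s y : R, `|s - s0| <= 1 -> - 1 <= y ->
  `|ln (U (expR (s + y))) - ln (U (expR s)) - gamma * y| <= K * expR (y / 4).

Let U0 (s : R) : 0 < s -> 0 < U (expR s).
Proof. by move=> s1; apply: quantile_gt0 => //; rewrite expR_gt1. Qed.

Lemma weight_gt0 (x : R) : F x < 1 -> 0 < exp_coord F x -> 0 < x.
Proof. by move=> x1 E0; apply: lt_le_trans (U0 E0) _; exact: quantile_exp_coord_le. Qed.

Let shifts (E1 E2 de : R) : `|E2 - s0| <= 1 / 2 -> 0 < de -> de <= 1 / 2 -> E2 <= E1 ->
  [/\ `|E2 - s0| <= 1, `|E2 + de - s0| <= 1, - 1 <= E1 - E2 + de & - 1 <= E1 - E2 - de].
Proof.
clear; rewrite !ler_norml => /andP[h1 h2] h3 h4 h5.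
by split; [apply/andP; split|apply/andP; split| |]; lra.
Qed.

Let squeeze (l1 l2 a1 b1 a2 b2 M e gG gd : R) : a1 <= l1 -> l1 <= b1 -> a2 <= l2 -> l2 <= b2 ->
  gd <= e -> `|a1 - b2 - (gG - gd)| <= M -> `|b1 - a2 - (gG + gd)| <= M ->
  `|l1 - l2 - gG| <= M + e.
Proof.
clear; rewrite !ler_norml => h1 h2 h3 h4 h5 /andP[h6 h7] /andP[h8 h9].
by apply/andP; split; lra.
Qed.

(** The weights lie between two quantiles whose levels differ by an arbitrarily
small [de]; the continuity of the linear term makes it disappear in the limit. *)
Lemma log_weight_increment (x1 x2 : R) : F x1 < 1 -> F x2 < 1 -> 0 < exp_coord F x2 ->
  exp_coord F x2 <= exp_coord F x1 -> `|exp_coord F x2 - s0| <= 1 / 2 ->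
  `|ln x1 - ln x2 - gamma * (exp_coord F x1 - exp_coord F x2)| <=
    2 * K * expR ((exp_coord F x1 - exp_coord F x2) / 4).
Proof.
move=> F1 F2 E20 E21 near0.
have E10 := lt_le_trans E20 E21.
have l1 := quantile_exp_coord_le F_support F1 E10.
have l2 := quantile_exp_coord_le F_support F2 E20.
have u1 d (d0 : 0 < d) := le_quantile_exp_coord F_continuous F_support F1 d0 (ltW E10).
have u2 d (d0 : 0 < d) := le_quantile_exp_coord F_continuous F_support F2 d0 (ltW E20).
have x10 := weight_gt0 F1 E10; have x20 := weight_gt0 F2 E20.
move: l1 l2 u1 u2 E10 E20 E21 near0.
set E1 := exp_coord F x1; set E2 := exp_coord F x2 => l1 l2 u1 u2 E10 E20 E21 near0.
apply/ler_addgt0Pr => e e0.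
pose de := Num.min (1 / 2) (e / gamma).
have d0 : 0 < de by rewrite lt_min divr_gt0//= divr_gt0.
have d2 : de <= 1 / 2 by rewrite ge_min lexx.
have dg : gamma * de <= e by rewrite mulrC -ler_pdivlMr// ge_min lexx orbT.
have lnU s : 0 < s -> forall x, 0 < x -> (ln (U (expR s)) <= ln x) = (U (expR s) <= x).
  by move=> s1 x x0; rewrite ler_ln ?posrE ?U0.
have lnU' s : 0 < s -> forall x, 0 < x -> (ln x <= ln (U (expR s))) = (x <= U (expR s)).
  by move=> s1 x x0; rewrite ler_ln ?posrE ?U0.
have a1 : ln (U (expR E1)) <= ln x1 by rewrite lnU.
have a2 : ln (U (expR E2)) <= ln x2 by rewrite lnU.
have b1 : ln x1 <= ln (U (expR (E1 + de))) by rewrite lnU' ?u1// addr_gt0.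
have b2 : ln x2 <= ln (U (expR (E2 + de))) by rewrite lnU' ?u2// addr_gt0.
have [n1 n2 y1 y2] := shifts near0 d0 d2 E21.
have := increment n1 y1; rewrite (_ : E2 + (E1 - E2 + de) = E1 + de); last by ring.
have := increment n2 y2; rewrite (_ : E2 + de + (E1 - E2 - de) = E1); last by ring.
have /andP[_ h2] := @expR_half_bounds R.
have ed : expR (de / 4) <= 2.
  apply: le_trans h2; rewrite ler_expR ler_pdivrMr//; apply: le_trans d2 _.
  by rewrite ler_peMr ?ler1n// divr_ge0.
have B1 : K * expR ((E1 - E2 + de) / 4) <= 2 * K * expR ((E1 - E2) / 4).
  rewrite mulrDl expRD mulrA [leRHS](_ : _ = K * expR ((E1 - E2) / 4) * 2); last by ring.
  by rewrite ler_wpM2l// mulr_ge0// expR_ge0.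
have B2 : K * expR ((E1 - E2 - de) / 4) <= 2 * K * expR ((E1 - E2) / 4).
  apply: le_trans B1; rewrite ler_wpM2l// ler_expR ler_pM2r// lerD2l.
  by apply: le_trans (ltW d0); rewrite oppr_le0 ltW.
move=> /le_trans/(_ B2) + /le_trans/(_ B1).
rewrite (mulrBr gamma (E1 - E2) de) (mulrDr gamma (E1 - E2) de) => c1 c2.
exact: (squeeze a1 b1 a2 b2 dg c1 c2).
Qed.

Lemma expRB1_le (u : R) : `|u| <= 1 / 2 -> `|expR u - 1| <= 2 * `|u|.
Proof.
move=> u2; have lo := expR_ge1Dx u; have hi := expR_ge1Dx (- u).
have e0 := expR_gt0 u; have em : expR u * expR (- u) = 1 by rewrite -expRD subrr expR0.
move: u2; rewrite ler_norml => /andP[u3 u4].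
have [u0|u0] := leP 0 u.
  rewrite (ger0_norm u0) ger0_norm; last by lra.
  have e1 : expR u * (1 - u) <= 1.
    by apply: le_trans (_ : expR u * expR (- u) <= _); [rewrite ler_wpM2l ?(ltW e0)|rewrite em].
  have e2 : expR u <= 2 by nra.
  have e3 : 0 <= 2 - expR u by rewrite subr_ge0.
  by have := mulr_ge0 e3 u0; lra.
have h1 : expR u - 1 <= 0 by rewrite subr_le0 -[leRHS]expR0 ler_expR ltW.
by rewrite (ler0_norm h1) (ltr0_norm u0); lra.
Qed.

Lemma weight_ratio_le (x1 x2 : R) : F x1 < 1 -> F x2 < 1 -> 0 < exp_coord F x2 ->
  exp_coord F x2 <= exp_coord F x1 -> `|exp_coord F x2 - s0| <= 1 / 2 ->
  2 * K * expR ((exp_coord F x1 - exp_coord F x2) / 4) <= 1 / 2 ->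
  `|x1 / x2 - expR (gamma * (exp_coord F x1 - exp_coord F x2))| <=
    4 * K * expR ((exp_coord F x1 - exp_coord F x2) / 4) *
    expR (gamma * (exp_coord F x1 - exp_coord F x2)).
Proof.
move=> F1 F2 E20 E21 near0 small.
have H := log_weight_increment F1 F2 E20 E21 near0.
have x10 := weight_gt0 F1 (lt_le_trans E20 E21); have x20 := weight_gt0 F2 E20.
move: H small; set G := _ - exp_coord F x2.
set u := ln x1 - ln x2 - gamma * G => H small.
have -> : x1 / x2 = expR (gamma * G) * expR u.
  rewrite -expRD (_ : gamma * G + u = ln x1 - ln x2); last by rewrite /u; ring.
  by rewrite expRB !lnK.
rewrite -[X in _ - X]mulr1 -mulrBr normrM ger0_norm ?expR_ge0// mulrC.
rewrite ler_wpM2r ?expR_ge0//; apply: le_trans (expRB1_le (le_trans H small)) _; lra.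
Qed.

End weight_ratio.

Section ordered_moments.
Context {R : realType}.

(** The order statistics, seen as a function of the rank, are a permutation of
the sample. *)
Lemma order_stat_idem (n : nat) (x : 'I_n -> R) (k : nat) : (0 < k <= n)%N ->
  order_stat (fun i : 'I_n => order_stat x i.+1) k = order_stat x k.
Proof.
move=> kn; have cmp c : (c < order_stat (fun i : 'I_n => order_stat x i.+1) k) = (c < order_stat x k).
  rewrite !(order_stat_gt _ _ kn); congr (_ <= _)%N.
  apply/eqP; rewrite -(eqr_nat R) -!sum1dep_card !natr_sum; apply/eqP.
  rewrite big_mkcond [RHS]big_mkcond/=.
  exact: (order_stat_sum (fun u => if c < u then 1 else 0 : R)).
apply/eqP; rewrite eq_le; apply/andP; split; first by rewrite leNgt cmp ltxx.
by rewrite leNgt -cmp ltxx.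
Qed.

Lemma order_stat_close (n : nat) (D x : 'I_n -> R) (De : R) :
  (forall i : 'I_n, `|D i - order_stat x i.+1| <= De) ->
  forall k, (0 < k <= n)%N -> `|order_stat D k - order_stat x k| <= De.
Proof.
move=> h k kn; rewrite -(order_stat_idem x kn); exact: order_stat_lipschitz.
Qed.

Variables (n m : nat) (p wk xi De : R) (x D : 'I_n -> R) (t : m.-tuple R).
Hypotheses (p0 : 0 <= p) (wk0 : 0 < wk) (xi0 : 0 <= xi) (m0 : (0 < m)%N).
Hypothesis wkE : wk = order_stat x m.+1.
Hypothesis t_dec : forall i j : 'I_m, (i <= j)%N -> tnth t j <= tnth t i.
Hypothesis ratio : forall i : 'I_m,
  `|order_stat x i.+1 / wk - expR (p * tnth t i)| <= xi * expR (p * tnth t i).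
Hypothesis close : forall k, (0 < k <= m.+1)%N -> `|order_stat D k - order_stat x k| <= De.

Let moment_diff (q : nat) :
  `|pwm_moment D m.+1 q / wk -
     m%:R^-1 * \sum_(i < m) (i.+1%:R / m%:R) ^+ q.-1 * (expR (p * tnth t i) - 1)| <=
  2 * De / wk + xi * (1 + excess1 p t).
Proof.
have mR : (0 : R) < m%:R by rewrite ltr0n.
rewrite /pwm_moment /= big_add1 /= big_mkord.
set S1 := \sum_(i < m) _; set S2 := \sum_(i < m) _.
rewrite (_ : _ * S1 / wk - _ * S2 = m%:R^-1 * (S1 / wk - S2)); last by ring.
rewrite /S1 /S2 mulr_suml -sumrB.
rewrite normrM ger0_norm ?invr_ge0// ler_pdivrMl//.
apply: le_trans (ler_norm_sum _ _ _) _.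
have E1 : \sum_(i < m) expR (p * tnth t i) = m%:R * (1 + excess1 p t).
  rewrite /excess1 sumrB sumr_const card_ord -[1 *+ m]/(m%:R); field; by rewrite gt_eqF.
have -> : m%:R * (2 * De / wk + xi * (1 + excess1 p t)) =
  \sum_(i < m) (2 * De / wk + xi * expR (p * tnth t i)).
  rewrite big_split/= -[\sum_(i < m) xi * _]mulr_sumr E1 sumr_const card_ord -[X in _ = X + _]mulr_natl; ring.
apply: ler_sum => i _.
set u : R := (i.+1%:R / m%:R) ^+ q.-1.
rewrite (_ : u * (order_stat D i.+1 - order_stat D m.+1) / wk - u * (expR (p * tnth t i) - 1) =
  u * ((order_stat D i.+1 - order_stat D m.+1) / wk - (expR (p * tnth t i) - 1))); last by ring.
rewrite normrM.
have u01 : `|u| <= 1.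
  rewrite /u normrX ger0_norm ?divr_ge0// exprn_ile1 ?divr_ge0//.
  by rewrite ler_pdivrMr// mul1r ler_nat.
rewrite -[leRHS]mul1r; apply: ler_pM => //.
have c1 : `|order_stat D i.+1 - order_stat x i.+1| <= De by apply: close; rewrite /= ltnS ltnW.
have c2 : `|order_stat D m.+1 - order_stat x m.+1| <= De by apply: close; rewrite /= leqnn.
rewrite (_ : _ - _ = ((order_stat D i.+1 - order_stat x i.+1) - (order_stat D m.+1 - order_stat x m.+1)) / wk
   + (order_stat x i.+1 / wk - expR (p * tnth t i))); last first.
  by rewrite -wkE; field; rewrite gt_eqF.
apply: le_trans (ler_normD _ _) _; apply: lerD; last exact: ratio.
rewrite normrM normfV (gtr0_norm wk0) ler_wpM2r ?invr_ge0 ?(ltW wk0)//.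
apply: le_trans (ler_normB _ _) _; lra.
Qed.

Lemma pwm_moment1_close :
  `|pwm_moment D m.+1 1 / wk - excess1 p t| <= 2 * De / wk + xi * (1 + excess1 p t).
Proof.
have := moment_diff 1; rewrite /=; under eq_bigr do rewrite expr0 mul1r.
exact.
Qed.

Lemma pwm_moment2_close :
  `|pwm_moment D m.+1 2 / wk - excess2 p t| <= 2 * De / wk + xi * (1 + excess1 p t).
Proof.
have := moment_diff 2; rewrite /= excess2_sorted//.
have -> : m%:R^-1 * \sum_(i < m) (i.+1%:R / m%:R) ^+ 1 * (expR (p * tnth t i) - 1) =
  (m%:R ^+ 2)^-1 * \sum_(i < m) i.+1%:R * (expR (p * tnth t i) - 1).
  rewrite !mulr_sumr; apply: eq_bigr => i _; rewrite expr1; field.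
  by rewrite pnatr_eq0 -lt0n.
exact.
Qed.

End ordered_moments.

(** * The limit law of the spacings *)

Section top_spacings_limit.
Context {R : realType} (p : R) (p01 : 0 < p < 1 / 2).
Context {d : nat -> measure_display} {T : forall n, measurableType (d n)}.
Variables (P : forall n, probability (T n) R).
Variables (X : forall n, 'I_n -> {RV (P n) >-> R}).
Arguments X : clear implicits.
Hypothesis X_indep : forall n, mutually_independent (X n).
Hypothesis X_law : forall n i A, measurable A -> P n (X n i @^-1` A) = exp_law A.
Hypothesis X_ge0 : forall n i w, 0 <= X n i w.
Variables (m : nat -> nat) (m_le : forall n, (m n <= n)%N).
Hypothesis m_infty : m n @[n --> \oo] --> \oo.
Hypothesis m_lt : \forall n \near \oo, (m n < n)%N.

Let Y n (i : 'I_(m n)) : {RV (P n) >-> R} := X n (widen_ord (m_le n) i).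

Let Y_law n i A : measurable A -> P n (@Y n i @^-1` A) = exp_law A.
Proof. exact: X_law. Qed.

Let Y_indep n : mutually_independent (@Y n).
Proof.
move=> S mS; have := sample_prefix_box (@X_indep n) (@X_law n) (m_le n) mS.
rewrite (_ : _ @^-1` _ = [set w | forall i, S i (@Y n i w)]); last first.
  by apply/seteqP; split => w /= h i; have := h i; rewrite tnth_mktuple.
by move=> ->; apply: eq_bigr => i _; rewrite Y_law.
Qed.

Let Y_ge0 n i w : 0 <= @Y n i w. Proof. exact: X_ge0. Qed.

Let transfer n (E : set ((m n).-tuple R)) : (m n < n)%N -> measurable E ->
  (forall t t' : (m n).-tuple R, perm_eq t t' -> E t -> E t') ->
  P n (top_spacings (X n) (m n) @^-1` E) = P n (sample Y (n:=n) @^-1` E).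
Proof.
move=> mn mE sE; rewrite (top_spacings_law (@X_indep n) (@X_law n) (@X_ge0 n) mn mE sE).
by rewrite (bool_irrelevance (ltnW mn) (m_le n)).
Qed.

(** [top_spacings_law] only compares the two laws on symmetric events, for
samples of the same size. *)
Let whp_transfer (E : forall n, set ((m n).-tuple R)) : (forall n, measurable (E n)) ->
  (forall n (t t' : (m n).-tuple R), perm_eq t t' -> E n t -> E n t') ->
  whp P (fun n => [set w | E n (sample Y (n:=n) w)]) ->
  whp P (fun n => [set w | E n (top_spacings (X n) (m n) w)]).
Proof.
move=> mE sE hE; apply: whp_measurable => [n|e e0].
  by have := measurable_top_spacings (X n) (m := m n) measurableT (mE n); rewrite setTI.
have mS n : measurable (sample Y (n:=n) @^-1` E n).
  by have := measurable_sample Y (n:=n) measurableT (mE n); rewrite setTI.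
have mTS n : measurable (top_spacings (X n) (m n) @^-1` E n).
  by have := measurable_top_spacings (X n) (m := m n) measurableT (mE n); rewrite setTI.
near=> n.
have [B [mB BE PB]] : exists B, [/\ measurable B, B `<=` [set w | E n (sample Y (n:=n) w)] & (P n (~` B) <= e%:E)%E].
  by near: n; exact: hE.
apply: le_trans PB; rewrite probability_setC//.
have mn : (m n < n)%N by near: n.
rewrite (transfer mn (mE n) (@sE n)).
rewrite -probability_setC//; apply: le_measure; rewrite ?inE//; try exact: measurableC.
by move=> w h /BE.
Unshelve. all: by end_near. Qed.

Theorem top_spacings_clt (x : R) :
  P n [set w | pwm_stat p (top_spacings (X n) (m n) w) <= x] @[n --> \oo] -->
  (std_cdf (den_limit p / Num.sqrt (score_variance p) * x))%:E.
Proof.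
have H := pwm_stat_clt (x := x) p01 Y_indep Y_law Y_ge0 m_infty.
apply: (cvg_trans (near_eq_cvg _)); last exact: H.
near=> n.
rewrite -/((top_spacings (X n) (m n)) @^-1` [set t | pwm_stat p t <= x]).
rewrite -/(sample Y (n:=n) @^-1` [set t | pwm_stat p t <= x]).
apply/esym/transfer; first by near: n.
  by apply: measurable_le; exact: (measurable_pwm_stat p).
by move=> t t' /(excess_perm p)[e1 e2]; rewrite /= /pwm_stat /pwm_num /pwm_den e1 e2.
Unshelve. all: by end_near. Qed.

Lemma whp_top_spacings (e : R) : 0 < e ->
  whp P (fun n => [set w | let t := top_spacings (X n) (m n) w in
    [/\ `|pwm_den p t - den_limit p| <= e, excess1 p t <= p / (1 - p) + 1 &
      forall i, tnth t i <= 2 * ln (m n)%:R]]).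
Proof.
move=> e0.
have H1 : whp P (fun n => [set w | `|pwm_den p (top_spacings (X n) (m n) w) - den_limit p| <= e]).
  apply: (whp_transfer (E := fun n => [set t | `|pwm_den p t - den_limit p| <= e])).
  - move=> n; apply: measurable_le; apply: (measurableT_comp (@normr_measurable R setT)).
    apply: measurable_funB => //; apply: measurable_funB; first exact: measurable_excess1.
    by apply: measurable_funM => //; exact: measurable_excess2.
  - by move=> n t t' /(excess_perm p)[e1 e2]; rewrite /= /pwm_den e1 e2.
  - exact: (whp_pwm_den p01 Y_indep Y_law Y_ge0 m_infty e0).
have H2 : whp P (fun n => [set w | excess1 p (top_spacings (X n) (m n) w) <= p / (1 - p) + 1]).
  apply: (whp_transfer (E := fun n => [set t | excess1 p t <= p / (1 - p) + 1])).
  - by move=> n; apply: measurable_le; exact: measurable_excess1.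
  - by move=> n t t' /(excess_perm p)[e1 e2]; rewrite /= e1.
  - exact: (whp_excess1 p01 Y_indep Y_law m_infty).
have H3 : whp P (fun n => [set w | forall i, tnth (top_spacings (X n) (m n) w) i <= 2 * ln (m n)%:R]).
  apply: (whp_transfer (E := fun n => [set t | forall i, tnth t i <= 2 * ln (m n)%:R])).
  - by move=> n; apply: measurable_forall => i; apply: measurable_le; exact: measurable_tnth.
  - move=> n t t' tt' /= h; have : all (fun u => u <= 2 * ln (m n)%:R) t' by rewrite -(perm_all _ tt'); apply/all_tnthP.
    by move=> /all_tnthP.
  - exact: (whp_max_le Y_law m_infty).
apply: whpS (whpI H1 (whpI H2 H3)); near=> n => w /= [h1 [h2 h3]]; split => //.
Unshelve. all: by end_near. Qed.

End top_spacings_limit.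

(** * Degrees and ordered weights with high probability *)

Section growth.
Context {R : realType}.

Lemma near_ln_ge (M : R) : \forall n \near \oo, M <= ln n%:R.
Proof.
have H : \forall n \near \oo, expR M <= n%:R :> R by exact: nbhs_infty_ger.
near=> n; have h : expR M <= n%:R by near: n; exact: H.
by rewrite -(expRK M) ler_ln ?posrE ?expR_gt0// (lt_le_trans (expR_gt0 M)).
Unshelve. all: by end_near. Qed.

(** Beating every power of n takes only the quadratic lower bound of exp. *)
Lemma expR_ge_square (v : R) : 0 <= v -> v ^+ 2 / 4 <= expR v.
Proof.
move=> v0; have h := expR_ge1Dx (v / 2).
have -> : expR v = expR (v / 2) ^+ 2 by rewrite -expRM_natl; congr expR; field.
have h2 : v / 2 <= expR (v / 2) by apply: le_trans h; rewrite lerDr.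
have v2 : 0 <= v / 2 by rewrite divr_ge0.
have -> : v ^+ 2 / 4 = (v / 2) ^+ 2 by field.
by rewrite ler_sqr ?nnegrE ?expR_ge0.
Qed.

(** The parameters of Chernoff's bound: the weights are below [n^(g + e)], the
tilt is the inverse square root of that, and the deviation exceeds the resulting
standard deviation by a factor [n^e]. *)
Definition weight_cap (g e : R) (n : nat) : nat := (Num.truncn (expR ((g + e) * ln n%:R))).+1.
Definition degree_tilt (g e : R) (n : nat) : R := expR (- ((g + e) / 2 * ln n%:R)).
Definition degree_error (g e : R) (n : nat) : R := expR ((e + (g + e) / 2) * ln n%:R).

Lemma degree_failure_cvg0 (g e : R) : 0 < e -> 0 < g -> g + e <= 1 -> forall u : R, 0 < u ->
  \forall n \near \oo, n%:R * ((weight_cap g e n)%:R *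
    (2 * expR (1 - degree_tilt g e n * degree_error g e n +
      2 * (weight_cap g e n)%:R * degree_tilt g e n ^+ 2))) <= u.
Proof.
move=> e0 g0 ge1 u u0.
near=> n; have n0 : (0 : R) < n%:R by rewrite ltr0n; near: n; exists 1%N.
pose l : R := ln n%:R.
have l0 : 0 <= l by rewrite ln_ge0// ler1n -(ltr0n R).
have l1 : 12 / e ^+ 2 <= l by rewrite /l; near: n; exact: near_ln_ge.
have l2 : 5 + ln (4 / u) <= l by rewrite /l; near: n; exact: near_ln_ge.
have nE : n%:R = expR l by rewrite lnK.
have capE : (weight_cap g e n)%:R <= 2 * expR ((g + e) * l).
  have q1 : 1 <= expR ((g + e) * l) by rewrite -[leLHS]expR0 ler_expR mulr_ge0//; lra.
  have h : (Num.truncn (expR ((g + e) * l)))%:R <= expR ((g + e) * l) by rewrite truncn_le expR_ge0.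
  by rewrite /weight_cap -natr1 -/l; lra.
have tilt2 : degree_tilt g e n ^+ 2 = expR (- ((g + e) * l)).
  by rewrite /degree_tilt -expRM_natl; congr expR; rewrite -/l; field.
have c4 : 2 * (weight_cap g e n)%:R * degree_tilt g e n ^+ 2 <= 4.
  rewrite tilt2; apply: le_trans (_ : 2 * (2 * expR ((g + e) * l)) * expR (- ((g + e) * l)) <= _).
    by rewrite ler_wpM2r ?expR_ge0// ler_wpM2l.
  rewrite (_ : _ * _ * _ = 4 * (expR ((g + e) * l) * expR (- ((g + e) * l)))); last by ring.
  by rewrite -expRD subrr expR0 mulr1.
have tE : degree_tilt g e n * degree_error g e n = expR (e * l).
  by rewrite /degree_tilt /degree_error -expRD -/l; congr expR; ring.
have sq : 3 * l <= expR (e * l).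
  apply: le_trans (expR_ge_square _); last by rewrite mulr_ge0// ltW.
  have h : 12 <= l * e ^+ 2 by rewrite -ler_pdivrMr// exprn_gt0.
  have -> : (e * l) ^+ 2 / 4 = (l * e ^+ 2) * l / 4 by ring.
  have : 12 * l <= l * e ^+ 2 * l by rewrite ler_wpM2r.
  lra.
have capn : (weight_cap g e n)%:R <= 2 * expR l.
  apply: le_trans capE _; rewrite ler_wpM2l// ler_expR -[leRHS]mul1r.
  by rewrite ler_wpM2r.
rewrite tE; set c := 2 * _ * _ in c4 *.
apply: le_trans (_ : expR l * (2 * expR l * (2 * expR (5 - 3 * l))) <= _).
  rewrite nE ler_wpM2l ?expR_ge0//; apply: ler_pM; [by []|by rewrite mulr_ge0 ?expR_ge0|exact: capn|].
  by rewrite ler_wpM2l// ler_expR; lra.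
have -> : expR l * (2 * expR l * (2 * expR (5 - 3 * l))) = 4 * expR (5 - l).
  have -> : expR (5 - l) = expR l * (expR l * expR (5 - 3 * l)).
    by rewrite -!expRD; congr expR; ring.
  by ring.
have : expR (5 - l) <= expR (- ln (4 / u)) by rewrite ler_expR; lra.
rewrite expRN lnK ?posrE ?divr_gt0// invf_div => h.
by apply: le_trans (_ : 4 * (u / 4) <= _); [rewrite ler_wpM2l|rewrite mulrC divfK].
Unshelve. all: by end_near. Qed.

End growth.

Section degree_approximation.
Context {R : realType} (F : cumulativeBounded (0 : R) (1 : R)).
Hypothesis F_continuous : continuous F.
Hypothesis F_support : forall x : R, x <= 0 -> F x = 0.
Context {d : nat -> measure_display} {T : forall n, measurableType (d n)}.
Variables (P : forall n, probability (T n) R).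
Variables (W : forall n, 'I_n -> {RV (P n) >-> R}).
Arguments W : clear implicits.
Hypothesis W_law : forall n (i : 'I_n) (x : R), cdf (W n i) x = (F x)%:E.
Hypothesis W_indep : forall n, mutually_independent (W n).
Local Notation U := (tail_quantile F).

Definition exp_rv n (i : 'I_n) : {RV (P n) >-> R} :=
  mfun_Sub (mem_set (measurable_exp_coord F (W n i))).
Arguments exp_rv : clear implicits.

Lemma exp_rv_law n i A : measurable A -> P n (exp_rv n i @^-1` A) = exp_law A.
Proof. by move=> mA; exact: (exp_coord_law F_continuous F_support (W_law i) mA). Qed.

Lemma exp_rv_indep n : mutually_independent (exp_rv n).
Proof.
have mE : measurable_fun setT (exp_coord F).
  apply: (measurableT_comp (@oppr_measurable R setT)); apply: (measurableT_comp (@measurable_ln R)).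
  by apply: measurable_funB => //; exact: measurable_cdf.
move=> S mS; have mS' i : measurable (exp_coord F @^-1` S i).
  by rewrite -[X in measurable X]setTI; exact: mE.
exact: (@W_indep n (fun i => exp_coord F @^-1` S i) mS').
Qed.

Lemma exp_rv_ge0 n i w : 0 <= exp_rv n i w.
Proof. exact: exp_coord_ge0. Qed.

(** Outside this almost sure event a weight may sit at the top of the support
of [F], where the exponential coordinate is infinite, or have coordinate 0. *)
Definition regular n (w : T n) := forall i, F (W n i w) < 1 /\ 0 < exp_rv n i w.
Arguments regular : clear implicits.

Lemma whp_regular : whp P regular.
Proof.
pose A n i : set (T n) := ~` ([set w | 1 <= F (W n i w)] `|` exp_rv n i @^-1` [set 0]).
have m1 n i : measurable [set w | 1 <= F (W n i w)].
  rewrite (_ : mkset _ = [set w | - F (W n i w) <= - 1]).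
    apply: measurable_le; apply: (measurableT_comp (@oppr_measurable R setT)).
    by apply: (measurableT_comp (measurable_cdf F)); exact: measurable_funPT.
  by apply/seteqP; split => w /=; rewrite lerN2.
have m2 n i : measurable (exp_rv n i @^-1` [set 0]).
  by rewrite -[X in measurable X]setTI; exact: measurable_funPT.
have mA n i : measurable (A n i) by exact/measurableC/measurableU.
apply: (@whpS _ _ _ _ (fun n => [set w | forall i, A n i w])).
  near=> n => w /= h i; have /not_orP[/negP h1 /eqP h2] := h i; split; first by rewrite ltNge.
  by rewrite lt_neqAle eq_sym h2 exp_rv_ge0.
apply: whp_measurable => [n|u u0]; first exact: (measurable_forall (@mA n)).
near=> n; rewrite (_ : ~` _ = [set w | exists i, (~` A n i) w]); last first.
  by apply/seteqP; split => w /=; rewrite -existsNE.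
have mC i : measurable (~` A n i) by exact: measurableC.
have c0 i : (P n (~` A n i) <= 0%:E)%E.
  have z1 : P n [set w | 1 <= F (W n i w)] = 0%E by exact: cdf_lt1_ae.
  have z2 : P n (exp_rv n i @^-1` [set 0]) = 0%E by rewrite exp_rv_law// exp_law_set1.
  have z : (P n [set w | (1 <= F (W n i w))%R] + P n (exp_rv n i @^-1` [set 0%R]) <= 0)%E.
    by rewrite z1 z2 adde0.
  by rewrite /A setCK; apply: le_trans (measureU2 _ (m1 n i) (m2 n i)) z.
apply: le_trans (union_bound mC c0) _; first by rewrite mulr0 lee_fin ltW.
Unshelve. all: by end_near. Qed.

Lemma regular_weight n w i : regular n w -> 0 < W n i w.
Proof. by move=> /(_ i)[w1 x0]; exact: (weight_gt0 F_continuous F_support w1 x0). Qed.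

Lemma order_stat_exp n w (k : nat) : regular n w -> (0 < k <= n)%N ->
  [/\ order_stat (exp_rv n ^~ w) k = exp_coord F (order_stat (W n ^~ w) k),
      F (order_stat (W n ^~ w) k) < 1 & 0 < order_stat (exp_rv n ^~ w) k].
Proof.
move=> rw kn; have [j jE] := order_stat_mem (W n ^~ w) kn.
have E : order_stat (exp_rv n ^~ w) k = exp_coord F (order_stat (W n ^~ w) k).
  apply: (order_stat_comp (h := exp_coord F) kn) => i i' ii' /=.
  have [w1 _] := rw i'; rewrite lerN2 ler_ln ?posrE ?subr_gt0//; last first.
    exact: le_lt_trans (cdf_homo F ii') w1.
  by rewrite lerD2l lerN2; exact: cdf_homo.
by rewrite E jE; have [w1 x0] := rw j.
Qed.

Variables (gamma e : R).
Hypotheses (gamma0 : 0 < gamma) (e0 : 0 < e) (eg : e < gamma) (e_small : 2 * gamma + 4 * e <= 1).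
Hypothesis U_rv : regularly_varying U gamma.
Variable (A : forall n, 'I_n -> 'I_n -> {RV (P n) >-> nat}).
Hypothesis model : (forall n, norros_reittu (W n) (@A n)) \/ (forall n, chung_lu (W n) (@A n)).

Let ge1 : gamma + e <= 1.
Proof. by have h1 := gamma0; have h2 := e0; have h4 := e_small; lra. Qed.

Let Ue0 : 0 < U (expR 1).
Proof. by apply: quantile_gt0 => //; rewrite expR_gt1. Qed.

Let U_bound (e1 : R) : 0 < e1 -> e1 < gamma ->
  \forall s \near +oo, U (expR s) <= expR ((gamma + e1) * s).
Proof.
move=> e10 e1g.
have := log_growth (quantile_gt0 F_continuous F_support) (quantile_homo F_continuous F_support) U_rv e10 e1g.
move=> H; near=> s; have s0 : 0 < s by near: s; exact: nbhs_pinfty_gt.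
have /andP[_ h] : (gamma - e1) * s <= ln (U (expR s)) <= (gamma + e1) * s by near: s.
rewrite -[leLHS]lnK ?ler_expR// posrE; apply: quantile_gt0 => //; by rewrite expR_gt1.
Unshelve. all: by end_near. Qed.

(** The maximum of the [E_i] is near [ln n], and the sum of the weights grows
linearly already because of the weights with [E_i > 1]; as [gamma < 1/2], products
of two weights are smaller than that. *)
Lemma whp_typical : whp P (fun n => [set w | [/\ regular n w, typical_weights (W n) w &
  forall i, ordered_weight (W n) i w < (weight_cap gamma e n)%:R]]).
Proof.
have e40 : 0 < e / 4 by rewrite divr_gt0.
have H1 := whp_max_exponential exp_rv_law e40.
have H2 := whp_exceedances_one exp_rv_indep exp_rv_law.
have e4g : e / 4 < gamma by have h2 := e0; have h3 := eg; lra.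
have [M [_ hM]] := U_bound e40 e4g.
apply: whpS (whpI whp_regular (whpI H1 H2)); near=> n => w /= [rw [mx ex]].
have n0 : (0 : R) < n%:R by rewrite ltr0n; near: n; exists 1%N.
pose l : R := ln n%:R.
have l1 : 2 / e <= l by rewrite /l; near: n; exact: near_ln_ge.
have l2 : M <= l by rewrite /l; near: n; exact: near_ln_ge.
have l3 : ln (8 / U (expR 1)) / (2 * e) <= l by rewrite /l; near: n; exact: near_ln_ge.
have l0 : 0 < l by apply: lt_le_trans l1; rewrite divr_gt0.
have nE : n%:R = expR l by rewrite lnK.
pose V := expR ((gamma + e) * l).
have WV i : W n i w <= V.
  have [w1 x0] := rw i.
  apply: le_trans (le_quantile_exp_coord F_continuous F_support w1 ltr01 (ltW x0)) _.
  apply: le_trans (_ : U (expR ((1 + e / 4) * l + 1)) <= _).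
    apply: quantile_homo => //; first by rewrite expR_gt1 ltr_wpDl// ltW.
    by rewrite ler_expR lerD2r; exact: mx.
  apply: le_trans (hM _ _) _.
    by apply: le_lt_trans l2 _; have h2 := e0; nra.
  rewrite ler_expR.
  have le2 : 2 <= l * e by rewrite -ler_pdivrMr.
  have -> : (gamma + e / 4) * ((1 + e / 4) * l + 1) =
    gamma * l + (l * e) / 4 * (1 + gamma + e / 4) + (gamma + e / 4) by field.
  have : (l * e) / 4 * (1 + gamma + e / 4) <= (l * e) / 4 * 2.
    rewrite ler_wpM2l//; have h1 := gamma0; have h2 := e0; have h3 := eg; have h4 := e_small; lra.
  have h1 := gamma0; have h2 := e0; have h3 := eg; have h4 := e_small; lra.
have W0 i := regular_weight i rw.
have os (i : 'I_n) : exists j, ordered_weight (W n) i w = W n j w.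
  by apply: order_stat_mem; rewrite ltn_ord.
have V0 : 0 <= V by exact: expR_ge0.
split=> //; last first.
  by move=> i; have [j ->] := os i; apply: le_lt_trans (WV j) _; exact: truncnS_gt.
split; first by move=> i; have [j ->] := os i.
have L : U (expR 1) * (n%:R / 8) <= \sum_i W n i w.
  apply: le_trans (_ : U (expR 1) * (exceedances exp_rv 1 w)%:R <= _).
    by rewrite ler_wpM2l// ltW.
  rewrite /exceedances -sum1dep_card natr_sum mulr_sumr big_mkcond/=.
  apply: ler_sum => i _; case: ifPn => [x1|_]; last exact/ltW.
  rewrite mulr1; have [w1 x0] := rw i.
  apply: le_trans (quantile_exp_coord_le F_support w1 x0).
  by apply: quantile_homo; rewrite ?expR_gt1// ler_expR ltW.
have V2 : V * V <= U (expR 1) * (n%:R / 8).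
  rewrite -ler_pdivrMl// mulrA.
  have -> : (U (expR 1))^-1 * V * V = (8 / U (expR 1)) * (V * V) / 8 by field; rewrite gt_eqF.
  rewrite ler_pM2r// -[X in X * _]lnK ?posrE ?divr_gt0// /V -!expRD nE ler_expR.
  move: l3; rewrite ler_pdivrMr ?mulr_gt0// => l3.
  have : (2 * gamma + 4 * e) * l <= 1 * l by rewrite ler_wpM2r// ltW.
  lra.
move=> i j; rewrite /edge_parameter ler_pdivrMr; last first.
  by apply: lt_le_trans L; rewrite mulr_gt0// divr_gt0.
rewrite mul1r; apply: le_trans L; apply: le_trans V2.
have [i' ->] := os i; have [j' ->] := os j.
by apply: ler_pM => //; exact/ltW.
Unshelve. all: by end_near. Qed.

Lemma whp_degree_close : whp P (fun n => [set w | regular n w /\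
  forall i, `|degree (@A n) w i - ordered_weight (W n) i w| <= degree_error gamma e n]).
Proof.
have H : whp P (fun n => [set w | forall i, typical_weights (W n) w ->
    ordered_weight (W n) i w < (weight_cap gamma e n)%:R ->
    `|degree (@A n) w i - ordered_weight (W n) i w| <= degree_error gamma e n]).
  move=> u u0; near=> n.
  have fail : n%:R * ((weight_cap gamma e n)%:R *
    (2 * expR (1 - degree_tilt gamma e n * degree_error gamma e n +
      2 * (weight_cap gamma e n)%:R * degree_tilt gamma e n ^+ 2))) <= u.
    by near: n; exact: (degree_failure_cvg0 e0 gamma0 ge1 u0).
  have mdl : norros_reittu (W n) (@A n) \/ chung_lu (W n) (@A n) by case: model; [left|right].
  have s01 : 0 < degree_tilt gamma e n <= 1 / 2.
    rewrite expR_gt0/=.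
    have l1 : 2 * ln 2 / (gamma + e) <= ln n%:R by near: n; exact: near_ln_ge.
    move: l1; rewrite ler_pdivrMr ?addr_gt0// => l1.
    rewrite mul1r -[leRHS](@lnK R) ?posrE ?invr_gt0// ler_expR lnV ?posrE//; lra.
  have [B [mB PB hB]] := degree_concentration (degree_error gamma e n) (weight_cap gamma e n) mdl s01.
  exists (~` B); split; first exact: measurableC.
    by move=> w Bw i tw cw; exact: hB.
  by rewrite setCK; apply: le_trans PB _; rewrite lee_fin.
apply: whpS (whpI whp_typical H); near=> n => w /= [[rw tw cw] h]; split=> // i.
exact: h.
Unshelve. all: by end_near. Qed.

End degree_approximation.

(** * Deviation of the estimator *)

Section estimator_deviation.
Context {R : realType}.

(** The normalisation uses [k], the sample has size [k - 1]. *)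
Lemma sqrt_succ_ratio (m : nat) : (0 < m)%N ->
  Num.sqrt m.+1%:R - Num.sqrt m%:R <= Num.sqrt m%:R / m%:R :> R.
Proof.
move=> m0; have mR : (0 : R) < m%:R by rewrite ltr0n.
set r := Num.sqrt m%:R; set r' := Num.sqrt m.+1%:R.
have r0 : 0 < r by rewrite sqrtr_gt0.
have r2 : r ^+ 2 = m%:R by rewrite sqr_sqrtr ?ltW.
rewrite -r2 (_ : r / r ^+ 2 = r^-1); last by field; rewrite gt_eqF.
have ri0 : 0 <= r^-1 + r by rewrite addr_ge0 ?invr_ge0 ?(ltW r0).
rewrite lerBlDr -ler_sqr ?nnegrE ?sqrtr_ge0//.
have -> : r' ^+ 2 = r ^+ 2 + 1 by rewrite r2 sqr_sqrtr ?ler0n// -natr1.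
have i2 : 0 <= r^-1 ^+ 2 by exact: sqr_ge0.
by rewrite sqrrD mulVf ?gt_eqF//; lra.
Qed.

(** The whole comparison at one sample point: passing from the ordered degrees
to the ordered weights costs [De], passing from the ratios of the weights to
exponentials of the spacings [t] costs [xi], and the estimator inherits both
through the two moments, relatively to the limit of its denominator. *)
Lemma estimator_deviation (n m : nat) (p wk xi De C e : R) (x D : 'I_n -> R) (t : m.-tuple R)
    (c := den_limit p) (delta := 2 * De / wk + xi * (1 + C)) :
  0 < p < 1 / 2 -> (0 < m)%N -> 0 < wk -> wk = order_stat x m.+1 -> 0 <= xi ->
  (forall i j : 'I_m, (i <= j)%N -> tnth t j <= tnth t i) ->
  (forall i : 'I_m,
    `|order_stat x i.+1 / wk - expR (p * tnth t i)| <= xi * expR (p * tnth t i)) ->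
  (forall k, (0 < k <= m.+1)%N -> `|order_stat D k - order_stat x k| <= De) ->
  `|pwm_den p t - c| <= c / 2 -> excess1 p t <= C ->
  3 * delta <= c / 4 ->
  20 * Num.sqrt m.+1%:R * delta / c <= e ->
  12 * Num.sqrt m.+1%:R * delta / c + m%:R^-1 <= e ->
  `|Num.sqrt m.+1%:R * (pwm_estimator D m.+1 - p) - pwm_stat p t| <=
    e * (1 + `|pwm_stat p t|).
Proof.
move=> p01 m0 wk0 wkE xi0 t_dec ratio close den ex d1 d2 d3.
have /andP[p0 p1] := p01.
have c0 : 0 < c by rewrite divr_gt0// mulr_gt0//; lra.
have mR : (0 : R) < m%:R by rewrite ltr0n.
have b0 : 2 * De / wk + xi * (1 + excess1 p t) <= delta by rewrite lerD2l ler_wpM2l// lerD2l.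
have M1 : `|pwm_moment D m.+1 1 / wk - excess1 p t| <= delta.
  exact: le_trans (pwm_moment1_close wk0 m0 wkE ratio close) b0.
have M2 : `|pwm_moment D m.+1 2 / wk - excess2 p t| <= delta.
  exact: le_trans (pwm_moment2_close (ltW p0) wk0 m0 wkE t_dec ratio close) b0.
have hJ : c / 2 <= excess1 p t - 2 * excess2 p t.
  by move: den; rewrite ler_norml => /andP[+ _]; rewrite /pwm_den; lra.
have := ratio_perturbation p01 c0 hJ M1 M2 d1.
have -> : (pwm_moment D m.+1 1 / wk - 4 * (pwm_moment D m.+1 2 / wk)) /
  (pwm_moment D m.+1 1 / wk - 2 * (pwm_moment D m.+1 2 / wk)) = pwm_estimator D m.+1.
  rewrite /pwm_estimator !mulrA -!mulrBl invfM invrK mulrACA mulVf ?mulr1 ?gt_eqF//.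
set y := (_ / (excess1 p t - 2 * excess2 p t)) => key.
have -> : pwm_stat p t = Num.sqrt m%:R * y by [].
clearbody y.
set r := Num.sqrt m%:R; set r' := Num.sqrt m.+1%:R in d2 d3 *.
have r1 : 1 <= r by rewrite -(@sqrtr1 R) ler_sqrt// ler1n.
have r'0 : 0 <= r' by exact: sqrtr_ge0.
have rr' : r <= r' by rewrite ler_sqrt// ler_nat.
have rm := sqrt_succ_ratio m0; rewrite -/r -/r' in rm.
have de0 : 0 <= delta by exact: le_trans (normr_ge0 _) M1.
rewrite normrM (ger0_norm (le_trans ler01 r1)).
rewrite (_ : _ - _ = r' * (pwm_estimator D m.+1 - p - y) + (r' - r) * y); last by ring.
apply: le_trans (ler_normD _ _) _; rewrite !normrM (ger0_norm r'0) (ger0_norm (_ : 0 <= r' - r)) ?subr_ge0//.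
have s1 : r' * `|pwm_estimator D m.+1 - p - y| <= r' * (4 * delta / c * (5 + 3 * `|y|)).
  by rewrite ler_wpM2l.
have y0 := normr_ge0 y.
have s2 : (r' - r) * `|y| <= m%:R^-1 * (r * `|y|).
  by rewrite mulrA ler_wpM2r// mulrC.
have yr : `|y| <= r * `|y| by rewrite ler_peMl.
have s3 : 12 * r' * delta / c * `|y| <= 12 * r' * delta / c * (r * `|y|).
  by rewrite ler_wpM2l// divr_ge0 ?(ltW c0)// !mulr_ge0.
have s4 : (12 * r' * delta / c + m%:R^-1) * (r * `|y|) <= e * (r * `|y|).
  by rewrite ler_wpM2r// mulr_ge0// (le_trans ler01 r1).
have E : r' * (4 * delta / c * (5 + 3 * `|y|)) = 20 * r' * delta / c + 12 * r' * delta / c * `|y|.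
  by field; rewrite gt_eqF.
rewrite E in s1; apply: le_trans (lerD s1 s2) _.
rewrite mulrDl in s4; rewrite (mulrDr e) mulr1.
apply: le_trans (_ : 20 * r' * delta / c + (12 * r' * delta / c * (r * `|y|) + m%:R^-1 * (r * `|y|)) <= _).
  by rewrite -addrA lerD2l lerD2r.
exact: lerD.
Qed.

End estimator_deviation.

(** * Rates of convergence *)

Section normal_scaling.
Context {R : realType}.
Local Notation mu := (@lebesgue_measure R).

Lemma normal_pdf_scale (s x : R) : 0 < s -> normal_pdf 0 s x = std_pdf (s^-1 * x) * s^-1.
Proof.
move=> s0; rewrite std_pdfE normal_pdfE ?gt_eqF// /normal_fun subr0 mulrAC; congr (_ * _).
  rewrite /normal_peak expr1n mul1r -mulrnAr sqrtrM ?sqr_ge0// sqrtr_sqr gtr0_norm//.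
  by rewrite invfM mulrC.
by congr expR; rewrite -mulr_natr; field; rewrite gt_eqF.
Qed.

Lemma normal_prob_scale (s x : R) : 0 < s ->
  normal_prob 0 s `]-oo, x] = (std_cdf (s^-1 * x))%:E.
Proof.
move=> s0; have si : 0 < s^-1 by rewrite invr_gt0.
have dF (z : R) : is_derive z 1 (fun y => s^-1 * y) s^-1.
  by apply: is_derive_eq; rewrite /GRing.scale /= mulr1.
have F' : ((fun y : R => s^-1 * y)^`())%classic = cst s^-1.
  by apply/funext => z; rewrite derive1E derive_val.
have cF : continuous (fun y : R => s^-1 * y).
  by move=> z; apply: differentiable_continuous; apply/derivable1_diffP; exact: ex_derive.
have -> : (std_cdf (s^-1 * x))%:E = (\int[mu]_(t in `]-oo, (s^-1 * x)%R]) (std_pdf t)%:E)%E.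
  by rewrite std_cdfE /Rintegral fineK//; apply: integrable_fin_num => //; exact: integrable_std_pdf.
rewrite (@increasing_ge0_integration_by_substitutionNy R (fun y => s^-1 * y)).
- rewrite /normal_prob; apply: eq_integral => t _; congr EFin.
  by rewrite normal_pdf_scale// F'.
- by move=> y z _ _ yz; rewrite ltr_pM2l.
- by move=> z _; rewrite F'; exact: cst_continuous.
- by rewrite F'; exact: is_cvg_cst.
- by rewrite F'; exact: cvg_cst.
- split; last exact: cvg_at_left_filter (cF x).
  by move=> z _; exact: ex_derive.
- apply/cvgrNyPle => A.
  have H : \forall y \near -oo, y <= s * A by exact: nbhs_ninfty_le (num_real _).
  by apply: filterS H => y yA; rewrite mulrC ler_pdivrMr// mulrC.
- by apply: continuous_subspaceT => z; exact: continuous_std_pdf.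
- by move=> z _; rewrite ltW// std_pdf_gt0.
Qed.

End normal_scaling.

Section rates.
Context {R : realType} (alpha gamma : R) (alpha_gt2 : 2 < alpha) (gammaE : gamma = 1 / alpha).
Variables (k : nat -> nat) (a : R -> R) (k_gt0 : forall n, (0 < k n)%N).
Hypothesis k_small : (k n)%:R * (ln n%:R) `^ alpha / n%:R `^ (1 / (4 * alpha + 1))
               @[n --> \oo] --> (0 : R).

Lemma tail_index_bounds : 0 < gamma /\ gamma < 1 / 2.
Proof.
have h := alpha_gt2; have a0 : 0 < alpha by lra.
by rewrite gammaE divr_gt0//; split => //; rewrite !div1r ltf_pV2 ?posrE.
Qed.

(** The logarithmic factor of the growth condition is only used through being
at least 1. *)
Lemma near_ln_k_le : \forall n \near \oo, (4 + gamma) * ln (k n)%:R <= gamma * ln n%:R.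
Proof.
have h := alpha_gt2; have a0 : 0 < alpha by lra.
have [g0 _] := tail_index_bounds.
have /cvgrPdist_le/(_ _ ltr01) H := k_small.
have [M _ hM] := H.
have [N _ hN] := near_ln_ge (1 : R).
near=> n; have Mn : (M <= n)%N by near: n; exists M.
have Nn : (N <= n)%N by near: n; exists N.
have l1 := hN n Nn; have := hM n Mn; rewrite /= sub0r normrN => /(le_trans (ler_norm _)).
have n0 : (0 : R) < n%:R by rewrite ltr0n; near: n; exists 1%N.
have kR : (0 : R) < (k n)%:R by rewrite ltr0n.
rewrite ler_pdivrMr ?powR_gt0// [X in _ <= X]mul1r => le1.
have p1 : 1 <= ln n%:R `^ alpha :> R by rewrite -[leLHS](powRr0 (ln n%:R)) ler_powR// ltW.
have : (k n)%:R <= n%:R `^ (1 / (4 * alpha + 1)) :> R.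
  by apply: le_trans le1; rewrite ler_peMr// ltW.
rewrite -ler_ln ?posrE ?powR_gt0// ln_powR.
have -> : 1 / (4 * alpha + 1) = gamma / (4 + gamma).
  by rewrite gammaE; field; rewrite !gt_eqF//; lra.
by rewrite mulrAC ler_pdivlMr 1?mulrC//; lra.
Unshelve. all: by end_near. Qed.

Let ln_ratio n : (0 < n)%N -> ln (n%:R / (k n)%:R) = ln n%:R - ln (k n)%:R :> R.
Proof. by move=> n0; rewrite ln_div ?posrE ?ltr0n. Qed.

Let ln_k_ge0 n : 0 <= ln (k n)%:R :> R.
Proof. by rewrite ln_ge0// ler1n. Qed.

Lemma near_ln_ratio_ge (M : R) : \forall n \near \oo, M <= ln (n%:R / (k n)%:R).
Proof.
have [g0 g2] := tail_index_bounds.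
near=> n; have h : (4 + gamma) * ln (k n)%:R <= gamma * ln n%:R by near: n; exact: near_ln_k_le.
have n0 : (0 < n)%N by near: n; exists 1%N.
have l1 : 2 * `|M| <= ln n%:R by near: n; exact: near_ln_ge.
rewrite ln_ratio//; apply: le_trans (ler_norm M) _.
have l0 : 0 <= ln n%:R :> R by rewrite ln_ge0// ler1n.
have k0 := ln_k_ge0 n.
have h1 : gamma * ln n%:R <= 1 / 2 * ln n%:R by rewrite ler_wpM2r// ltW.
have h2 : 0 <= gamma * ln (k n)%:R by rewrite mulr_ge0// ltW.
lra.
Unshelve. all: by end_near. Qed.

Lemma near_k_lt : \forall n \near \oo, (k n < n)%N.
Proof.
near=> n; have n0 : (0 < n)%N by near: n; exists 1%N.
have h : 1 <= ln (n%:R / (k n)%:R : R) by near: n; exact: near_ln_ratio_ge.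
move: h; rewrite ln_ratio// => h.
rewrite -(ltr_nat R) -ltr_ln ?posrE ?ltr0n//; lra.
Unshelve. all: by end_near. Qed.

Lemma k_ratio_cvg0 : (k n)%:R / n%:R @[n --> \oo] --> (0 : R).
Proof.
apply/cvgrPdist_le => e e0; near=> n.
have n0 : (0 < n)%N by near: n; exists 1%N.
have h : - ln e <= ln (n%:R / (k n)%:R : R) by near: n; exact: near_ln_ratio_ge.
rewrite sub0r normrN ger0_norm ?divr_ge0// -ler_ln ?posrE ?divr_gt0 ?ltr0n//.
by move: h; rewrite !ln_div ?posrE ?ltr0n//; lra.
Unshelve. all: by end_near. Qed.

(** The exponent in the growth condition of [k] enters here: it gives
[ln k <= gamma / (4 + gamma) * ln n], and for [gamma < 1/2] the whole quantity is
then at most a constant times [n] to the power [- gamma / 36]. *)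
Lemma near_degree_error (e r : R) : 0 < e -> e <= gamma / 10 -> 0 < r ->
  \forall n \near \oo, Num.sqrt (k n)%:R *
    (degree_error gamma e n / expR ((gamma - e) * (ln (n%:R / (k n)%:R) - 1 / 2))) <= r.
Proof.
move=> e0 e10 r0; have [g0 g2] := tail_index_bounds.
near=> n; have n0 : (0 < n)%N by near: n; exists 1%N.
have h : (4 + gamma) * ln (k n)%:R <= gamma * ln n%:R by near: n; exact: near_ln_k_le.
have l1 : (1 - ln r) * 36 / gamma <= ln n%:R by near: n; exact: near_ln_ge.
have l0 : 0 <= ln n%:R :> R by rewrite ln_ge0// ler1n.
have k0 := ln_k_ge0 n.
have -> : Num.sqrt (k n)%:R = expR (ln (k n)%:R / 2) :> R.
  have E : (k n)%:R = expR (ln (k n)%:R / 2) ^+ 2 :> R.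
    by rewrite -expRM_natl mulrC divfK// lnK// posrE ltr0n.
  by rewrite [in LHS]E sqrtr_sqr ger0_norm// expR_ge0.
rewrite /degree_error -expRN -!expRD -[leRHS]lnK ?posrE// ler_expR ln_ratio//.
move: l1; rewrite ler_pdivrMr// => l1.
set K := ln (k n)%:R in h k0 *; set l := ln n%:R in h l1 l0 *.
have c1 : gamma * K <= 1 / 2 * K by rewrite ler_wpM2r// ltW.
have c2 : e * l <= gamma / 10 * l by rewrite ler_wpM2r.
have c3 : 0 <= e * K by rewrite mulr_ge0// ltW.
have c4 : (1 / 2 + gamma) * K <= 2 / 9 * gamma * l by lra.
lra.
Unshelve. all: by end_near. Qed.

End rates.

(** * The limit law of the estimator *)

Section weak_limit.
Context {R : realType} (F : cumulativeBounded (0 : R) (1 : R)).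
Hypothesis F_continuous : continuous F.
Hypothesis F_support : forall x : R, x <= 0 -> F x = 0.
Context {d : nat -> measure_display} {T : forall n, measurableType (d n)}.
Variables (P : forall n, probability (T n) R).
Variables (W : forall n, 'I_n -> {RV (P n) >-> R}).
Arguments W : clear implicits.
Hypothesis W_law : forall n (i : 'I_n) (x : R), cdf (W n i) x = (F x)%:E.
Hypothesis W_indep : forall n, mutually_independent (W n).
Variable (A : forall n, 'I_n -> 'I_n -> {RV (P n) >-> nat}).
Arguments A : clear implicits.
Hypothesis model : (forall n, norros_reittu (W n) (A n)) \/ (forall n, chung_lu (W n) (A n)).
Variables (alpha gamma : R) (alpha_gt2 : 2 < alpha) (gammaE : gamma = 1 / alpha).
Local Notation U := (tail_quantile F).
Hypothesis U_rv : regularly_varying U gamma.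
Variables (rho : R) (a : R -> R) (rho_le0 : rho <= 0) (a_sign : constant_sign a).
Hypothesis U_second_order : second_order_condition U a gamma rho.
Variables (k : nat -> nat) (k_gt0 : forall n, (0 < k n)%N).
Hypothesis k_infty : k n @[n --> \oo] --> \oo.
Hypothesis k_small : (k n)%:R * (ln n%:R) `^ alpha / n%:R `^ (1 / (4 * alpha + 1))
               @[n --> \oo] --> (0 : R).
Hypothesis k_bias : (k n)%:R * a (n%:R / (k n)%:R) @[n --> \oo] --> (0 : R).

Local Notation X n := (@exp_rv R F d T P W n).

(** The minimum only matters for the finitely many [n <= k n]. *)
Definition spacing_count (n : nat) : nat := minn (k n).-1 n.-1.
Local Notation m := spacing_count.

Let m_le n : (m n <= n)%N.
Proof. by apply: leq_trans (geq_minr _ _) (leq_pred _). Qed.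

Let near_mS : \forall n \near \oo, (m n).+1 = k n.
Proof.
have := near_k_lt alpha_gt2 gammaE k_gt0 k_small; apply: filterS => n kn.
rewrite /m (minn_idPl _) ?prednK//.
by rewrite -!subn1 leq_sub2r// ltnW.
Qed.

Let near_m_lt : \forall n \near \oo, (m n < n)%N.
Proof.
near=> n; have e : (m n).+1 = k n by near: n; exact: near_mS.
by rewrite e ltnW//; near: n; exact: (near_k_lt alpha_gt2 gammaE k_gt0 k_small).
Unshelve. all: by end_near. Qed.

Let m_infty : m n @[n --> \oo] --> \oo.
Proof.
apply/cvgnyPge => M; have /cvgnyPge/(_ M.+1) H := k_infty.
near=> n; have e : (m n).+1 = k n by near: n; exact: near_mS.
by rewrite -ltnS e; near: n; exact: H.
Unshelve. all: by end_near. Qed.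

Let X_indep n : mutually_independent (X n).
Proof. exact: exp_rv_indep. Qed.

Let X_law n i D : measurable D -> P n (X n i @^-1` D) = exp_law D.
Proof. exact: exp_rv_law. Qed.

Let X_ge0 n i w : 0 <= X n i w.
Proof. exact: exp_rv_ge0. Qed.

Let gamma01 : 0 < gamma < 1 / 2.
Proof. by have [h1 h2] := tail_index_bounds alpha_gt2 gammaE; rewrite h1 h2. Qed.

Let spacings n w : (m n).-tuple R := top_spacings (X n) (m n) w.
Arguments spacings : clear implicits.

Let estimator n (w : T n) : R := Num.sqrt (k n)%:R * (pwm_estimator (degree (A n) w) (k n) - gamma).
Arguments estimator : clear implicits.

(* The two bounds serve [near_degree_error] and [whp_typical]. *)
Let e : R := Num.min (gamma / 10) ((1 - 2 * gamma) / 4).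

Let e_bounds : [/\ 0 < e, e <= gamma / 10, e < gamma & 2 * gamma + 4 * e <= 1].
Proof.
have /andP[g0 g2] := gamma01.
have h1 : e <= gamma / 10 by rewrite ge_min lexx.
have h2 : e <= (1 - 2 * gamma) / 4 by rewrite ge_min lexx orbT.
split=> //; [|by lra|by lra].
by rewrite lt_min !divr_gt0//; lra.
Qed.

Let C0 : R := gamma / (1 - gamma) + 1.

Lemma weight_top_ge (n : nat) (w : T n) (kn : nat) (s M : R) : regular F W w -> (0 < kn <= n)%N ->
  (forall s', M < s' -> (gamma - e) * s' <= ln (U (expR s')) <= (gamma + e) * s') ->
  M < s -> s <= order_stat (X n ^~ w) kn ->
  expR ((gamma - e) * s) <= order_stat (W n ^~ w) kn.
Proof.
move=> rw kn1 hM Ms sX.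
have [XE F1 X0] := order_stat_exp rw kn1.
rewrite XE in sX X0.
apply: le_trans (quantile_exp_coord_le F_support F1 X0).
have /andP[h _] := hM _ (lt_le_trans Ms sX).
have Up : 0 < U (expR (exp_coord F (order_stat (W n ^~ w) kn))).
  by apply: quantile_gt0 => //; rewrite expR_gt1.
rewrite -[leRHS]lnK ?posrE// ler_expR; apply: le_trans h.
have [_ _ eg _] := e_bounds.
by rewrite ler_wpM2l// subr_ge0 ltW.
Qed.

(** On the intersection of three events of high probability, on the degrees, on
the level of [E_(k)] and on the spacings, the comparison is deterministic. *)
Lemma whp_estimator_close (r : R) : 0 < r ->
  whp P (fun n => [set w | `|estimator n w - pwm_stat gamma (spacings n w)| <=
    r * (1 + `|pwm_stat gamma (spacings n w)|)]).
Proof.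
move=> r0; have /andP[g0 g2] := gamma01.
have [e0 e10 eg e4] := e_bounds.
have c0 : 0 < den_limit gamma by rewrite divr_gt0// mulr_gt0//; lra.
set c := den_limit gamma in c0.
(* [eta] bounds [sqrt k * delta] in the three requirements on [delta] of
   [estimator_deviation]; half of it is left to each of the two errors. *)
pose eta := c * Num.min (1 / 12) (r / 24).
have min0 : 0 < Num.min (1 / 12) (r / 24) by rewrite lt_min !divr_gt0.
have eta0 : 0 < eta by rewrite mulr_gt0.
have eta1 : eta <= c / 12 by rewrite ler_pM2l// ge_min div1r lexx.
have eta2 : eta <= c * (r / 24) by rewrite ler_pM2l// ge_min lexx orbT.
have Ugt0 := quantile_gt0 F_continuous F_support; have Uhomo := quantile_homo F_continuous F_support.
have [C [M1 [_ hC]]] := log_quantile_increment Ugt0 Uhomo U_rv rho_le0 a_sign U_second_order.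
have [M2 [_ hM2]] := log_growth Ugt0 Uhomo U_rv e0 eg.
have C00 : 0 < C0 by rewrite addr_gt0// divr_gt0//; lra.
have c2 : 0 < c / 2 by rewrite divr_gt0.
have H1 := whp_degree_close F_continuous F_support W_law W_indep g0 e0 eg e4 U_rv model.
have H2 := whp_order_stat X_indep X_law k_gt0 k_infty (k_ratio_cvg0 alpha_gt2 gammaE k_gt0 k_small).
have H3 := whp_top_spacings gamma01 X_indep X_law X_ge0 m_le m_infty near_m_lt c2.
have bias_lt q : 0 < q -> \forall n \near \oo, `|(k n)%:R * a (n%:R / (k n)%:R)| <= q.
  move=> q0; have /cvgrPdist_le/(_ _ q0) := k_bias.
  by apply: filterS => n'; rewrite sub0r normrN.
have C10 : 0 < `|C| + 1 by rewrite ltr_wpDl.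
pose b := Num.min (1 / 4) (eta / (8 * (1 + C0))).
have b0 : 0 < b by rewrite lt_min !divr_gt0// mulr_gt0// addr_gt0.
have q0 : 0 < b / (`|C| + 1) by rewrite divr_gt0.
have near_m : \forall n \near \oo, ((Num.truncn (2 / r)).+1 <= m n)%N.
  by move/cvgnyPge : m_infty; exact.
apply: whpS (whpI H1 (whpI H2 H3)); near=> n => w /= [[rw degc] [osk [den ex mx]]].
have mE : (m n).+1 = k n by near: n; exact: near_mS.
have mn : (m n < n)%N by near: n; exact: near_m_lt.
have m0 : (0 < m n)%N by near: n; move/cvgnyPgt : m_infty => /(_ 0%N).
have n0 : (0 : R) < n%:R by rewrite ltr0n (leq_ltn_trans _ mn).
have kR : (0 : R) < (k n)%:R by rewrite ltr0n.
have mR : (0 : R) < (m n)%:R by rewrite ltr0n.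
pose s0 : R := ln (n%:R / (k n)%:R).
have s0E : expR s0 = n%:R / (k n)%:R by rewrite lnK// posrE divr_gt0.
have s1 : M1 < s0.
  have : M1 + 1 <= s0 by rewrite /s0; near: n; exact: (near_ln_ratio_ge alpha_gt2 gammaE k_gt0 k_small).
  by apply: lt_le_trans; rewrite ltrDl.
have s2 : M2 < s0 - 1 / 2.
  have : M2 + 1 <= s0 by rewrite /s0; near: n; exact: (near_ln_ratio_ge alpha_gt2 gammaE k_gt0 k_small).
  by move=> h; lra.
have r1 : Num.sqrt (k n)%:R * (degree_error gamma e n / expR ((gamma - e) * (s0 - 1 / 2))) <= eta / 4.
  rewrite /s0; near: n; apply: (near_degree_error alpha_gt2 gammaE k_gt0 k_small) => //.
  by rewrite divr_gt0.
pose K := `|C| * `|a (expR s0)|.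
have K0 : 0 <= K by rewrite mulr_ge0.
have bias : `|(k n)%:R * a (n%:R / (k n)%:R)| <= b / (`|C| + 1) by near: n; exact: (bias_lt _ q0).
have kK : (k n)%:R * K <= b.
  rewrite normrM gtr0_norm// ler_pdivlMr// in bias.
  rewrite /K s0E; apply: le_trans bias; rewrite mulrCA mulrC ler_wpM2l ?mulr_ge0 ?(ltW kR)//.
  by rewrite lerDl.
have sq_mk : Num.sqrt (m n)%:R <= Num.sqrt (k n)%:R :> R by rewrite ler_sqrt// ler_nat -mE.
have sk1 : 1 <= Num.sqrt (k n)%:R :> R by rewrite -[leLHS](@sqrtr1 R) ler_sqrt// ler1n.
have sqk : Num.sqrt (k n)%:R * Num.sqrt (k n)%:R = (k n)%:R :> R by rewrite -expr2 sqr_sqrtr// ltW.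
set sk := Num.sqrt (k n)%:R in r1 sq_mk sk1 sqk.
set sm := Num.sqrt (m n)%:R in sq_mk.
have sm0 : 0 <= sm by exact: sqrtr_ge0.
have kK1 : sk * (K * sm) <= (k n)%:R * K.
  by rewrite -sqk mulrCA mulrC ler_wpM2r// ler_wpM2l// (le_trans ler01).
have Ksm : K * sm <= 1 / 4.
  apply: le_trans (_ : sk * (K * sm) <= _); first by rewrite ler_peMl// mulr_ge0.
  by apply: le_trans kK1 (le_trans kK _); rewrite ge_min lexx.
have Keta : sk * (K * sm) <= eta / (8 * (1 + C0)).
  by apply: le_trans kK1 (le_trans kK _); rewrite ge_min lexx orbT.
pose wk := order_stat (W n ^~ w) (m n).+1.
have mrange : (0 < (m n).+1 <= n)%N by [].
have Xk : `|order_stat (X n ^~ w) (m n).+1 - s0| <= 1 / 2 by rewrite mE.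
have wk_ge : expR ((gamma - e) * (s0 - 1 / 2)) <= wk.
  apply: (weight_top_ge rw mrange hM2 s2).
  by move: Xk; rewrite ler_norml => /andP[+ _]; rewrite lerBrDl.
have wk0 : 0 < wk by apply: lt_le_trans wk_ge; exact: expR_gt0.
have [XkE Fk Xk0] := order_stat_exp rw mrange.
have inc s y : `|s - s0| <= 1 -> - 1 <= y ->
    `|ln (U (expR (s + y))) - ln (U (expR s)) - gamma * y| <= K * expR (y / 4).
  move=> h1 h2; apply: le_trans (hC _ s1 _ _ h1 h2) _.
  by rewrite ler_wpM2r ?expR_ge0// ler_wpM2r// ler_norm.
have tE i : tnth (spacings n w) i =
    exp_coord F (order_stat (W n ^~ w) i.+1) - exp_coord F wk.
  have ir : (0 < i.+1 <= n)%N by rewrite /= (leq_trans (ltn_ord i))// ltnW.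
  have [XiE _ _] := order_stat_exp rw ir.
  by rewrite tnth_mktuple XiE XkE.
have smE : sm = expR (ln (m n)%:R / 2).
  have E : (m n)%:R = expR (ln (m n)%:R / 2) ^+ 2 :> R.
    by rewrite -expRM_natl mulrC divfK// lnK.
  by rewrite /sm [in LHS]E sqrtr_sqr ger0_norm// expR_ge0.
have quarter i : expR (tnth (spacings n w) i / 4) <= sm.
  rewrite smE ler_expR ler_pdivrMr//; apply: le_trans (mx i) _.
  by rewrite (_ : _ / 2 * 4 = 2 * ln (m n)%:R)//; field.
have ratio (i : 'I_(m n)) : `|order_stat (W n ^~ w) i.+1 / wk - expR (gamma * tnth (spacings n w) i)| <=
    4 * K * sm * expR (gamma * tnth (spacings n w) i).
  have ir : (0 < i.+1 <= n)%N by rewrite /= (leq_trans (ltn_ord i))// ltnW.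
  have [XiE Fi Xi0] := order_stat_exp rw ir.
  have q4 := quarter i; rewrite tE in q4 *.
  rewrite XkE in Xk0 Xk.
  have ord : exp_coord F wk <= exp_coord F (order_stat (W n ^~ w) i.+1).
    by rewrite -XkE -XiE; apply: order_stat_le => //; rewrite ltnS (ltnW (ltn_ord i)).
  have small : 2 * K * expR ((exp_coord F (order_stat (W n ^~ w) i.+1) - exp_coord F wk) / 4) <= 1 / 2.
    apply: le_trans (_ : 2 * (K * sm) <= _); last by lra.
    by rewrite -mulrA ler_wpM2l// ler_wpM2l.
  apply: le_trans (weight_ratio_le F_continuous F_support g0 K0 inc Fi Fk Xk0 ord Xk small) _.
  by rewrite ler_wpM2r ?expR_ge0// ler_wpM2l// mulr_ge0.
have t_dec (i j : 'I_(m n)) : (i <= j)%N -> tnth (spacings n w) j <= tnth (spacings n w) i.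
  move=> ij; rewrite !tnth_mktuple lerD2r; apply: order_stat_le => //.
  by rewrite ltnS ij (leq_trans (ltn_ord j))// ltnW.
have close kk : (0 < kk <= (m n).+1)%N ->
    `|order_stat (degree (A n) w) kk - order_stat (W n ^~ w) kk| <= degree_error gamma e n.
  move=> /andP[k1 k2]; apply: (order_stat_close degc).
  by rewrite k1 (leq_trans k2).
pose delta := 2 * degree_error gamma e n / wk + 4 * K * sm * (1 + C0).
have dle : sk * delta <= eta.
  rewrite /delta mulrDr.
  have d1 : sk * (2 * degree_error gamma e n / wk) <= eta / 2.
    apply: le_trans (_ : 2 * (eta / 4) <= _); last by lra.
    rewrite (_ : sk * _ = 2 * (sk * (degree_error gamma e n / wk))); last by ring.
    rewrite ler_wpM2l//; apply: le_trans r1; rewrite ler_wpM2l ?(le_trans ler01)//.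
    by rewrite ler_wpM2l ?expR_ge0// lef_pV2 ?posrE ?expR_gt0.
  have d2 : sk * (4 * K * sm * (1 + C0)) <= eta / 2.
    rewrite (_ : sk * _ = 4 * (1 + C0) * (sk * (K * sm))); last by ring.
    have C1 : 0 < 1 + C0 by rewrite addr_gt0.
    apply: le_trans (_ : 4 * (1 + C0) * (eta / (8 * (1 + C0))) <= _).
      by rewrite ler_wpM2l// mulr_ge0// ltW.
    by rewrite (_ : _ * _ = eta / 2)//; field; rewrite gt_eqF.
  lra.
have de0 : 0 <= delta.
  by rewrite addr_ge0// !mulr_ge0// ?expR_ge0 ?invr_ge0 ?(ltW wk0)// ltW// addr_gt0.
have dsk : delta <= sk * delta by rewrite ler_peMl.
have xi0 : 0 <= 4 * K * sm by rewrite !mulr_ge0.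
rewrite /estimator -/sk -mE.
have skE : sk = Num.sqrt (m n).+1%:R by rewrite /sk mE.
rewrite skE.
apply: (@estimator_deviation R n (m n) gamma wk (4 * K * sm) (degree_error gamma e n) C0 r
  (W n ^~ w) (degree (A n) w) (spacings n w)) => //; rewrite -/delta -/c.
- lra.
- rewrite -skE -(mulrA 20) ler_pdivrMr//; lra.
- rewrite -skE.
  have h1 : 12 * sk * delta / c <= r / 2 by rewrite -(mulrA 12) ler_pdivrMr//; lra.
  have h2 : (m n)%:R^-1 <= r / 2.
    have h : ((Num.truncn (2 / r)).+1 <= m n)%N by near: n; exact: near_m.
    rewrite -[leRHS]invf_div lef_pV2 ?posrE ?divr_gt0//.
    by apply: le_trans (ltW (truncnS_gt _)) _; rewrite ler_nat.
  lra.
Unshelve. all: by end_near. Qed.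

Lemma measurable_estimator n : measurable_fun setT (estimator n).
Proof.
have mO i : measurable_fun setT (fun w => order_stat (degree (A n) w) i).
  by apply: measurable_order_stat => j; exact: measurable_degree.
have mM q : measurable_fun setT (fun w => pwm_moment (degree (A n) w) (k n) q).
  apply: measurable_funM => //; apply: measurable_sum => i.
  by apply: measurable_funM => //; exact: measurable_funB.
apply: measurable_funM => //; apply: measurable_funB => //.
apply: measurable_funM; first by apply: measurable_funB => //; exact: measurable_funM.
apply: (measurableT_comp measurable_inv).
by apply: measurable_funB => //; exact: measurable_funM.
Qed.

Lemma estimator_cvg (x : R) : P n [set w | estimator n w <= x] @[n --> \oo] -->
  (std_cdf (den_limit gamma / Num.sqrt (score_variance gamma) * x))%:E.
Proof.
set c := den_limit gamma / _.
have clt y := top_spacings_clt (x := y) gamma01 X_indep X_law X_ge0 m_le m_infty near_m_lt.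
apply: (slutsky (S := fun n w => pwm_stat gamma (spacings n w)) (G := fun x => std_cdf (c * x))) => //.
- move=> y; have cm : {for y, continuous (fun z : R => c * z)}.
    by apply: cvgM; [exact: cvg_cst|exact: cvg_id].
  apply: (continuous_comp cm).
  apply/cvgrPdist_le => u u0; have p0 : 0 < normal_peak (1 : R) by rewrite normal_peak_gt0 ?oner_eq0.
  near=> z; apply: le_trans (std_cdf_lipschitz _ _) _.
  rewrite -ler_pdivlMl//.
  have : `|c * y - z| <= (normal_peak 1)^-1 * u.
    by near: z; apply: cvgr_dist_le => //; rewrite mulr_gt0// invr_gt0.
  by [].
- by move=> n; exact: (measurableT_comp (measurable_pwm_stat gamma (k := m n)) (measurable_top_spacings (X n) (m := m n))).
- exact: measurable_estimator.
- exact: whp_estimator_close.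
Unshelve. all: by end_near. Qed.

End weak_limit.

Theorem theorem3 (R : realType)
  (F : cumulativeBounded (0 : R) (1 : R))
  (F_continuous : continuous F)
  (F_support : forall x : R, x <= 0 -> F x = 0)
  (d : nat -> measure_display)
  (T : forall n, measurableType (d n))
  (P : forall n, probability (T n) R)
  (W : forall n, 'I_n -> {RV (P n) >-> R})
  (W_law : forall n (i : 'I_n) (x : R), cdf (W n i) x = (F x)%:E)
  (W_indep : forall n, mutually_independent (W n))
  (A : forall n, 'I_n -> 'I_n -> {RV (P n) >-> nat})
  (model : (forall n, norros_reittu (W n) (A n)) \/
           (forall n, chung_lu (W n) (A n)))
  (alpha gamma : R) (alpha_gt2 : 2 < alpha) (gammaE : gamma = 1 / alpha)
  (U_rv : regularly_varying (tail_quantile F) gamma)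
  (U_lower : exists t0 eta : R, [/\ 0 < t0, 0 <= eta < 1 &
     forall t x, t0 <= t -> 1 <= x ->
       tail_quantile F (t * x) / tail_quantile F t
         >= (1 - eta) * x `^ gamma + eta])
  (rho : R) (a : R -> R) (rho_le0 : rho <= 0) (a_sign : constant_sign a)
  (U_second_order : second_order_condition (tail_quantile F) a gamma rho)
  (k : nat -> nat) (k_gt0 : forall n, (0 < k n)%N)
  (k_infty : k n @[n --> \oo] --> \oo)
  (k_small : (k n)%:R * (ln n%:R) `^ alpha / n%:R `^ (1 / (4 * alpha + 1))
               @[n --> \oo] --> (0 : R))
  (k_bias : (k n)%:R * a (n%:R / (k n)%:R) @[n --> \oo] --> (0 : R)) :
  let tau := (1 - gamma) * (2 - gamma) ^+ 2 * (1 - gamma + 2 * gamma ^+ 2)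
             / ((1 - 2 * gamma) * (3 - 2 * gamma)) in
  cvg_in_distribution P
    (fun n w => Num.sqrt (k n)%:R *
                (pwm_estimator (degree (A n) w) (k n) - gamma))
    (normal_prob 0 (Num.sqrt tau)).
Proof.
move=> tau.
have [g0 g2] := tail_index_bounds alpha_gt2 gammaE.
have t0 : 0 < tau.
  have gg : 0 <= 2 * gamma ^+ 2 by rewrite mulr_ge0// sqr_ge0.
  by rewrite divr_gt0// !mulr_gt0// ?exprn_gt0//; lra.
have s0 : 0 < Num.sqrt tau by rewrite sqrtr_gt0.
split=> [n|x _]; first exact: measurable_estimator.
rewrite normal_prob_scale//.
have -> : (Num.sqrt tau)^-1 = den_limit gamma / Num.sqrt (score_variance gamma).
  have d0 : 0 < den_limit gamma by rewrite divr_gt0// mulr_gt0//; lra.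
  have tauE : score_variance gamma = den_limit gamma ^+ 2 * tau.
    by rewrite /score_variance /den_limit /tau; field; rewrite !gt_eqF//; lra.
  rewrite tauE (sqrtrM tau (sqr_ge0 (den_limit gamma))) sqrtr_sqr gtr0_norm// invfM mulrA mulfV ?mul1r//.
  by rewrite gt_eqF.
exact: (estimator_cvg F_continuous F_support W_law W_indep model alpha_gt2 gammaE U_rv
  rho_le0 a_sign U_second_order k_gt0 k_infty k_small k_bias).
Qed.
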